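(* For any $f\in D(L)$ the following holds: $$f\in D(L'),\qquad L'(f)=L(f).$$
   Context: Fix $\hbar\in(0,1]$; $i^{s}=e^{i\pi s/2}$, so $(2\pi i\hbar)^{-n/2}=(2\pi\hbar)^{-n/2}e^{-i\pi n/4}$. For $g\in\mathcal{S}(\mathbb{R}^n)$ and $h\in\mathcal{S}'(\mathbb{R}^n)$, $V_gh(x,\xi)$ is the Fourier transform of $h\,\overline{g(\cdot-x)}$ at $\xi$, normalized as $V_gh(x,\xi)=(2\pi\hbar)^{-n/2}\int e^{-\frac i\hbar\xi\cdot y}h(y)\overline{g(y-x)}\,dy$. $\|h\|_{M^{\infty,1}_{(g)}(\mathbb{R}^n)}=\int_{\mathbb{R}^n}\sup_x|V_gh(x,\xi)|\,d\xi$; $M^{\infty,1}(\mathbb{R}^n)$ is the space of $h\in\mathcal{S}'(\mathbb{R}^n)$ with finite norm for some (equivalently every) nonzero Schwartz window; its elements are bounded continuous functions. For $h\in M^{\infty,1}(\mathbb{R}^n)$, $L_n(h)=\widetilde{\int_{\mathbb{R}^n}}e^{\frac i{2\hbar}|x|^2}h(x)\,dx:=\lim_{\varepsilon\downarrow0}(2\pi i\hbar)^{-n/2}\int_{\mathbb{R}^n}e^{\frac i{2\hbar}|x|^2}h(x)\varphi(\varepsilon x)\,dx$, for any $\varphi\in\mathcal{S}(\mathbb{R}^n)$ with $\varphi(0)=1$ (the limit exists and is independent of $\varphi$). Fix positive reals $(q_j)_{j\in\mathbb{N}}$ with $\sum_jq_j^2<\infty$ and let $g_n(x)=(2\pi\hbar)^{-n/2}e^{-\frac1{2\hbar}\sum_{j=1}^nq_jx_j^2}$,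 $x\in\mathbb{R}^n$. $\mathbb{R}^\infty=\mathbb{R}^{\mathbb{N}}$, $\pi_n:\mathbb{R}^\infty\to\mathbb{R}^n$ is the projection on the first $n$ coordinates, and $\mathcal{E}_nh(x)=h(\pi_nx)$ for $h:\mathbb{R}^n\to\mathbb{C}$, $x\in\mathbb{R}^\infty$. $\mathcal{C}_0=\bigcup_n\mathcal{E}_nM^{\infty,1}(\mathbb{R}^n)$, with norm $\|\mathcal{E}_nh\|_{M^{\infty,1}_{(g)}(\mathbb{R}^\infty)}:=\|h\|_{M^{\infty,1}_{(g_n)}(\mathbb{R}^n)}$, and $L_{\min}:\mathcal{C}_0\to\mathbb{C}$, $L_{\min}(\mathcal{E}_nh):=L_n(h)$, for $h\in M^{\infty,1}(\mathbb{R}^n)$ (both independent of the representation; $L_{\min}$ is bounded). $D(L)=\overline{\mathcal{C}_0}$ is the set of equivalence classes of Cauchy sequences $(f_n)$ in $\mathcal{C}_0$ for this norm (equivalent when the norm of the difference tends to $0$). An element $f\in D(L)$ represented by $(f_n)$ is regarded as a function $f:\mathbb{R}^\infty\to\mathbb{C}$ via $f(x):=\lim_nf_n(x)$ (the limit exists and is independent of the representative), and $L(f):=\lim_nL_{\min}(f_n)$. For $f:\mathbb{R}^\infty\to\mathbb{C}$ and $n\in\mathbb{N}$ let $f^{(n)}(x_1,\dots,x_n)=f(x_1,\dots,x_n,0,0,\dots)$. $D(L')$ is the set of $f:\mathbb{R}^\infty\to\mathbb{C}$ such that $f^{(n)}\in M^{\infty,1}(\mathbb{R}^n)$ for every $n$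 and $\lim_nL_n(f^{(n)})$ exists and is finite; then $L'(f):=\lim_{n\to\infty}L_n(f^{(n)})$. *)

(* Defs.v *)
From HB Require Import structures.
From mathcomp Require Import all_boot all_order all_algebra.
From mathcomp Require Import all_classical all_reals all_analysis.
From mathcomp Require Export complex.

Set Implicit Arguments.
Unset Strict Implicit.
Unset Printing Implicit Defensive.

Import Order.TTheory GRing.Theory Num.Theory.
Import numFieldNormedType.Exports.

Local Open Scope classical_set_scope.
Local Open Scope ring_scope.
Local Open Scope complex_scope.

(* The topology of [R[i]] is the one induced by its modulus. *)
HB.instance Definition _ (R : realType) := NormedModule.copy R[i] R[i]^o.

(* R^n is [n.-tuple R] for measure theory and ['rV[R]_n] for everything else. *)

Definition tcons (T : Type) (n : nat) (p : T * n.-tuple T) : n.+1.-tuple T :=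
  [tuple of p.1 :: p.2].

Fixpoint lebn (R : realType) (n : nat) :
    set (n.-tuple (measurableTypeR R)) -> \bar R :=
  match n with
  | 0 => \d_[tuple]
  | m.+1 => pushforward (lebesgue_measure \x lebn (n := m))%E
              (@tcons (measurableTypeR R) m)
  end.
Arguments lebn R n : clear implicits.

Section lebn_measure.
Context (R : realType).
Let T := measurableTypeR R.

Lemma measurable_tcons (n : nat) : measurable_fun setT (@tcons T n).
Proof. by apply: measurable_cons. Qed.

Let lebnS (n : nat) (m : {sigma_finite_measure set (n.-tuple T) -> \bar R})
    : {measure set (n.+1.-tuple T) -> \bar R} :=
  measure_function_pushforward__canonical__measure_function_Measure
    (lebesgue_measure \x m)%E (@measurable_tcons n).

Let sigma_finite_lebnS (n : nat)
    (m : {sigma_finite_measure set (n.-tuple T) -> \bar R}) :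
  sigma_finite setT (lebnS m).
Proof.
have /sigma_finiteP[F [TF ndF Foo]] := sigma_finiteT (@lebesgue_measure R).
have /sigma_finiteP[G [TG ndG Goo]] := sigma_finiteT m.
exists (fun k => (fun t : n.+1.-tuple T => thead t) @^-1` F k `&`
                 (fun t : n.+1.-tuple T => behead_tuple t) @^-1` G k).
  apply/esym; rewrite -subTset => t _.
  have : (\bigcup_k F k) (thead t) by rewrite -TF.
  have : (\bigcup_k G k) (behead_tuple t) by rewrite -TG.
  move=> [i _ Gi] [j _ Fj]; exists (maxn i j) => //; split.
  - by have /subsetPset := ndF _ _ (leq_maxr i j); exact.
  - by have /subsetPset := ndG _ _ (leq_maxl i j); exact.
move=> k; have [mF Fk] := Foo k; have [mG Gk] := Goo k; split.
  apply: measurableI; rewrite -[X in measurable X]setTI.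
  - exact: (@measurable_tnth _ T n.+1 ord0 measurableT _ mF).
  - exact: (@measurable_behead _ T n measurableT _ mG).
rewrite [X in (X < _)%E](_ : _ = (lebesgue_measure \x m)%E (F k `*` G k)).
  by rewrite product_measure1E// lte_mul_pinfty// ge0_fin_numE.
rewrite /lebnS/= /pushforward; apply: congr1.
by apply/funext => -[x t]; congr (F k _ /\ G k _); exact: val_inj.
Qed.

Let lebnP (n : nat) :
  exists m : {sigma_finite_measure set (n.-tuple T) -> \bar R},
    lebn R n = m :> (set (n.-tuple T) -> \bar R).
Proof.
elim: n => [|n [m mE]]; first by exists (\d_[tuple]).
pose mS := Measure_isSigmaFinite.Build _ _ _ (lebnS m) (sigma_finite_lebnS m).
pose mu : {sigma_finite_measure set _ -> \bar R} :=
  HB.pack_for {sigma_finite_measure set (n.+1.-tuple T) -> \bar R} (Measure.sort (lebnS m)) mS.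
by exists mu; rewrite /= mE.
Qed.

Variable n : nat.

Let lebn0 : lebn R n set0 = 0%E.
Proof. by have [m ->] := lebnP n; rewrite measure0. Qed.

Let lebn_ge0 A : (0 <= lebn R n A)%E.
Proof. by have [m ->] := lebnP n. Qed.

Let lebn_sigma_additive : semi_sigma_additive (lebn R n).
Proof. by have [m ->] := lebnP n; exact: measure_semi_sigma_additive. Qed.

HB.instance Definition _ := isMeasure.Build _ _ _ (lebn R n)
  lebn0 lebn_ge0 lebn_sigma_additive.

Let lebn_sigma_finite : sigma_finite setT (lebn R n).
Proof. by have [m ->] := lebnP n; exact: sigma_finiteT. Qed.

HB.instance Definition _ := Measure_isSigmaFinite.Build _ _ _ (lebn R n)
  lebn_sigma_finite.

End lebn_measure.

Section Defs.
Context (R : realType).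

Definition cis (t : R) : R[i] := cos t +i* sin t.

Definition dot (n : nat) (x y : 'rV[R]_n) : R := \sum_(i < n) x 0 i * y 0 i.

Definition cintegral (n : nat) (f : 'rV[R]_n -> R[i]) : R[i] :=
  (\int[lebn R n]_t complex.Re (f (\row_i tnth t i))) +i*
  (\int[lebn R n]_t complex.Im (f (\row_i tnth t i))).

(* [iter_partial [:: i_1; ..; i_k] f] is d_{i_1} ... d_{i_k} f. *)
Definition iter_partial (n : nat) (s : seq 'I_n) (f : 'rV[R]_n -> R) :
    'rV[R]_n -> R :=
  foldr (fun i g => 'D_(delta_mx 0 i) g) f s.

Definition rschwartz (n : nat) (f : 'rV[R]_n -> R) : Prop :=
  forall s : seq 'I_n,
    (forall x, differentiable (iter_partial s f) x) /\
    (forall k : nat, exists C : R, forall x,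
        `|x| ^+ k * `|iter_partial s f x| <= C).

Definition schwartz (n : nat) (f : 'rV[R]_n -> R[i]) : Prop :=
  rschwartz (fun x => complex.Re (f x)) /\ rschwartz (fun x => complex.Im (f x)).

Definition stft (hbar : R) (n : nat) (g h : 'rV[R]_n -> R[i])
    (x xi : 'rV[R]_n) : R[i] :=
  ((2 * pi * hbar) `^ (- (n%:R / 2)))%:C *
  cintegral (fun y => cis (- (dot xi y / hbar)) * h y * conjc (g (y - x))).

Definition normMinf1 (hbar : R) (n : nat) (g h : 'rV[R]_n -> R[i]) : \bar R :=
  (\int[lebn R n]_t
     ereal_sup [set (Normc.normc (stft hbar g h x (\row_i tnth t i)))%:E
               | x in setT])%E.

(* The elements of M^{oo,1}(R^n), a priori tempered distributions, are
   identified with the bounded continuous functions representing them. *)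
Definition Minf1 (hbar : R) (n : nat) (h : 'rV[R]_n -> R[i]) : Prop :=
  [/\ continuous h,
      exists C : R, forall x, Normc.normc (h x) <= C &
      exists g, [/\ schwartz g, exists x, g x != 0 &
                    (normMinf1 hbar g h < +oo)%E]].

(* The prefactor is (2 pi i hbar)^(-n/2) with i^s = e^(i pi s / 2). *)
Definition fresnel_approx (hbar : R) (n : nat) (h phi : 'rV[R]_n -> R[i])
    (eps : R) : R[i] :=
  ((2 * pi * hbar) `^ (- (n%:R / 2)))%:C * cis (- (pi * n%:R / 4)) *
  cintegral (fun x => cis (dot x x / (2 * hbar)) * h x * phi (eps *: x)).

(* The common value, over all cutoffs [phi], of the limit as eps -> 0+. *)
Definition fresnel (hbar : R) (n : nat) (h : 'rV[R]_n -> R[i]) : R[i] :=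
  xget 0 [set z | forall phi, schwartz phi -> phi 0 = 1 ->
    fresnel_approx hbar h phi eps @[eps --> 0^'+] --> z].

(* R^oo is [nat -> R]: coordinates are numbered from 0, while finite dimensions
   are at least 1. *)

Definition window (hbar : R) (q : nat -> R) (n : nat) (x : 'rV[R]_n) : R[i] :=
  ((2 * pi * hbar) `^ (- (n%:R / 2)) *
   expR (- ((\sum_(j < n) q j * x 0 j ^+ 2) / (2 * hbar))))%:C.

Definition projn (n : nat) (x : nat -> R) : 'rV[R]_n := \row_(i < n) x i.

Definition cyl (n : nat) (h : 'rV[R]_n -> R[i]) : (nat -> R) -> R[i] :=
  fun x => h (projn n x).

Definition represents (hbar : R) (f : (nat -> R) -> R[i])
    (n : nat) (h : 'rV[R]_n -> R[i]) : Prop :=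
  [/\ (0 < n)%N, Minf1 hbar h & f = cyl h].

Definition C0 (hbar : R) (f : (nat -> R) -> R[i]) : Prop :=
  exists n (h : 'rV[R]_n -> R[i]), represents hbar f h.

(* The common value over all representations of [f]. *)
Definition C0norm (hbar : R) (q : nat -> R) (f : (nat -> R) -> R[i]) : \bar R :=
  xget 0%E [set r | forall n (h : 'rV[R]_n -> R[i]), represents hbar f h ->
    r = normMinf1 hbar (@window hbar q n) h].

Definition Lmin (hbar : R) (f : (nat -> R) -> R[i]) : R[i] :=
  xget 0 [set z | forall n (h : 'rV[R]_n -> R[i]), represents hbar f h ->
    z = fresnel hbar h].

Definition C0cauchy (hbar : R) (q : nat -> R) (u : nat -> (nat -> R) -> R[i]) :
    Prop :=
  (forall k, C0 hbar (u k)) /\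
  forall e : R, 0 < e -> exists N : nat, forall k l : nat,
    (N <= k)%N -> (N <= l)%N -> (C0norm hbar q (u k \- u l)%R < e%:E)%E.

Definition C0equiv (hbar : R) (q : nat -> R) (u v : nat -> (nat -> R) -> R[i]) :
    Prop :=
  C0norm hbar q (u k \- v k)%R @[k --> \oo] --> 0%E.

Definition DL (hbar : R) (q : nat -> R)
    (F : set (nat -> (nat -> R) -> R[i])) : Prop :=
  exists2 u, C0cauchy hbar q u &
    F = [set v | C0cauchy hbar q v /\ C0equiv hbar q u v].

(* The common value of the limit over all representatives of the class. *)
Definition DLfun (F : set (nat -> (nat -> R) -> R[i])) (x : nat -> R) : R[i] :=
  xget 0 [set z | forall u, F u -> u k x @[k --> \oo] --> z].

Definition L (hbar : R) (F : set (nat -> (nat -> R) -> R[i])) : R[i] :=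
  xget 0 [set z | forall u, F u -> Lmin hbar (u k) @[k --> \oo] --> z].

Definition cutoff (n : nat) (f : (nat -> R) -> R[i]) : 'rV[R]_n -> R[i] :=
  fun x => f (fun k => if insub k is Some i then x 0 i else 0).

Definition DL' (hbar : R) (f : (nat -> R) -> R[i]) : Prop :=
  (forall n, (0 < n)%N -> Minf1 hbar (@cutoff n f)) /\
  cvg (fresnel hbar (@cutoff n f) @[n --> \oo]).

Definition L' (hbar : R) (f : (nat -> R) -> R[i]) : R[i] :=
  lim (fresnel hbar (@cutoff n f) @[n --> \oo]).

End Defs.

(* Main.v *)
(* For a window g with short-time Fourier transform V = V_g h and
   D = int e^{-i|z|^2/(2 hbar)} conj(g(z)) dz, Fubini and the Fourier inversion of
   the cutoff phi give
     L_n(h) D = e^{-i pi n/4} int e^{-i|xi|^2/(2 hbar)} V(-xi, xi) dxi.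
   For g = g_n one finds |D| = prod_j (1 + q_j^2)^{-1/4}, hence
   |L_n(h)| <= exp(sum_j q_j^2 / 4) ||h||, uniformly in n.

   Adding a dummy variable changes neither the norm nor L_n (the latter because
   atan q + atan (1/q) = pi/2), and setting the last variable to 0 does not
   increase the norm. So if (u_l) is a Cauchy sequence representing f, with
   ||u_k - u_l|| < e for k, l >= N, Fatou's lemma gives
   ||f^(n) - u_l^(n)|| <= e for all n and all l >= N, whence
   |L_n(f^(n)) - Lmin(u_l)| <= C e as soon as n is at least the number of variables
   of u_l. Let n, and then l, tend to infinity. *)
Require Import Defs.
From HB Require Import structures.
From mathcomp Require Import all_boot all_order all_algebra.
From mathcomp Require Import all_classical all_reals all_analysis.
From mathcomp Require Import measurable_realfun ring lra.
Set Implicit Arguments.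
Unset Strict Implicit.
Unset Printing Implicit Defensive.
Import Order.TTheory GRing.Theory Num.Theory.
Import numFieldNormedType.Exports.
Local Open Scope classical_set_scope.
Local Open Scope ring_scope.
Local Open Scope complex_scope.

(** The norm and [Lmin] on cylindrical functions are [xget] values common to all representations, so
    they must be shown well defined, and the limits need constants that do not grow with n. The
    prefactor of g_n makes this work: g_n(0) equals the constant of the transform, so Fourier
    inversion in one variable at the origin costs a factor 1, and a dummy variable contributes a
    function of mass 1. Only 1/|D| accumulates over the variables, and there the summability of
    q_j^2 enters.

    The formula for L_n rests on |y|^2 - |xi + y|^2 = -|xi|^2 - 2 xi.y: a chirp times a translated
    conjugate chirp is a character in y, so the integral over y is a short-time transform, centred
    at -xi. Its use with g = g_n requires a finite norm for g_n, while [Minf1] only provides some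
    Schwartz window. Hence a change of window is needed, and only towards Gaussians, where
    completing a square suffices.

    The limit f need not be cylindrical, and f^(n) is known only as a pointwise limit of the
    u_k^(n). Its norm can therefore be reached only through lower semicontinuity. *)

Notation normc := Normc.normc.
Notation Re := complex.Re.
Notation Im := complex.Im.

(** * Complex numbers *)

Section complex_numbers.
Context {R : realType}.
Implicit Types (z w : R[i]) (r t : R).

Lemma normc_ge0 z : 0 <= normc z.
Proof. by case: z => a b; exact: sqrtr_ge0. Qed.

Lemma normc_R r : normc r%:C = `|r|.
Proof. by rewrite /= expr0n addr0 sqrtr_sqr. Qed.

Lemma ReD z w : Re (z + w) = Re z + Re w. Proof. by case: z; case: w. Qed.
Lemma ImD z w : Im (z + w) = Im z + Im w. Proof. by case: z; case: w. Qed.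
Lemma ReN z : Re (- z) = - Re z. Proof. by case: z. Qed.
Lemma ImN z : Im (- z) = - Im z. Proof. by case: z. Qed.
Lemma ReB z w : Re (z - w) = Re z - Re w. Proof. by rewrite ReD ReN. Qed.
Lemma ImB z w : Im (z - w) = Im z - Im w. Proof. by rewrite ImD ImN. Qed.
Lemma ReM z w : Re (z * w) = Re z * Re w - Im z * Im w.
Proof. by case: z; case: w. Qed.
Lemma ImM z w : Im (z * w) = Re z * Im w + Im z * Re w.
Proof. by case: z; case: w. Qed.
Lemma Re_conjc z : Re (conjc z) = Re z. Proof. by case: z. Qed.
Lemma Im_conjc z : Im (conjc z) = - Im z. Proof. by case: z. Qed.

Lemma complex_ext z w : Re z = Re w -> Im z = Im w -> z = w.
Proof. by case: z => a b; case: w => c d /= -> ->. Qed.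

Lemma normc_sqr z : normc z ^+ 2 = Re z ^+ 2 + Im z ^+ 2.
Proof. by case: z => a b; rewrite /= sqr_sqrtr// addr_ge0// sqr_ge0. Qed.

Lemma Re_le_normc z : `|Re z| <= normc z.
Proof.
rewrite -(ler_pXn2r (n := 2)) ?nnegrE ?normc_ge0// normc_sqr real_normK ?num_real//.
by rewrite lerDl sqr_ge0.
Qed.

Lemma Im_le_normc z : `|Im z| <= normc z.
Proof.
rewrite -(ler_pXn2r (n := 2)) ?nnegrE ?normc_ge0// normc_sqr real_normK ?num_real//.
by rewrite lerDr sqr_ge0.
Qed.

Lemma normc_le z : normc z <= `|Re z| + `|Im z|.
Proof.
rewrite -(ler_pXn2r (n := 2)) ?nnegrE ?normc_ge0 ?addr_ge0// normc_sqr sqrrD.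
by rewrite !real_normK ?num_real// -addrA lerD2l lerDr mulrn_wge0// mulr_ge0.
Qed.

Lemma normc_conjc z : normc (conjc z) = normc z.
Proof. by case: z => a b /=; rewrite sqrrN. Qed.

Lemma normcB_sym z w : normc (z - w) = normc (w - z).
Proof. by rewrite -normcN opprB. Qed.

Lemma normc_eq0P z : normc z = 0 -> z = 0. Proof. exact: Normc.eq0_normc. Qed.

Lemma normcM z w : normc (z * w) = normc z * normc w.
Proof. exact: Normc.normcM. Qed.

Lemma normcV z : normc z^-1 = (normc z)^-1.
Proof. exact: Normc.normcV. Qed.

Lemma cisD s t : cis (s + t) = cis s * cis t :> R[i].
Proof.
by rewrite /cis sinD cosD; apply: complex_ext; rewrite /= // addrC.
Qed.

Lemma cis0 : cis 0 = 1 :> R[i]. Proof. by rewrite /cis cos0 sin0. Qed.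

Lemma normc_cis t : normc (cis t) = 1.
Proof. by rewrite /cis /= cos2Dsin2 sqrtr1. Qed.

Lemma cis_neq0 t : cis t != 0.
Proof.
apply/eqP => /(congr1 (@Normc.normc R)); rewrite normc_cis Normc.normc0.
by move/eqP; rewrite oner_eq0.
Qed.

Lemma cvg_normcP (I : Type) (F : set_system I) {FF : Filter F} (f : I -> R[i]) z :
  f @ F --> z <-> (fun i => normc (f i - z)) @ F --> 0.
Proof.
split.
- move=> /cvgrPdist_lt h; apply/cvgrPdist_lt => e e0.
  have e0' : (0 : R[i]) < e%:C by rewrite ltcR.
  apply: filterS (h _ e0') => i /= H.
  rewrite sub0r normrN ger0_norm ?normc_ge0// normcB_sym.
  by rewrite -ltcR; exact: H.
(* Radii in [R[i]] are complex numbers; a positive one has zero imaginary part. *)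
- move=> /cvgrPdist_lt h; apply/cvgrPdist_lt => -[e e'].
  rewrite ltcE/= => /andP[/eqP -> e0].
  apply: filterS (h _ e0) => i /= H.
  move: H; rewrite sub0r normrN ger0_norm ?normc_ge0// normcB_sym -ltcR.
  exact.
Qed.

Lemma cvg_dist_le (I : Type) (F : set_system I) {FF : Filter F} (f g : I -> R) (l : R) :
  (forall i, `|f i - l| <= g i) -> g @ F --> 0 -> f @ F --> l.
Proof.
move=> fg /cvgrPdist_lt g0; apply/cvgrPdist_lt => e e0.
apply: filterS (g0 _ e0) => i /= H; rewrite distrC (le_lt_trans (fg i))//.
by move: H; rewrite sub0r normrN; exact/le_lt_trans/ler_norm.
Qed.

Lemma cvg_complexP (I : Type) (F : set_system I) {FF : Filter F} (f : I -> R[i]) z :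
  f @ F --> z <-> ((fun i => Re (f i)) @ F --> Re z) /\ ((fun i => Im (f i)) @ F --> Im z).
Proof.
rewrite cvg_normcP; split.
- move=> h; split; apply: (cvg_dist_le _ h) => i.
  + by rewrite -ReB Re_le_normc.
  + by rewrite -ImB Im_le_normc.
- have norm0 (u : I -> R) l : u @ F --> l -> (fun i => `|u i - l|) @ F --> 0.
    move=> ul; rewrite -(normr0 R) -(subrr l).
    by apply: cvg_norm; apply: cvgB => //; exact: cvg_cst.
  move=> [/norm0 h1 /norm0 h2].
  have : (fun i => `|Re (f i) - Re z| + `|Im (f i) - Im z|) @ F --> 0.
    by rewrite -(addr0 0); exact: cvgD.
  apply: cvg_dist_le => i.
  by rewrite subr0 ger0_norm ?normc_ge0// -ReB -ImB normc_le.
Qed.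

End complex_numbers.

(** * Lebesgue measure on row vectors *)

Section row_measurable.
Context {R : realType} {n : nat}.

Definition tuple_row (t : n.-tuple (measurableTypeR R)) : 'rV[R]_n := \row_i tnth t i.
Definition row_tuple (x : 'rV[R]_n) : n.-tuple (measurableTypeR R) := [tuple x 0 i | i < n].

Lemma tuple_rowK : cancel tuple_row row_tuple.
Proof. by move=> t; apply/eq_from_tnth => i; rewrite tnth_mktuple mxE. Qed.

Lemma row_tupleK : cancel row_tuple tuple_row.
Proof. by move=> x; apply/rowP => i; rewrite mxE tnth_mktuple. Qed.

(** The sigma-algebra is transported from tuples, so that [leb] is a mere pushforward of [lebn]. Its
    relation to the topology of ['rV[R]_n] is then a separate question, settled by
    [continuous_measurable_row]. *)
Definition row_measurable : set (set 'rV[R]_n) :=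
  [set A | measurable (tuple_row @^-1` A)].

Lemma row_measurable0 : row_measurable set0.
Proof. by rewrite /row_measurable /= preimage_set0. Qed.

Lemma row_measurableC A : row_measurable A -> row_measurable (~` A).
Proof. by rewrite /row_measurable /= preimage_setC; exact: measurableC. Qed.

Lemma row_measurable_bigcup (F : (set 'rV[R]_n)^nat) :
  (forall i, row_measurable (F i)) -> row_measurable (\bigcup_i F i).
Proof.
by move=> mF; rewrite /row_measurable /= preimage_bigcup; exact: bigcupT_measurable.
Qed.

HB.instance Definition _ := @isMeasurable.Build default_measure_display 'rV[R]_n
  row_measurable row_measurable0 row_measurableC row_measurable_bigcup.

Lemma measurable_tuple_row : measurable_fun setT tuple_row.
Proof. by move=> _ A mA; rewrite setTI. Qed.

Lemma measurable_row_tuple : measurable_fun setT row_tuple.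
Proof.
move=> _ A mA; rewrite setTI; rewrite /measurable /= /row_measurable /=.
rewrite -comp_preimage (_ : _ \o _ = id) ?preimage_id//.
by apply/funext => t /=; rewrite tuple_rowK.
Qed.

Lemma measurable_coord i : measurable_fun setT (fun x : 'rV[R]_n => x 0 i).
Proof.
rewrite (_ : (fun _ => _) = (@tnth n (measurableTypeR R))^~ i \o row_tuple).
  by apply: measurableT_comp; [exact: measurable_tnth|exact: measurable_row_tuple].
by apply/funext => x /=; rewrite tnth_mktuple.
Qed.

Lemma measurable_rowP d (T : measurableType d) (f : T -> 'rV[R]_n) :
  (forall i, measurable_fun setT (fun x => f x 0 i)) -> measurable_fun setT f.
Proof.
move=> mf; rewrite (_ : f = tuple_row \o (row_tuple \o f)); last first.
  by apply/funext => x /=; rewrite row_tupleK.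
apply: measurableT_comp; first exact: measurable_tuple_row.
apply/measurable_fun_tnthP => i.
apply: eq_measurable_fun (mf i) => x _ /=.
by rewrite tnth_mktuple.
Qed.

Definition leb : set 'rV[R]_n -> \bar R := pushforward (lebn R n) tuple_row.

Let lebm : {measure set 'rV[R]_n -> \bar R} :=
  measure_function_pushforward__canonical__measure_function_Measure
    (lebn R n) measurable_tuple_row.

HB.instance Definition _ := isMeasure.Build _ _ _ leb
  (measure0 lebm) (measure_ge0 lebm) (@measure_semi_sigma_additive _ _ _ lebm).

Let leb_sigma_finite : sigma_finite setT leb.
Proof.
have /sigma_finiteP[F [TF _ Foo]] := sigma_finiteT (lebn R n).
exists (fun k => row_tuple @^-1` F k).
  by rewrite -preimage_bigcup -TF preimage_setT.
move=> k; have [mF Fk] := Foo k; split.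
  by rewrite -[X in measurable X]setTI; exact: measurable_row_tuple.
rewrite /leb /pushforward -comp_preimage (_ : _ \o _ = id) ?preimage_id//.
by apply/funext => t /=; rewrite tuple_rowK.
Qed.

HB.instance Definition _ := Measure_isSigmaFinite.Build _ _ _ leb leb_sigma_finite.

Lemma ge0_integral_leb (f : 'rV[R]_n -> \bar R) :
  measurable_fun setT f -> (forall x, 0 <= f x)%E ->
  (\int[leb]_x f x = \int[lebn R n]_t f (tuple_row t))%E.
Proof.
move=> mf f0; rewrite ge0_integral_pushforward//.
exact: measurable_tuple_row.
Qed.

End row_measurable.
Arguments leb R n : clear implicits.

Section continuous_measurable.
Context {R : realType} {n : nat}.

Definition grid (k : nat) (x : 'rV[R]_n) : 'rV[int]_n :=
  \row_i Num.floor (k.+1%:R * x 0 i).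
Definition grid_point (k : nat) (z : 'rV[int]_n) : 'rV[R]_n :=
  \row_i ((z 0 i)%:~R / k.+1%:R).

Let measurable_grid k (A : set 'rV[int]_n) : measurable (grid k @^-1` A).
Proof.
rewrite (_ : _ @^-1` _ = \bigcup_(z in A) (grid k @^-1` [set z])); last first.
  apply/seteqP; split=> [x Ax|x [z Az xz]]; first by exists (grid k x).
  by rewrite /preimage /=; move: xz => /= ->.
have -> : \bigcup_(z in A) (grid k @^-1` [set z]) =
    \bigcup_z (if z \in A then grid k @^-1` [set z] else set0).
  apply/seteqP; split=> [x [z Az xz]|x [z _]].
    by exists z => //; rewrite mem_set.
  by case: ifPn => // /set_mem Az xz; exists z.
apply: countable_bigcupT_measurable => [|z]; first exact: countableP.
case: ifP => // _.
rewrite (_ : _ @^-1` _ = \bigcap_(i in [set: 'I_n])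
    ((fun x : 'rV[R]_n => x 0 i) @^-1`
       `[(z 0 i)%:~R / k.+1%:R, (z 0 i + 1)%:~R / k.+1%:R[)).
  apply: fin_bigcap_measurable => // i _.
  by rewrite -[X in measurable X]setTI; exact: measurable_coord.
have fE i (x : 'rV[R]_n) : (Num.floor (k.+1%:R * x 0 i) == z 0 i) =
    (x 0 i \in `[(z 0 i)%:~R / k.+1%:R, (z 0 i + 1)%:~R / k.+1%:R[).

 rewrite floor_eq in_itv /= ler_pdivrMr ?ltr_pdivlMr//.
  by rewrite !(mulrC k.+1%:R).
apply/seteqP; split=> [x xz i _|x xz] /=.
  by rewrite -fE; apply/eqP; rewrite -xz mxE.
by apply/rowP => i; rewrite mxE; apply/eqP; rewrite fE; exact: xz.
Qed.

Lemma cvg_grid_point x : grid_point k (grid k x) @[k --> \oo] --> x.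
Proof.
apply/cvgrPdist_lt => e e0; near=> k.
have k1 : 0 < k.+1%:R :> R by [].
rewrite /Num.norm /= mx_normrE; apply/bigmax_ltP; split=> // -[i j] _ /=.
rewrite ord1 !mxE /= -(@ltr_pM2l _ k.+1%:R)// -{1}(ger0_norm (ltW k1)) -normrM.
rewrite mulrBr mulrCA divff ?gt_eqF// mulr1.
set y := _ * x 0 j; have /andP[y1 y2] := floor_itv y.
rewrite ger0_norm ?subr_ge0// ltrBlDl (lt_trans y2)// intrD ltrD2l.
rewrite mulrC -ltr_pdivrMr// div1r.
by near: k; apply: (near_infty_natSinv_lt (PosNum e0)).
Unshelve. all: by end_near. Qed.

(** [f] is the pointwise limit of its values at the grid points of mesh 1/(k+1). Each approximant
    factors through the countable type of integer vectors, all of whose subsets have measurable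
    preimages, so no comparison of Borel and product sigma-algebras is required. *)
Lemma continuous_measurable_row (f : 'rV[R]_n -> R) :
  continuous f -> measurable_fun setT f.
Proof.
move=> cf; apply: (measurable_fun_cvg (h := fun k => f \o grid_point k \o grid k)).
- by move=> k _ A mA; rewrite setTI comp_preimage; exact: measurable_grid.
- by move=> x _; apply: cvg_comp; [exact: cvg_grid_point|exact: cf].
Qed.

End continuous_measurable.

Section cons_rcons.
Context {R : realType}.

Definition row_cons n (x : R) (t : 'rV[R]_n) : 'rV[R]_n.+1 :=
  \row_i if unlift ord0 i is Some j then t 0 j else x.

(** [lebn] grows at the front, whereas variables of cylindrical functions are added and dropped at
    the end; hence both insertions, reconciled by [ge0_integral_row_rcons]. *)
Definition row_rcons n (t : 'rV[R]_n) (x : R) : 'rV[R]_n.+1 :=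
  \row_i if unlift ord_max i is Some j then t 0 j else x.

Lemma row_cons0 n (x : R) (t : 'rV[R]_n) : row_cons x t 0 ord0 = x.
Proof. by rewrite mxE unlift_none. Qed.

Lemma row_consS n (x : R) (t : 'rV[R]_n) j : row_cons x t 0 (lift ord0 j) = t 0 j.
Proof. by rewrite mxE liftK. Qed.

Lemma row_rcons_max n (t : 'rV[R]_n) (x : R) : row_rcons t x 0 ord_max = x.
Proof. by rewrite mxE unlift_none. Qed.

Lemma row_rcons_widen n (t : 'rV[R]_n) (x : R) j :
  row_rcons t x 0 (lift ord_max j) = t 0 j.
Proof. by rewrite mxE liftK. Qed.

Lemma row_consP n (x : R) (t : 'rV[R]_n) (y : 'rV[R]_n.+1) :
  y 0 ord0 = x -> (forall j, y 0 (lift ord0 j) = t 0 j) -> row_cons x t = y.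
Proof.
move=> yx yt; apply/rowP => i; case: (unliftP ord0 i) => [j|] ->.
  by rewrite row_consS yt.
by rewrite row_cons0 yx.
Qed.

Lemma row_rconsP n (x : R) (t : 'rV[R]_n) (y : 'rV[R]_n.+1) :
  y 0 ord_max = x -> (forall j, y 0 (lift ord_max j) = t 0 j) -> row_rcons t x = y.
Proof.
move=> yx yt; apply/rowP => i; case: (unliftP ord_max i) => [j|] ->.
  by rewrite row_rcons_widen yt.
by rewrite row_rcons_max yx.
Qed.

Lemma row_cons_rcons n (x y : R) (t : 'rV[R]_n) :
  row_cons x (row_rcons t y) = row_rcons (row_cons x t) y.
Proof.
apply: row_consP => [|j].
  have -> : ord0 = lift ord_max ord0 :> 'I_n.+2 by apply/val_inj.
  by rewrite row_rcons_widen row_cons0.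
case: (unliftP ord_max j) => [i|] ->; last first.
  have -> : lift ord0 ord_max = ord_max :> 'I_n.+2 by apply/val_inj.
  by rewrite !row_rcons_max.
have -> : lift ord0 (lift ord_max i) = lift ord_max (lift ord0 i) :> 'I_n.+2.
  apply/val_inj; rewrite /= /bump !leq0n (leqNgt n) ltn_ord add0n add1n.
  by rewrite ltnS leqNgt ltn_ord.
by rewrite !row_rcons_widen row_consS.
Qed.

Lemma measurable_row_cons n :
  measurable_fun setT (fun p : measurableTypeR R * 'rV[R]_n => row_cons p.1 p.2).
Proof.
apply: measurable_rowP => i; case: (unliftP ord0 i) => [j|] ->.
  under eq_fun do rewrite row_consS.
  by apply: (measurableT_comp (measurable_coord j)); exact: measurable_snd.
by under eq_fun do rewrite row_cons0; exact: measurable_fst.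
Qed.

Lemma measurable_row_consr n (x : R) : measurable_fun setT (@row_cons n x).
Proof.
apply: measurable_rowP => i; case: (unliftP ord0 i) => [j|] ->.
  by under eq_fun do rewrite row_consS; exact: measurable_coord.
by under eq_fun do rewrite row_cons0; exact: measurable_cst.
Qed.

Lemma measurable_row_rcons n :
  measurable_fun setT (fun p : 'rV[R]_n * measurableTypeR R => row_rcons p.1 p.2).
Proof.
apply: measurable_rowP => i; case: (unliftP ord_max i) => [j|] ->.
  under eq_fun do rewrite row_rcons_widen.
  by apply: (measurableT_comp (measurable_coord j)); exact: measurable_fst.
by under eq_fun do rewrite row_rcons_max; exact: measurable_snd.
Qed.

Local Open Scope ereal_scope.

Lemma ge0_integral_leb0 (f : 'rV[R]_0 -> \bar R) (x : 'rV[R]_0) : (forall x, 0 <= f x) ->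
  \int[leb R 0]_x f x = f x.
Proof.
move=> f0; have f_cst y : f y = f x by congr f; apply/rowP => -[].
have -> : f = cst (f x) by apply/funext => y; rewrite f_cst.
have leb0T : leb R 0 setT = 1 by rewrite /leb /pushforward /= diracT.
by rewrite integral_cst// [X in _ * X]leb0T mule1.
Qed.

Lemma ge0_integral_row_cons n (f : 'rV[R]_n.+1 -> \bar R) :
  measurable_fun setT f -> (forall x, 0 <= f x) ->
  \int[leb R n.+1]_x f x =
  \int[lebesgue_measure]_x \int[leb R n]_t f (row_cons x t).
Proof.
move=> mf f0; rewrite ge0_integral_leb//=.
have mt : measurable_fun setT (@tuple_row R n.+1) := measurable_tuple_row.
have mc := @measurable_tcons R n.
have mft : measurable_fun setT (f \o @tuple_row R n.+1) by exact: measurableT_comp.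
have := @ge0_integral_pushforward _ _ _ _ R _ mc
  (lebesgue_measure \x lebn R n)%E setT _ measurableT mft (fun y _ => f0 _).
rewrite preimage_setT => ->.
rewrite fubini_tonelli1; last 2 first.
- exact: measurableT_comp mft mc.
- by move=> p; exact: f0.
apply: eq_integral => x _; rewrite ge0_integral_leb//; last first.
  exact: (measurableT_comp mf (@measurable_row_consr _ x)).
apply: eq_integral => t _ /=; congr f.
apply/esym/row_consP => [|j]; rewrite !mxE.
  by rewrite (tnth_nth 0%R).
by rewrite !(tnth_nth 0%R).
Qed.

(** Induction on [n]: the first coordinate is peeled off on both sides and the last one is isolated
    in what remains, the two insertions commuting. In dimension one they coincide. *)
Lemma ge0_integral_row_rcons n (f : 'rV[R]_n.+1 -> \bar R) :
  measurable_fun setT f -> (forall x, 0 <= f x) ->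
  \int[leb R n.+1]_x f x =
  \int[leb R n]_t \int[lebesgue_measure]_x f (row_rcons t x).
Proof.
elim: n => [|n IHn] in f *; move=> mf f0.
  rewrite ge0_integral_row_cons// [RHS](@ge0_integral_leb0 _ 0)//; last first.
    by move=> t; exact: integral_ge0.
  apply: eq_integral => x _; rewrite (@ge0_integral_leb0 _ 0)//; congr f.
  apply: row_consP => [|[]//].
  by rewrite (_ : ord0 = ord_max) ?row_rcons_max//; exact/val_inj.
rewrite ge0_integral_row_cons// ge0_integral_row_cons//; last 2 first.
- apply: (@measurable_fun_fubini_tonelli_F _ _ _ _ _ lebesgue_measure
    (fun p : 'rV[R]_n.+1 * measurableTypeR R => f (row_rcons p.1 p.2))) => //.
  by apply: measurableT_comp => //; exact: measurable_row_rcons.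
- by move=> x; exact: integral_ge0.
apply: eq_integral => x _; rewrite IHn//; last first.
  exact: (measurableT_comp mf (@measurable_row_consr _ x)).
apply: eq_integral => t _; apply: eq_integral => y _.
by rewrite row_cons_rcons.
Qed.

End cons_rcons.

(** * Integrals of complex functions *)

Section complex_measurable.
Context d (T : measurableType d) {R : realType}.
Implicit Types f g : T -> R[i].

Definition cmeas f :=
  measurable_fun setT (fun x => Re (f x)) /\ measurable_fun setT (fun x => Im (f x)).

Lemma cmeasM f g : cmeas f -> cmeas g -> cmeas (fun x => f x * g x).
Proof.
move=> [fr fi] [gr gi]; split.
  by under eq_fun do rewrite ReM; apply: measurable_funB; exact: measurable_funM.
by under eq_fun do rewrite ImM; apply: measurable_funD; exact: measurable_funM.
Qed.

Lemma cmeas_conj f : cmeas f -> cmeas (fun x => conjc (f x)).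
Proof.
move=> [fr fi]; split.
  by under eq_fun do rewrite Re_conjc.
by under eq_fun do rewrite Im_conjc; exact: measurable_funN.
Qed.

Lemma cmeas_cst (c : R[i]) : cmeas (fun=> c).
Proof. by split; exact: measurable_cst. Qed.

Lemma cmeas_real (f : T -> R) : measurable_fun setT f -> cmeas (fun x => (f x)%:C).
Proof. by move=> mf; split => //; exact: measurable_cst. Qed.

Lemma cmeas_cis (f : T -> R) : measurable_fun setT f -> cmeas (fun x => cis (f x)).
Proof.
move=> mf; split; rewrite /cis /=.
  exact: (measurableT_comp (continuous_measurable_fun (@continuous_cos R)) mf).
exact: (measurableT_comp (continuous_measurable_fun (@continuous_sin R)) mf).
Qed.

Lemma measurable_normc f : cmeas f -> measurable_fun setT (fun x => normc (f x)).
Proof.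
have normcE z : normc z = Num.sqrt (Re z ^+ 2 + Im z ^+ 2) :> R.
  by case: z => a b /=.
move=> [fr fi]; under eq_fun do rewrite normcE.
apply: (measurableT_comp (continuous_measurable_fun (@sqrt_continuous R))).
by apply: measurable_funD; exact: measurable_funX.
Qed.

End complex_measurable.

Lemma cmeas_comp d d' (T : measurableType d) (X : measurableType d') (R : realType)
    (phi : X -> T) (f : T -> R[i]) :
  measurable_fun setT phi -> cmeas f -> cmeas (fun x => f (phi x)).
Proof.
by move=> mphi [fr fi]; split; [exact: (measurableT_comp fr mphi)|exact: (measurableT_comp fi mphi)].
Qed.

Section complex_integral.
Context d (T : measurableType d) {R : realType} (mu : {measure set T -> \bar R}).
Implicit Types f g : T -> R[i].

Definition cint f : R[i] := (\int[mu]_x Re (f x)) +i* (\int[mu]_x Im (f x)).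

Definition cintegrable f := cmeas f /\ (\int[mu]_x (normc (f x))%:E < +oo)%E.

Lemma cintegrable_norm f : cintegrable f ->
  mu.-integrable setT (EFin \o (fun x => normc (f x))).
Proof.
move=> [mf ioo]; have mn : measurable_fun setT (EFin \o (fun x => normc (f x))).
  exact/measurable_EFinP/measurable_normc.
apply/integrableP; split => //.
apply: le_lt_trans ioo; apply: ge0_le_integral => //=.
- exact: (measurableT_comp (@abse_measurable R setT) mn).
- by move=> x _; rewrite lee_fin ger0_norm// normc_ge0.
Qed.

Lemma cintegrable_le f (g : T -> R) : cmeas f -> (forall x, normc (f x) <= g x) ->
  mu.-integrable setT (EFin \o g) -> cintegrable f.
Proof.
move=> mf fg ig; split => //.
have /integrableP[mg] := ig; apply: le_lt_trans; apply: ge0_le_integral => //=.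
- by move=> x _; rewrite lee_fin normc_ge0.
- exact/measurable_EFinP/measurable_normc.
- exact: (measurableT_comp (@abse_measurable R setT) mg).
- by move=> x _; rewrite lee_fin; apply: le_trans (fg x) _; exact: ler_norm.
Qed.

Lemma cintegrable_Re f : cintegrable f ->
  mu.-integrable setT (EFin \o (fun x => Re (f x))).
Proof.
move=> intf; apply: le_integrable (cintegrable_norm intf) => //=.
  by apply/measurable_EFinP; case: intf => -[].
by move=> x _; rewrite lee_fin (ger0_norm (normc_ge0 _)) Re_le_normc.
Qed.

Lemma cintegrable_Im f : cintegrable f ->
  mu.-integrable setT (EFin \o (fun x => Im (f x))).
Proof.
move=> intf; apply: le_integrable (cintegrable_norm intf) => //=.
  by apply/measurable_EFinP; case: intf => -[].
by move=> x _; rewrite lee_fin (ger0_norm (normc_ge0 _)) Im_le_normc.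
Qed.

Lemma cintegrable_comp f : cmeas f ->
  mu.-integrable setT (EFin \o (fun x => Re (f x))) ->
  mu.-integrable setT (EFin \o (fun x => Im (f x))) -> cintegrable f.
Proof.
move=> mf iR iI; apply: (@cintegrable_le _ (fun x => `|Re (f x)| + `|Im (f x)|)) => //.
  by move=> x; exact: normc_le.
apply: (integrableD measurableT (integrable_norm iR) (integrable_norm iI)).
Qed.

Lemma cintegrableZ (c : R[i]) f : cintegrable f -> cintegrable (fun x => c * f x).
Proof.
move=> fi; apply: (@cintegrable_le _ (fun x => normc c * normc (f x))).
- by apply: cmeasM; [exact: cmeas_cst|case: fi].
- by move=> x; rewrite normcM.
- exact: (integrableZl measurableT _ (cintegrable_norm fi)).
Qed.

Lemma Re_cint f : Re (cint f) = \int[mu]_x Re (f x). Proof. by []. Qed.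
Lemma eq_cint f g : f =1 g -> cint f = cint g.
Proof. by move/funext => ->. Qed.

Lemma cintD f g : cintegrable f -> cintegrable g ->
  cint (fun x => f x + g x) = cint f + cint g.
Proof.
move=> fi gi; apply: complex_ext; rewrite ?ReD ?ImD /=.
  under eq_Rintegral do rewrite ReD.
  by rewrite RintegralD//; exact: cintegrable_Re.
under eq_Rintegral do rewrite ImD.
by rewrite RintegralD//; exact: cintegrable_Im.
Qed.

Lemma cintZ (c : R[i]) f : cintegrable f -> cint (fun x => c * f x) = c * cint f.
Proof.
move=> fi.
have iR a : mu.-integrable setT (EFin \o (fun x => a * Re (f x))).
  exact: (integrableZl measurableT _ (cintegrable_Re fi)).
have iI a : mu.-integrable setT (EFin \o (fun x => a * Im (f x))).
  exact: (integrableZl measurableT _ (cintegrable_Im fi)).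
apply: complex_ext; rewrite ?ReM ?ImM /=.
  under eq_Rintegral do rewrite ReM.
  by rewrite RintegralB// !RintegralZl//; [exact: cintegrable_Im|exact: cintegrable_Re].
under eq_Rintegral do rewrite ImM.
by rewrite RintegralD// !RintegralZl//; [exact: cintegrable_Re|exact: cintegrable_Im].
Qed.

Lemma cintB f g : cintegrable f -> cintegrable g ->
  cint (fun x => f x - g x) = cint f - cint g.
Proof.
move=> fi gi; under eq_cint => x do rewrite -mulN1r.
by rewrite cintD// ?cintZ// ?mulN1r//; exact: cintegrableZ.
Qed.

Lemma cint_real (f : T -> R) : cint (fun x => (f x)%:C) = (\int[mu]_x f x)%:C.
Proof. by apply: complex_ext => //=; rewrite Rintegral_cst// mul0r. Qed.

(** With z the integral, |z|^2 is the integral of Re (conj z f), which is at most |z| times the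
    integral of |f|; then divide by |z|. *)
Lemma normc_cint f : cintegrable f -> normc (cint f) <= \int[mu]_x normc (f x).
Proof.
move=> fi; set z := cint f; have [->|z0] := eqVneq z 0.
  by rewrite Normc.normc0 Rintegral_ge0// => x _; exact: normc_ge0.
have nz : 0 < normc z.
  by rewrite lt_neqAle normc_ge0 andbT eq_sym; apply: contra_neq z0 => /normc_eq0P.
rewrite -(ler_pM2l nz) -RintegralZl//; last exact: cintegrable_norm.
have -> : normc z * normc z = Re (cint (fun x => conjc z * f x)).
  by rewrite cintZ// -/z ReM Re_conjc Im_conjc mulNr opprK -!expr2 normc_sqr.
rewrite Re_cint; apply: le_Rintegral => //.
- exact/cintegrable_Re/cintegrableZ.
- exact: (integrableZl measurableT _ (cintegrable_norm fi)).
- move=> x _; rewrite -(normc_conjc z) -normcM.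
  exact: le_trans (ler_norm _) (Re_le_normc _).
Qed.

Lemma normc_cint_le f (g : T -> R) : cmeas f -> (forall x, normc (f x) <= g x) ->
  mu.-integrable setT (EFin \o g) -> normc (cint f) <= \int[mu]_x g x.
Proof.
move=> mf fg ig; have fi := cintegrable_le mf fg ig.
apply: le_trans (normc_cint fi) _; apply: le_Rintegral => //.
exact: cintegrable_norm.
Qed.

Lemma Rintegral_dominated (u_ : nat -> T -> R) (u g : T -> R) :
  (forall k, measurable_fun setT (u_ k)) -> measurable_fun setT u ->
  (forall x, u_ k x @[k --> \oo] --> u x) -> (forall k x, `|u_ k x| <= g x) ->
  mu.-integrable setT (EFin \o g) ->
  (\int[mu]_x u_ k x) @[k --> \oo] --> \int[mu]_x u x.
Proof.
move=> mu_ mu' u_u u_g ig.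
have ue x : setT x -> (u_ k x)%:E @[k --> \oo] --> (u x)%:E.
  by move=> _; apply: cvg_EFin; [exact: nearW|exact: u_u].
have [iu _] := @dominated_convergence _ T R mu setT measurableT
  (fun k x => (u_ k x)%:E) (fun x => (u x)%:E) (EFin \o g)
  (fun k => (measurable_EFinP _ _).2 (mu_ k)) ((measurable_EFinP _ _).2 mu')
  (aeW _ ue) ig (aeW _ (fun x k _ => u_g k x)).
by move=> H; apply: fine_cvg; rewrite fineK//; exact: integrable_fin_num.
Qed.

Lemma cint_dominated (f_ : nat -> T -> R[i]) f (g : T -> R) :
  (forall k, cmeas (f_ k)) -> cmeas f ->
  (forall x, f_ k x @[k --> \oo] --> f x) ->
  (forall k x, normc (f_ k x) <= g x) ->
  mu.-integrable setT (EFin \o g) ->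
  cint (f_ k) @[k --> \oo] --> cint f.
Proof.
move=> mf_ mf f_f f_g ig.
apply/cvg_complexP; split; (apply: Rintegral_dominated; last exact: ig).
- by move=> k; case: (mf_ k).
- by case: mf.
- by move=> x; have /cvg_complexP[] := f_f x.
- by move=> k x; exact: le_trans (Re_le_normc _) (f_g k x).
- by move=> k; case: (mf_ k).
- by case: mf.
- by move=> x; have /cvg_complexP[] := f_f x.
- by move=> k x; exact: le_trans (Im_le_normc _) (f_g k x).
Qed.

End complex_integral.

Section Rintegral_parts.
Context d (T : measurableType d) {R : realType} (mu : {measure set T -> \bar R}).

Lemma RintegralE (f : T -> R) : (\int[mu]_x f x) =
  fine ((\int[mu]_x (EFin \o f)^\+ x) - (\int[mu]_x (EFin \o f)^\- x))%E.
Proof. by rewrite /Rintegral integralE. Qed.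

Lemma EFin_Rintegral (f : T -> R) : mu.-integrable setT (EFin \o f) ->
  ((\int[mu]_x f x)%:E = \int[mu]_x (f x)%:E)%E.
Proof. by move=> fi; rewrite /Rintegral fineK//; exact: integrable_fin_num. Qed.

End Rintegral_parts.

Section complex_fubini.
Context d1 d2 (T1 : measurableType d1) (T2 : measurableType d2) {R : realType}.
Variable m1 : {sigma_finite_measure set T1 -> \bar R}.
Variable m2 : {sigma_finite_measure set T2 -> \bar R}.

(** A [Rintegral] is [fine] of a difference of two integrals of nonnegative functions, and Tonelli
    makes each of them measurable in the parameter whether finite or not. *)
Lemma measurable_Rintegral_param (f : T1 * T2 -> R) : measurable_fun setT f ->
  measurable_fun setT (fun x => \int[m2]_y f (x, y)).
Proof.
move=> /measurable_EFinP mf; under eq_fun do rewrite RintegralE.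
apply: (measurableT_comp (@fine_measurable R _ measurableT)).
apply: emeasurable_funB.
- have := @measurable_fun_fubini_tonelli_F _ _ T1 T2 R m2 (EFin \o f)^\+%E
    (measurable_funepos mf) (fun x => funepos_ge0 _ x).
  apply: eq_measurable_fun => x _.
  by apply: eq_integral => y _; rewrite !funeposE.
- have := @measurable_fun_fubini_tonelli_F _ _ T1 T2 R m2 (EFin \o f)^\-%E
    (measurable_funeneg mf) (fun x => funeneg_ge0 _ x).
  apply: eq_measurable_fun => x _.
  by apply: eq_integral => y _; rewrite !funenegE.
Qed.

Lemma cmeas_cint_param (f : T1 * T2 -> R[i]) : cmeas f ->
  cmeas (fun x => cint m2 (fun y => f (x, y))).
Proof.
move=> [fr fi]; split; first exact: (measurable_Rintegral_param fr).
exact: (measurable_Rintegral_param fi).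
Qed.

(** The hypotheses fit the kernels met below: an integrable factor [a] times, typically, a translate
    of a bounded integrable function. The uniform mass [M] gives integrability on the product, and
    the bound [B] makes every section in the first variable integrable, so that no inner integral is
    a default value of [fine]. *)
Lemma cfubini (f : T1 * T2 -> R[i]) (a : T1 -> R) (b : T1 -> T2 -> R) (M B : R) :
  cmeas f -> (forall x y, normc (f (x, y)) <= a x * b x y) ->
  (forall x, 0 <= a x) -> m1.-integrable setT (EFin \o a) ->
  (forall x, m2.-integrable setT (EFin \o b x)) ->
  (forall x, \int[m2]_y b x y <= M) -> (forall x y, b x y <= B) ->
  cint m1 (fun x => cint m2 (fun y => f (x, y))) =
  cint m2 (fun y => cint m1 (fun x => f (x, y))).
Proof.
move=> mf fab a0 ia ib bM bB.
have mfx x : cmeas (fun y => f (x, y)).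
  exact: (cmeas_comp (pair1_measurable x) mf).
have mfy y : cmeas (fun x => f (x, y)).
  exact: (cmeas_comp (pair2_measurable y) mf).
have ifx x : cintegrable m2 (fun y => f (x, y)).
  apply: (@cintegrable_le _ _ _ _ _ (fun y => a x * b x y)) => //.
  exact: (integrableZl measurableT _ (ib x)).
have ify y : cintegrable m1 (fun x => f (x, y)).
  apply: (@cintegrable_le _ _ _ _ _ (fun x => B * a x)) => //.
    by move=> x; apply: le_trans (fab x y) _; rewrite mulrC ler_wpM2r.
  exact: (integrableZl measurableT _ ia).
have normf x : (\int[m2]_y (normc (f (x, y)))%:E <= (M * a x)%:E)%E.
  apply: (@le_trans _ _ (\int[m2]_y (a x * b x y)%:E)%E).
    apply: ge0_le_integral => //=.
    - by move=> y _; rewrite lee_fin normc_ge0.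
    - exact/measurable_EFinP/measurable_normc.
    - by have /integrableP[] := integrableZl measurableT (a x) (ib x).
    - by move=> y _; rewrite lee_fin.
  rewrite -EFin_Rintegral; last exact: (integrableZl measurableT _ (ib x)).
  rewrite lee_fin RintegralZl// mulrC; exact: ler_wpM2r.
have prod_int (u : T1 * T2 -> R) : measurable_fun setT u ->
    (forall p, `|u p| <= normc (f p)) -> (m1 \x m2)%E.-integrable setT (EFin \o u).
  move=> mu uf; apply/integrable12ltyP; first exact/measurable_EFinP.
  have /integrableP[_] := integrableZl measurableT M ia.
  apply: le_lt_trans; apply: ge0_le_integral => //=.
  - by move=> x _; apply: integral_ge0 => y _; rewrite lee_fin.
  - apply: (@measurable_fun_fubini_tonelli_F _ _ T1 T2 R m2 (fun p => `|u p|%:E)) => //.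
      exact/measurable_EFinP/(measurableT_comp (@normr_measurable R setT)).
  - have /integrableP[mMa _] := integrableZl measurableT M ia.
    exact: (measurableT_comp (@abse_measurable R setT) mMa).
  - move=> x _; apply: (@le_trans _ _ (M * a x)%:E); last by rewrite lee_fin ler_norm.
    apply: le_trans (normf x).
    apply: ge0_le_integral => //=.
    - apply/measurable_EFinP/(measurableT_comp (@normr_measurable R setT)).
      exact: (measurableT_comp mu (pair1_measurable x)).
    - exact/measurable_EFinP/measurable_normc.
    - by move=> y _; rewrite lee_fin uf.
have fub (u : T1 * T2 -> R) : measurable_fun setT u ->
    (forall p, `|u p| <= normc (f p)) ->
    (forall x, m2.-integrable setT (EFin \o (fun y => u (x, y)))) ->
    (forall y, m1.-integrable setT (EFin \o (fun x => u (x, y)))) ->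
    \int[m1]_x \int[m2]_y u (x, y) = \int[m2]_y \int[m1]_x u (x, y).
  move=> mu uf iux iuy; rewrite /Rintegral; congr fine.
  under eq_integral do rewrite EFin_Rintegral//.
  under [RHS]eq_integral do rewrite EFin_Rintegral//.
  exact: (Fubini (prod_int _ mu uf)).
case: (mf) => mr mi; apply: complex_ext.
- apply: (fub (fun p => Re (f p)) mr) => [p|x|y]; first exact: Re_le_normc.
    exact: cintegrable_Re (ifx x).
  exact: cintegrable_Re (ify y).
- apply: (fub (fun p => Im (f p)) mi) => [p|x|y]; first exact: Im_le_normc.
    exact: cintegrable_Im (ifx x).
  exact: cintegrable_Im (ify y).
Qed.

End complex_fubini.

Section complex_transfer.
Context d1 d2 (X : measurableType d1) (Y : measurableType d2) {R : realType}.
Variables (mu : {measure set X -> \bar R}) (nu : {measure set Y -> \bar R}).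
Variables (phi : X -> Y) (c : R).
Hypothesis c0 : 0 < c.
Hypothesis mphi : measurable_fun setT phi.
Hypothesis H : forall f : Y -> \bar R, measurable_fun setT f -> (forall y, 0 <= f y)%E ->
  (\int[mu]_x f (phi x) = c%:E * \int[nu]_y f y)%E.

Lemma integrable_transfer (f : Y -> R) : nu.-integrable setT (EFin \o f) ->
  mu.-integrable setT (EFin \o (f \o phi)).
Proof.
move=> /integrableP[mf foo]; apply/integrableP; split.
  exact: (measurableT_comp mf mphi).
rewrite (H (f := fun y => `|(f y)%:E|%E))//; last first.
  exact: (measurableT_comp (@abse_measurable R setT) mf).
by rewrite lte_mul_pinfty// lee_fin ltW.
Qed.

Lemma Rintegral_transfer (f : Y -> R) : nu.-integrable setT (EFin \o f) ->
  \int[mu]_x f (phi x) = c * \int[nu]_y f y.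
Proof.
move=> fi; have /integrableP[mf _] := fi; rewrite !RintegralE.
have -> : (\int[mu]_x ((EFin \o (fun x => f (phi x)))^\+ x) =
    c%:E * \int[nu]_y ((EFin \o f)^\+ y))%E.
  by rewrite -(H (measurable_funepos mf))//; apply: eq_integral => x _; rewrite !funeposE.
have -> : (\int[mu]_x ((EFin \o (fun x => f (phi x)))^\- x) =
    c%:E * \int[nu]_y ((EFin \o f)^\- y))%E.
  by rewrite -(H (measurable_funeneg mf))//; apply: eq_integral => x _; rewrite !funenegE.
have := integrable_pos_fin_num measurableT fi.
have := integrable_neg_fin_num measurableT fi.
move=> /fineK <- /fineK <-.
by rewrite -!EFinM -!EFinB /= mulrBr.
Qed.

Lemma cintegrable_transfer (f : Y -> R[i]) : cintegrable nu f ->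
  cintegrable mu (fun x => f (phi x)).
Proof.
move=> fi; apply: (@cintegrable_le _ _ _ _ _ (fun x => normc (f (phi x)))) => //.
  by apply: cmeas_comp => //; case: fi.
exact: (integrable_transfer (cintegrable_norm fi)).
Qed.

(** Changes of variables are proved on nonnegative functions only, in the form [H], and are lifted
    to complex integrands here; [c] is the Jacobian factor. *)
Lemma cint_transfer (f : Y -> R[i]) : cintegrable nu f ->
  cint mu (fun x => f (phi x)) = c%:C * cint nu f.
Proof.
move=> fi; apply: complex_ext; rewrite ?ReM ?ImM /= ?mul0r ?subr0 ?addr0.
  by rewrite (Rintegral_transfer (cintegrable_Re fi)).
by rewrite (Rintegral_transfer (cintegrable_Im fi)).
Qed.

End complex_transfer.

Lemma cintegralE (R : realType) n (f : 'rV[R]_n -> R[i]) : cmeas f ->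
  cintegral f = cint (leb R n) f.
Proof.
have E (u : 'rV[R]_n -> R) : measurable_fun setT u ->
    \int[lebn R n]_t u (\row_i tnth t i) = \int[leb R n]_x u x.
  move=> /measurable_EFinP mu; rewrite !RintegralE.
  rewrite (ge0_integral_leb (measurable_funepos mu))//.
  rewrite (ge0_integral_leb (measurable_funeneg mu))//.
  by congr (fine (_ - _)); apply: eq_integral => x _; rewrite ?funeposE ?funenegE.
by move=> [mr mi]; apply: complex_ext; [exact: (E _ mr)|exact: (E _ mi)].
Qed.

(** * Affine changes of variables *)

Section affine.
Context {R : realType}.
Local Notation mu := (@lebesgue_measure R).

(** [a] times the image of Lebesgue measure under x |-> a x + v agrees with Lebesgue measure on
    half-open intervals, hence everywhere. *)
Let ge0_integral_scale_shift (f : R -> \bar R) (a v : R) : 0 < a ->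
  measurable_fun setT f -> (forall x, 0 <= f x)%E ->
  (\int[mu]_x f x = a%:E * \int[mu]_x f (a * x + v)%R)%E.
Proof.
move=> a0 mf f0.
have mphi : measurable_fun setT (fun x : measurableTypeR R => a * x + v : measurableTypeR R).
  by apply: measurable_funD => //; exact: mulrl_measurable.
pose nu : {measure set (measurableTypeR R) -> \bar R} :=
  measure_function_pushforward__canonical__measure_function_Measure mu mphi.
pose nua := mscale (NngNum (ltW a0)) nu.
have E A : measurable A -> mu A = nua A.
  apply: lebesgue_measure_unique => _ [[l r]] _ <-.
  rewrite /nua /= /mscale /= /pushforward.
  have -> : (fun x : R => a * x + v) @^-1` `]l, r] = `](l - v) / a, (r - v) / a]%classic.
    apply/seteqP; split => x /=; rewrite !in_itv /= ltr_pdivrMr// ler_pdivlMr//;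
      by rewrite ltrBlDr lerBrDr (mulrC x).
  rewrite !lebesgue_measure_itv /= !lte_fin ltr_pM2r ?invr_gt0// ltrD2r.
  case: ifPn => [lr|_]; last by rewrite mule0.
  rewrite -!EFinB -EFinM -mulrBl; congr EFin.
  by rewrite mulrCA divff ?gt_eqF// mulr1 opprB addrA subrK.
rewrite [LHS](eq_measure_integral nua); last by move=> A mA _; exact: E.
rewrite ge0_integral_mscale//=; congr (_ * _)%E.
by rewrite [LHS](@ge0_integral_pushforward _ _ _ _ _ _ mphi mu setT f).
Qed.

Let ge0_integralN (f : R -> \bar R) :
  measurable_fun setT f -> (forall x, 0 <= f x)%E ->
  (\int[mu]_x f x = \int[mu]_x f (- x)%R)%E.
Proof.
move=> mf f0.
have mphi : measurable_fun setT (-%R : measurableTypeR R -> measurableTypeR R).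
  exact: oppr_measurable.
pose nu : {measure set (measurableTypeR R) -> \bar R} :=
  measure_function_pushforward__canonical__measure_function_Measure mu mphi.
rewrite [LHS](eq_measure_integral nu); last first.
  by move=> A mA _; apply/esym/lebesgue_measureN.
by rewrite [LHS](@ge0_integral_pushforward _ _ _ _ _ _ mphi mu setT f).
Qed.

Lemma ge0_integral_affine (f : R -> \bar R) (a v : R) : a != 0 ->
  measurable_fun setT f -> (forall x, 0 <= f x)%E ->
  (\int[mu]_x f x = `|a|%:E * \int[mu]_x f (a * x + v)%R)%E.
Proof.
move=> a0 mf f0; have [a_gt0|a_le0] := ltP 0 a.
  by rewrite gtr0_norm//; exact: ge0_integral_scale_shift.
have Na0 : 0 < - a by rewrite oppr_gt0 lt_neqAle a0.
rewrite ler0_norm// (ge0_integral_scale_shift v Na0)//; congr (_ * _)%E.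
rewrite ge0_integralN//; first by apply: eq_integral => x _; rewrite mulrNN.
by apply: (measurableT_comp mf); exact: measurable_funD.
Qed.

Lemma measurable_affine_row n (a : R) (v : 'rV[R]_n) :
  measurable_fun setT (fun x : 'rV[R]_n => a *: x + v).
Proof.
apply: measurable_rowP => i; under eq_fun do rewrite !mxE.
apply: measurable_funD => //.
by apply: (measurableT_comp (@mulrl_measurable R setT a)); exact: measurable_coord.
Qed.

Lemma ge0_integral_affine_row n (f : 'rV[R]_n -> \bar R) (a : R) (v : 'rV[R]_n) :
  a != 0 -> measurable_fun setT f -> (forall x, 0 <= f x)%E ->
  (\int[leb R n]_x f x = (`|a| ^+ n)%:E * \int[leb R n]_x f (a *: x + v)%R)%E.
Proof.
move=> a0; elim: n => [|n IHn] in f v *; move=> mf f0.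
  rewrite !(ge0_integral_leb0 0)// expr0 mul1e; congr f.
  by apply/rowP => -[].
have mff x : measurable_fun setT (fun t => f (row_cons x t)).
  exact: (measurableT_comp mf (measurable_row_consr x)).
pose v' : 'rV[R]_n := \row_j v 0 (lift ord0 j).
have consE x t : row_cons (a * x + v 0 ord0) (a *: t + v') = a *: row_cons x t + v.
  by apply/row_consP => [|j]; rewrite !mxE ?unlift_none ?liftK.
have mfa := measurableT_comp mf (measurable_affine_row a v).
have mg (h : 'rV[R]_n.+1 -> \bar R) : measurable_fun setT h -> (forall x, 0 <= h x)%E ->
    measurable_fun setT (fun x : measurableTypeR R => \int[leb R n]_t h (row_cons x t))%E.
  move=> mh h0; apply: (@measurable_fun_fubini_tonelli_F _ _ _ _ _ (leb R n)
    (fun p : measurableTypeR R * 'rV[R]_n => h (row_cons p.1 p.2))) => //.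
  exact: (measurableT_comp mh (@measurable_row_cons R n)).
rewrite ge0_integral_row_cons// ge0_integral_row_cons//.
rewrite (ge0_integral_affine (v 0 ord0) a0); last 2 first.
- exact: (mg f mf f0).
- by move=> x; exact: integral_ge0.
rewrite exprS EFinM -muleA; congr (_ * _)%E.
rewrite -ge0_integralZl//; last 2 first.
- exact: (mg (fun y => f (a *: y + v)) mfa (fun=> f0 _)).
- by move=> x _; exact: integral_ge0.
apply: eq_integral => x _; rewrite (IHn _ v')//; congr (_ * _)%E.
by apply: eq_integral => t _; rewrite consE.
Qed.

End affine.

(** * Gaussian integrals *)

Section derive_rules.
Context {R : realType}.
Implicit Types (f g : R -> R) (x a b : R).

Lemma dfun_id x : is_derive x (1 : R) (fun y : R => y) 1.
Proof. exact: is_derive_id. Qed.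

Lemma dfun_cst (c : R) x : is_derive x (1 : R) (fun _ : R => c) 0.
Proof. exact: is_derive_cst. Qed.

Lemma dfunD f g x a b : is_derive x (1 : R) f a -> is_derive x (1 : R) g b ->
  is_derive x (1 : R) (fun y => f y + g y) (a + b).
Proof. by move=> ? ?; exact: is_deriveD. Qed.

Lemma dfunN f x a : is_derive x (1 : R) f a -> is_derive x (1 : R) (fun y => - f y) (- a).
Proof. by move=> ?; exact: is_deriveN. Qed.

Lemma dfunM f g x a b : is_derive x (1 : R) f a -> is_derive x (1 : R) g b ->
  is_derive x (1 : R) (fun y => f y * g y) (a * g x + f x * b).
Proof.
move=> fa gb; apply: is_derive_eq (is_deriveM fa gb) _.
by rewrite addrC /GRing.scale /= (mulrC (g x)).
Qed.

Lemma dfun_comp f g x a b : is_derive (g x) (1 : R) f a -> is_derive x (1 : R) g b ->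
  is_derive x (1 : R) (fun y => f (g y)) (a * b).
Proof. by move=> ? ?; exact: is_derive1_comp. Qed.

Lemma dfun_expR g x b : is_derive x (1 : R) g b ->
  is_derive x (1 : R) (fun y => expR (g y)) (expR (g x) * b).
Proof. by move=> h; exact: (dfun_comp (is_derive_expR _) h). Qed.

Lemma dfun_cos g x b : is_derive x (1 : R) g b ->
  is_derive x (1 : R) (fun y => cos (g y)) (- sin (g x) * b).
Proof. by move=> h; exact: (dfun_comp (is_derive_cos _) h). Qed.

Lemma dfun_sin g x b : is_derive x (1 : R) g b ->
  is_derive x (1 : R) (fun y => sin (g y)) (cos (g x) * b).
Proof. by move=> h; exact: (dfun_comp (is_derive_sin _) h). Qed.

Lemma dfun_continuous f : (forall x, exists a, is_derive x (1 : R) f a) -> continuous f.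
Proof.
move=> df x; have [a fa] := df x.
exact/differentiable_continuous/derivable1_diffP.
Qed.

End derive_rules.

(** Builds the derivative as an existential variable by recursion on the shape of the function. Its
    callers either compare the result with the wanted expression through [is_derive_eq] and [ring],
    or only use that a derivative exists. *)
Ltac dfun := repeat first
  [ eapply dfun_cst | eapply dfun_id | eapply dfun_expR | eapply dfun_cos
  | eapply dfun_sin | eapply dfunN | eapply dfunD | eapply dfunM ].

Section gaussian_1d.
Context {R : realType}.
Local Notation mu := (@lebesgue_measure R).

Lemma integral_gauss (a : R) : 0 < a ->
  mu.-integrable setT (EFin \o (fun x => expR (- (a * x ^+ 2)))) /\
  \int[mu]_x expR (- (a * x ^+ 2)) = Num.sqrt (pi / a).
Proof.
move=> a0.
have ra0 : 0 < Num.sqrt a by rewrite sqrtr_gt0.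
have g0 x : (0 <= (@gauss_fun R x)%:E)%E by rewrite lee_fin gauss_fun_ge0.
have mg : measurable_fun setT (EFin \o @gauss_fun R).
  by apply/measurable_EFinP; exact: measurable_gauss_fun.
have gE x : gauss_fun (Num.sqrt a * x + 0) = expR (- (a * x ^+ 2)).
  by rewrite /gauss_fun addr0 exprMn sqr_sqrtr// ltW.
have mga : measurable_fun setT (fun x : R => expR (- (a * x ^+ 2))).
  apply: (measurableT_comp (@measurable_expR R)); apply: measurable_funN.
  by apply: measurable_funM => //; exact: exprn_measurable.
have := @ge0_integral_affine R _ _ 0 (lt0r_neq0 ra0) mg g0.
rewrite integralT_gauss (ger0_norm (ltW ra0)).
under eq_integral do rewrite /= gE.
move=> E.
have Ei : (\int[mu]_x (expR (- (a * x ^+ 2)))%:E = (Num.sqrt (pi / a))%:E)%E.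
  have -> : Num.sqrt (pi / a) = (Num.sqrt a)^-1 * Num.sqrt pi.
    by rewrite sqrtrM ?pi_ge0// sqrtrV ?ltW// mulrC.
  by rewrite EFinM E muleA -EFinM mulVf ?mul1e// gt_eqF.
split; last by rewrite /Rintegral Ei.
apply/integrableP; split; first exact/measurable_EFinP.
under eq_integral do rewrite /= ger0_norm ?expR_ge0//.
by rewrite Ei ltry.
Qed.

(** Half of the Gaussian decay absorbs the polynomial, because 1 + t <= exp t. Multiples of
    exp(-x^2/2) thus dominate all moments up to order two. *)
Lemma gauss_mom (x : R) : (1 + x ^+ 2) * expR (- (1 * x ^+ 2)) <= 2 * expR (- (2^-1 * x ^+ 2)).
Proof.
have -> : - (1 * x ^+ 2) = - (2^-1 * x ^+ 2) + - (2^-1 * x ^+ 2) by field.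
rewrite expRD mulrA ler_wpM2r ?expR_ge0// expRN ler_pdivrMr ?expR_gt0//.
have := expR_ge1Dx (2^-1 * x ^+ 2); lra.
Qed.

(** Over [-(k+1), k+1] the integral is a difference of boundary values of [u]. As k grows, the bound
    on [u] sends it to 0, while the bound on [u'] gives convergence to the integral over the
    line. *)
Lemma integral_derive_gauss (u u' : R -> R) (K : R) :
  (forall x, is_derive x (1 : R) u (u' x)) -> continuous u' ->
  (forall x, `|u x| <= K * expR (- (2^-1 * x ^+ 2))) ->
  (forall x, `|u' x| <= K * expR (- (2^-1 * x ^+ 2))) ->
  \int[mu]_x u' x = 0.
Proof.
move=> du cu' bu bu'.
have half0 : 0 < 2^-1 :> R by [].
have [ig _] := integral_gauss half0.
have igK : mu.-integrable setT (EFin \o (fun x => K * expR (- (2^-1 * x ^+ 2)))).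
  exact: (integrableZl measurableT K ig).
have mu' : measurable_fun setT u' by exact: continuous_measurable_fun.
pose A (k : nat) : set R := `[- k.+1%:R, k.+1%:R]%classic.
have mA k : measurable (A k) by exact: measurable_itv.
have cu : continuous u by apply: dfun_continuous => x; exists (u' x).
have FTC k : (\int[mu]_(x in A k) (u' x)%:E)%E = (u k.+1%:R - u (- k.+1%:R))%:E.
  rewrite EFinB; apply: continuous_FTC2.
  - by rewrite -subr_gt0 opprK addr_gt0.
  - exact: continuous_subspaceT.
  - split=> [x _||]; first exact: ex_derive.
    + exact/cvg_at_right_filter/cu.
    + exact/cvg_at_left_filter/cu.
  - by move=> x _; rewrite derive1E; exact: derive_val.
have IE k : \int[mu]_x (u' \_ (A k)) x = u k.+1%:R - u (- k.+1%:R).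
  by rewrite -Rintegral_mkcond /Rintegral FTC.
have I1 : \int[mu]_x (u' \_ (A k)) x @[k --> \oo] --> \int[mu]_x u' x.
  apply: (Rintegral_dominated _ _ _ _ igK) => //.
  - by move=> k; apply/(measurable_restrictT _ (mA k)); exact: measurable_funTS.
  - move=> x; apply: cvg_near_cst; near=> k.
    rewrite patchE ifT// inE /A /= in_itv /= -ler_norml.
    have : `|x| <= k%:R by near: k; exact: nbhs_infty_ger.
    by move/le_trans; apply; rewrite ler_nat.
  - move=> k x; rewrite patchE; case: ifP => // _.
    by rewrite normr0 (le_trans (normr_ge0 _) (bu' x)).
have I2 : \int[mu]_x (u' \_ (A k)) x @[k --> \oo] --> 0.
  (* There are two boundary terms; with t = k.+1 each is at most [|K|] exp(-t^2/2), and exp(-t^2/2)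
     <= 2/t. *)
  apply: (@cvg_dist_le _ _ _ _ _ (fun k => (4 * `|K|) * k.+1%:R^-1)); last first.
    rewrite -(mulr0 (4 * `|K|)); apply: cvgMr; exact: cvg_harmonic.
  move=> k; rewrite subr0 IE; apply: le_trans (ler_normB _ _) _.
  apply: le_trans (lerD (bu _) (bu _)) _; rewrite sqrrN.
  set e := expR _.
  have : e <= 2 * k.+1%:R^-1.
    rewrite /e expRN -lef_pV2 ?posrE ?invr_gt0 ?expR_gt0 ?divr_gt0//.
    rewrite invrK invfM invrK; apply: le_trans (expR_ge1Dx _).
    by set t := k.+1%:R; have := sqr_ge0 (t - 1); nra.
  have e0 : 0 <= e by exact: expR_ge0.
  have := ler_norm K; have : 0 <= `|K| by [].
  set j := k.+1%:R^-1; set c := `|K|; nra.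
exact: (cvg_unique _ I1 I2).
Unshelve. all: by end_near. Qed.

End gaussian_1d.

Section gaussian_transforms.
Context {R : realType}.
Local Notation mu := (@lebesgue_measure R).
Local Notation e := (fun x : R => expR (- (1 * x ^+ 2))).
Local Notation g := (fun x : R => expR (- (2^-1 * x ^+ 2))).

Lemma is_derive_integral (f f' : R -> R -> R) (G : R -> R) :
  (forall w, mu.-integrable setT (EFin \o f w)) ->
  (forall w x, is_derive w (1 : R) (f ^~ x) (f' w x)) ->
  mu.-integrable setT (EFin \o G) -> (forall w x, `|f' w x| <= G x) ->
  forall w, is_derive w (1 : R) (fun w => \int[mu]_x f w x) (\int[mu]_x f' w x).
Proof.
move=> fi df Gi f'G w.
have G0 x : 0 <= G x := le_trans (normr_ge0 _) (f'G 0 x).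
have Iw : `]w - 1, w + 1[%classic w.
  by rewrite /= in_itv /= ltrBlDr ltrDl ltr01.
have E w' x : partial1of2 f w' x = f' w' x.
  by rewrite partial1of2E; exact: derive_val.
have bnd (w' x : R) : `]w - 1, w + 1[%classic w' -> setT x -> `|partial1of2 f w' x| <= G x.
  by rewrite E.
have der (w' x : R) : `]w - 1, w + 1[%classic w' -> setT x -> derivable (f ^~ x) w' 1.
  by move=> _ _; exact: ex_derive.
have fi' (w' : R) : `]w - 1, w + 1[%classic w' -> mu.-integrable setT (EFin \o f w').
  by [].
apply: DeriveDef.
  exact: (derivable_under_integral measurableT Iw fi' der G0 Gi bnd).
rewrite -derive1E (differentiation_under_integral measurableT Iw fi' der G0 Gi bnd).
by apply: eq_Rintegral => x _; rewrite E.
Qed.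

Let e_ge0 x : 0 <= e x. Proof. exact: expR_ge0. Qed.
Let g_ge0 x : 0 <= g x. Proof. exact: expR_ge0. Qed.
Let gi : mu.-integrable setT (EFin \o g).
Proof. by have [] := @integral_gauss R 2^-1. Qed.
Let giZ K : mu.-integrable setT (EFin \o (fun x => K * g x)).
Proof. exact: (integrableZl measurableT K gi). Qed.

Let e_le x : e x <= 2 * g x.
Proof.
apply: le_trans (gauss_mom x); rewrite ler_peMl// lerDl; exact: sqr_ge0.
Qed.

Let xe_le x : `|x| * e x <= 2 * g x.
Proof.
apply: le_trans (gauss_mom x); rewrite ler_wpM2r// -(real_normK (num_real x)).
by have := normr_ge0 x; set y := `|x| => y0; have := sqr_ge0 (y - 1); nra.
Qed.

Let x2e_le x : x ^+ 2 * e x <= 2 * g x.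
Proof. by apply: le_trans (gauss_mom x); rewrite ler_wpM2r// lerDr. Qed.

Let me : measurable_fun setT e.
Proof.
apply: (measurableT_comp (@measurable_expR R)); apply: measurable_funN.
by apply: measurable_funM => //; exact: exprn_measurable.
Qed.

Let int_le (f : R -> R) K : measurable_fun setT f -> (forall x, `|f x| <= K * g x) ->
  mu.-integrable setT (EFin \o f).
Proof.
move=> mf fK; apply: le_integrable (giZ K) => //; first exact/measurable_EFinP.
by move=> x _ /=; rewrite lee_fin (le_trans (fK x)) ?ler_norm.
Qed.

Let cos_le1 (x : R) : `|cos x| <= 1. Proof. by rewrite ler_norml cos_geN1 cos_le1. Qed.
Let sin_le1 (x : R) : `|sin x| <= 1. Proof. by rewrite ler_norml sin_geN1 sin_le1. Qed.

Let bnd1 (y c K x : R) : `|c| <= 1 -> `|y| * e x <= K -> `|y * e x * c| <= K.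
Proof.
move=> c1 yK; rewrite 2!normrM (ger0_norm (e_ge0 _)); apply: le_trans yK.
by rewrite ler_piMr// mulr_ge0.
Qed.

(** Differentiation under the integral followed by an integration by parts gives F' = -(w/2) F. So
    F(w) exp(w^2/4) is constant, equal to its value sqrt(pi) at 0. *)
Lemma integral_gauss_cos1 (w : R) :
  \int[mu]_x (e x * cos (w * x)) = Num.sqrt pi * expR (- (w ^+ 2 / 4)).
Proof.
pose F w := \int[mu]_x (e x * cos (w * x)).
pose F' w := \int[mu]_x (- (x * e x * sin (w * x))).
have mcos w' : measurable_fun setT (fun x : R => cos (w' * x)).
  by apply: (measurableT_comp (continuous_measurable_fun (@continuous_cos R)));
    exact: mulrl_measurable.
have msin w' : measurable_fun setT (fun x : R => sin (w' * x)).
  by apply: (measurableT_comp (continuous_measurable_fun (@continuous_sin R)));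
    exact: mulrl_measurable.
have ci w' : mu.-integrable setT (EFin \o (fun x => e x * cos (w' * x))).
  apply: (@int_le _ 2); first exact: measurable_funM.
  by move=> x; rewrite -(mul1r (e x)); apply: bnd1 => //; rewrite normr1 mul1r.
have si w' : mu.-integrable setT (EFin \o (fun x => x * e x * sin (w' * x))).
  apply: (@int_le _ 2); first by apply: measurable_funM => //; exact: measurable_funM.
  by move=> x; exact: bnd1.
have dF w' : is_derive w' (1 : R) F (F' w').
  apply: (@is_derive_integral _ (fun w' x => - (x * e x * sin (w' * x))) _ ci _ (giZ 2)).
    move=> w'' x; apply: is_derive_eq (dfunM (dfun_cst (e x) w'')
      (dfun_cos (dfunM (dfun_id w'') (dfun_cst x w'')))) _.
    ring.
  by move=> w'' x; rewrite normrN; exact: bnd1.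
have ibp w' : F' w' = - (w' / 2) * F w'.
  have ci' := integrableZl measurableT w' (ci w').
  have si' := integrableZl measurableT 2 (si w').
  have : \int[mu]_x (w' * (e x * cos (w' * x)) - 2 * (x * e x * sin (w' * x))) = 0.
    apply: (@integral_derive_gauss R (fun x => e x * sin (w' * x)) _ (4 + 2 * `|w'|)).
    - move=> x; eapply is_derive_eq; first by dfun.
      by rewrite /=; ring.
    - by apply: dfun_continuous => x; eexists; dfun.
    - move=> x; rewrite mulrDl; apply: (@le_trans _ _ (2 * g x)).
        by rewrite -(mul1r (e x)); apply: bnd1 => //; rewrite normr1 mul1r.
      have := g_ge0 x; have := normr_ge0 w'.
      by set c := `|w'|; set d := expR (- (2^-1 * _)); nra.
    - move=> x; apply: le_trans (ler_normB _ _) _.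
      rewrite (normrM w') (normrM 2) (ger0_norm (ler0n _ 2)).
      have H1 : `|e x * cos (w' * x)| <= 2 * g x.
        by rewrite -(mul1r (e x)); apply: bnd1 => //; rewrite normr1 mul1r.
      have H2 : `|x * e x * sin (w' * x)| <= 2 * g x by exact: bnd1.
      have := normr_ge0 w'; move: H1 H2.
      set c := `|w'|; set d := expR (- (2^-1 * _)); set p := `|_|; set q := `|_|.
      by nra.
  rewrite RintegralB// !RintegralZl// -/(F w') => H.
  have -> : F' w' = - \int[mu]_x (x * e x * sin (w' * x)).
    rewrite /F' -[RHS]mulN1r -RintegralZl//; apply: eq_Rintegral => x _.
    by rewrite mulN1r.
  lra.
have Fcst x y : F x * expR (x ^+ 2 / 4) = F y * expR (y ^+ 2 / 4).
  apply: (@is_derive_0_is_cst _ (fun w => F w * expR (w ^+ 2 / 4)) x y) => w'; eapply is_derive_eq.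
    by eapply (dfunM (dF w')); dfun.
  by rewrite ibp /=; field.
have := Fcst w 0; have -> : (0 : R) ^+ 2 / 4 = 0 by field.
rewrite expR0 mulr1 /F.
under [X in _ = X -> _]eq_Rintegral do rewrite mul0r cos0 mulr1.
have [_ ->] := @integral_gauss R 1 ltr01.
rewrite divr1 => E; rewrite expRN -E mulfK//.
by rewrite gt_eqF// expR_gt0.
Qed.

Let chirp_meas (b : R) (f : R -> R) : continuous f ->
  measurable_fun setT (fun x : R => f (b * x ^+ 2)).
Proof.
move=> cf; apply: (measurableT_comp (continuous_measurable_fun cf)).
by apply: measurable_funM => //; exact: exprn_measurable.
Qed.

(* Integrating by parts, the two integrals satisfy a linear ODE system in [b]:
   rotated by [atan b / 2] and rescaled, they have zero derivative. *)
Lemma integral_gauss_chirp1 (b : R) :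
  \int[mu]_x (e x * cos (b * x ^+ 2)) =
    Num.sqrt pi * expR (- (ln (1 + b ^+ 2) / 4)) * cos (atan b / 2) /\
  \int[mu]_x (e x * sin (b * x ^+ 2)) =
    Num.sqrt pi * expR (- (ln (1 + b ^+ 2) / 4)) * sin (atan b / 2).
Proof.
pose C b := \int[mu]_x (e x * cos (b * x ^+ 2)).
pose S b := \int[mu]_x (e x * sin (b * x ^+ 2)).
pose C2 b := \int[mu]_x (x ^+ 2 * e x * cos (b * x ^+ 2)).
pose S2 b := \int[mu]_x (x ^+ 2 * e x * sin (b * x ^+ 2)).
have mcos b' := chirp_meas b' (@continuous_cos R).
have msin b' := chirp_meas b' (@continuous_sin R).
have mx2e : measurable_fun setT (fun x : R => x ^+ 2 * e x).
  by apply: measurable_funM => //; exact: exprn_measurable.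
have bx2 (c x : R) : `|c| <= 1 -> `|x ^+ 2 * e x * c| <= 2 * g x.
  by move=> c1; apply: bnd1 => //; rewrite ger0_norm ?sqr_ge0.
have b0 (c x : R) : `|c| <= 1 -> `|e x * c| <= 2 * g x.
  by move=> c1; rewrite -(mul1r (e x)); apply: bnd1 => //; rewrite normr1 mul1r.
have iC b' : mu.-integrable setT (EFin \o (fun x => e x * cos (b' * x ^+ 2))).
  by apply: (@int_le _ 2) => [|x]; [exact: measurable_funM|exact: b0].
have iS b' : mu.-integrable setT (EFin \o (fun x => e x * sin (b' * x ^+ 2))).
  by apply: (@int_le _ 2) => [|x]; [exact: measurable_funM|exact: b0].
have iC2 b' : mu.-integrable setT (EFin \o (fun x => x ^+ 2 * e x * cos (b' * x ^+ 2))).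
  by apply: (@int_le _ 2) => [|x]; [exact: measurable_funM|exact: bx2].
have iS2 b' : mu.-integrable setT (EFin \o (fun x => x ^+ 2 * e x * sin (b' * x ^+ 2))).
  by apply: (@int_le _ 2) => [|x]; [exact: measurable_funM|exact: bx2].
have dC b' : is_derive b' (1 : R) C (- S2 b').
  have -> : - S2 b' = \int[mu]_x (-1 * (x ^+ 2 * e x * sin (b' * x ^+ 2))).
    by rewrite RintegralZl// mulN1r.
  apply: (@is_derive_integral _ (fun b' x => -1 * (x ^+ 2 * e x * sin (b' * x ^+ 2)))
    _ iC _ (giZ 2)) => w x; last by rewrite mulN1r normrN; exact: bx2.
  eapply is_derive_eq; first by dfun.
  by rewrite /=; ring.
have dS b' : is_derive b' (1 : R) S (C2 b').
  apply: (@is_derive_integral _ (fun b' x => x ^+ 2 * e x * cos (b' * x ^+ 2))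
    _ iS _ (giZ 2)) => w x; last exact: bx2.
  eapply is_derive_eq; first by dfun.
  by rewrite /=; ring.
have xe (x : R) : `|x * e x| <= 2 * g x by rewrite normrM (ger0_norm (e_ge0 _)).
have gbd (p q r c x : R) : `|p| <= 2 * g x -> `|q| <= 2 * g x -> `|r| <= 2 * g x ->
    `|p + (-2) * q + 2 * c * r| <= (6 + 4 * `|c|) * g x.
  move=> p1 q1 r1.
  apply: le_trans (ler_normD _ _) _; apply: le_trans (lerD (ler_normD _ _) (lexx _)) _.
  rewrite !normrM normrN (ger0_norm (ler0n _ 2)).
  have := normr_ge0 c; move: p1 q1 r1 (g_ge0 x).
  by set d := expR (- (2^-1 * _)); nra.
have gbd0 (p c x : R) : `|p| <= 2 * g x -> `|p| <= (6 + 4 * `|c|) * g x.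
  move/le_trans; apply; rewrite ler_wpM2r//; have := normr_ge0 c; lra.
have ibpC b' : C b' - 2 * C2 b' - 2 * b' * S2 b' = 0.
  have : \int[mu]_x (e x * cos (b' * x ^+ 2) + (-2) * (x ^+ 2 * e x * cos (b' * x ^+ 2))
      + 2 * (- b') * (x ^+ 2 * e x * sin (b' * x ^+ 2))) = 0.
    apply: (@integral_derive_gauss R (fun x => x * e x * cos (b' * x ^+ 2)) _ (6 + 4 * `|- b'|)).
    - move=> x; eapply is_derive_eq; first by dfun.
      by rewrite /=; ring.
    - by apply: dfun_continuous => x; eexists; dfun.
    - by move=> x; apply: gbd0; exact: bnd1.
    - by move=> x; apply: gbd; [exact: b0|exact: bx2|exact: bx2].
  have i2 := integrableZl measurableT (-2) (iC2 b').
  have i3 := integrableZl measurableT (2 * - b') (iS2 b').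
  rewrite RintegralD//; last exact: (integrableD measurableT (iC b') i2).
  rewrite RintegralD// !RintegralZl// -/(C b') -/(C2 b') -/(S2 b') => H.
  rewrite -[RHS]H; ring.
have ibpS b' : S b' - 2 * S2 b' + 2 * b' * C2 b' = 0.
  have : \int[mu]_x (e x * sin (b' * x ^+ 2) + (-2) * (x ^+ 2 * e x * sin (b' * x ^+ 2))
      + 2 * b' * (x ^+ 2 * e x * cos (b' * x ^+ 2))) = 0.
    apply: (@integral_derive_gauss R (fun x => x * e x * sin (b' * x ^+ 2)) _ (6 + 4 * `|b'|)).
    - move=> x; eapply is_derive_eq; first by dfun.
      by rewrite /=; ring.
    - by apply: dfun_continuous => x; eexists; dfun.
    - by move=> x; apply: gbd0; exact: bnd1.
    - by move=> x; apply: gbd; [exact: b0|exact: bx2|exact: bx2].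
  have i2 := integrableZl measurableT (-2) (iS2 b').
  have i3 := integrableZl measurableT (2 * b') (iC2 b').
  rewrite RintegralD//; last exact: (integrableD measurableT (iS b') i2).
  rewrite RintegralD// !RintegralZl// -/(S b') -/(C2 b') -/(S2 b') => H.
  rewrite -[RHS]H; ring.
have q0 b' : 0 < 1 + b' ^+ 2 :> R by rewrite ltr_pwDl// sqr_ge0.
(* The two integrations by parts form a linear system for [C2] and [S2], of determinant 4 (1 +
   b'^2); solving it closes the differential system in [C] and [S]. *)
have C2E b' : C2 b' = (C b' - b' * S b') / (2 * (1 + b' ^+ 2)).
  apply: (mulIf (lt0r_neq0 (q0 b'))); rewrite invfM mulrA mulfVK ?gt_eqF//.
  have := ibpC b'; have := ibpS b'; set y := S2 b'; set z := C2 b' => h1 h2.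
  have -> : S b' = 2 * y - 2 * b' * z by lra.
  have -> : C b' = 2 * z + 2 * b' * y by lra.
  by field.
have S2E b' : S2 b' = (S b' + b' * C b') / (2 * (1 + b' ^+ 2)).
  apply: (mulIf (lt0r_neq0 (q0 b'))); rewrite invfM mulrA mulfVK ?gt_eqF//.
  have := ibpC b'; have := ibpS b'; set y := S2 b'; set z := C2 b' => h1 h2.
  have -> : S b' = 2 * y - 2 * b' * z by lra.
  have -> : C b' = 2 * z + 2 * b' * y by lra.
  by field.
pose th (b : R) := atan b / 2.
pose rho (b : R) := expR (ln (1 + b ^+ 2) / 4).
have dth (x : R) : is_derive x (1 : R) th (1 / (2 * (1 + x ^+ 2))).
  apply: is_derive_eq (dfunM (is_derive1_atan x) (dfun_cst 2^-1 x)) _.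
  by field; rewrite gt_eqF.
have drho (x : R) : is_derive x (1 : R) rho (rho x * (x / (2 * (1 + x ^+ 2)))).
  have h1 : is_derive (x : R) (1 : R) (fun b : R => 1 + b ^+ 2) (2 * x).
    eapply is_derive_eq; first by dfun.
    by rewrite /=; ring.
  have h2 : is_derive (x : R) (1 : R) (fun b : R => ln (1 + b ^+ 2)) ((1 + x ^+ 2)^-1 * (2 * x)).
    exact: (@dfun_comp R (@ln R) (fun b : R => 1 + b ^+ 2) x _ _ (is_derive1_ln (q0 x)) h1).
  apply: is_derive_eq (dfun_expR (dfunM h2 (dfun_cst 4^-1 x))) _.
  by rewrite /rho; field; rewrite gt_eqF.
have cth x : is_derive x (1 : R) (fun b => cos (th b)) (- sin (th x) * (1 / (2 * (1 + x ^+ 2)))).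
  exact: (dfun_cos (dth x)).
have sth x : is_derive x (1 : R) (fun b => sin (th b)) (cos (th x) * (1 / (2 * (1 + x ^+ 2)))).
  exact: (dfun_sin (dth x)).
(* With [rho] = (1 + b^2)^(1/4), [U] and [W] concern the real and imaginary parts of rho(b) (C + i
   S) exp(-i th(b)). *)
have U x y : rho x * (C x * cos (th x) + S x * sin (th x)) =
             rho y * (C y * cos (th y) + S y * sin (th y)).
  apply: (@is_derive_0_is_cst _ (fun b => rho b * (C b * cos (th b) + S b * sin (th b)))
    x y) => b'.
  apply: is_derive_eq (dfunM (drho b') (dfunD (dfunM (dC b') (cth b'))
    (dfunM (dS b') (sth b')))) _.
  by rewrite C2E S2E; field; rewrite gt_eqF.
have W x y : rho x * (S x * cos (th x) - C x * sin (th x)) =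
             rho y * (S y * cos (th y) - C y * sin (th y)).
  apply: (@is_derive_0_is_cst _ (fun b => rho b * (S b * cos (th b) - C b * sin (th b)))
    x y) => b'.
  apply: is_derive_eq (dfunM (drho b') (dfunD (dfunM (dS b') (cth b'))
    (dfunN (dfunM (dC b') (sth b'))))) _.
  by rewrite C2E S2E; field; rewrite gt_eqF.
have th0 : th 0 = 0 by rewrite /th atan0 mul0r.
have rho0 : rho 0 = 1.
  rewrite /rho; have -> : (1 + 0 ^+ 2 : R) = 1 by field.
  by rewrite ln1 mul0r expR0.
have C0 : C 0 = Num.sqrt pi.
  rewrite /C; under eq_Rintegral do rewrite mul0r cos0 mulr1.
  by have [_ ->] := @integral_gauss R 1 ltr01; rewrite divr1.
have S0 : S 0 = 0.
  rewrite /S; under eq_Rintegral do rewrite mul0r sin0 mulr0.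
  by rewrite Rintegral_cst// mul0r.
have := U b 0; have := W b 0; rewrite th0 rho0 C0 S0 sin0 cos0 !mulr0 !mul0r.
rewrite !mulr1 !mul1r subr0 addr0 => HW HU.
have rb : rho b != 0 by rewrite gt_eqF// expR_gt0.
have {}HW : S b * cos (th b) - C b * sin (th b) = 0.
  by apply/eqP; move/eqP: HW; rewrite mulf_eq0 (negbTE rb).
have {}HU : C b * cos (th b) + S b * sin (th b) = Num.sqrt pi * (rho b)^-1.
  by apply: (mulfI rb); rewrite HU mulrCA divff ?mulr1.
have cs := cos2Dsin2 (th b).
rewrite expRN -/(rho b) -/(th b) -/(C b) -/(S b); split.
  rewrite -HU -[LHS]mulr1 -cs; move: HW.
  set c := cos _; set s := sin _ => HW.
  have -> : (C b * c + S b * s) * c = C b * (c ^+ 2 + s ^+ 2) + s * (S b * c - C b * s) by ring.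
  by rewrite HW mulr0 addr0.
rewrite -HU -[LHS]mulr1 -cs; move: HW.
set c := cos _; set s := sin _ => HW.
have -> : (C b * c + S b * s) * s = S b * (c ^+ 2 + s ^+ 2) - c * (S b * c - C b * s) by ring.
by rewrite HW mulr0 subr0.
Qed.

End gaussian_transforms.

Section gaussian_1d_scaled.
Context {R : realType}.
Local Notation mu := (@lebesgue_measure R).

Let scale_transfer (s : R) : 0 < s -> forall f : R -> \bar R,
  measurable_fun setT f -> (forall y, 0 <= f y)%E ->
  (\int[mu]_x f (s * x)%R = (s^-1)%:E * \int[mu]_y f y)%E.
Proof.
move=> s0 f mf f0; rewrite (ge0_integral_affine 0 (lt0r_neq0 s0) mf f0).
rewrite muleA gtr0_norm// -EFinM mulVf ?gt_eqF// mul1e.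
by apply: eq_integral => x _; rewrite addr0.
Qed.

Let opp_transfer : forall f : R -> \bar R,
  measurable_fun setT f -> (forall y, 0 <= f y)%E ->
  (\int[mu]_x f (- x)%R = 1%:E * \int[mu]_y f y)%E.
Proof.
move=> f mf f0; have N1 : -1 != 0 :> R by rewrite oppr_eq0 oner_eq0.
rewrite (ge0_integral_affine 0 N1 mf f0) muleA normrN normr1 !mul1e.
by apply: eq_integral => x _; rewrite addr0 mulN1r.
Qed.

Local Notation RR := (measurableTypeR R).

Lemma Rintegral_scale (s : R) (f : R -> R) : 0 < s -> mu.-integrable setT (EFin \o f) ->
  \int[mu]_x f (s * x) = s^-1 * \int[mu]_x f x.
Proof.
by move=> s0; exact: (@Rintegral_transfer _ _ RR RR R mu mu (fun x => s * x) s^-1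
  (scale_transfer s0) f).
Qed.

Lemma Rintegral_opp (f : R -> R) : mu.-integrable setT (EFin \o f) ->
  \int[mu]_x f (- x) = \int[mu]_x f x.
Proof.
rewrite -[RHS]mul1r.
exact: (@Rintegral_transfer _ _ RR RR R mu mu (fun x => - x) 1 opp_transfer f).
Qed.

Lemma cint_scale (s : R) (f : R -> R[i]) : 0 < s -> cintegrable mu f ->
  cint mu (fun x : RR => f (s * x)) = (s^-1)%:C * cint mu f.
Proof.
by move=> s0; exact: (@cint_transfer _ _ RR RR R mu mu (fun x => s * x) s^-1
  (scale_transfer s0) f).
Qed.

Lemma measurable_gauss1 (a : R) : measurable_fun setT (fun x : R => expR (- (a * x ^+ 2))).
Proof.
apply: (measurableT_comp (@measurable_expR R)); apply: measurable_funN.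
by apply: measurable_funM => //; exact: exprn_measurable.
Qed.

Lemma cintegrable_gauss_cis (a : R) (u : R -> R) : 0 < a -> measurable_fun setT u ->
  cintegrable mu (fun x : R => (expR (- (a * x ^+ 2)))%:C * cis (u x)).
Proof.
move=> a0 mu'; have [gi _] := integral_gauss a0.
refine (cintegrable_le _ _ gi).
- exact: (cmeasM (cmeas_real (measurable_gauss1 a)) (cmeas_cis mu')).
- by move=> x; rewrite normcM normc_R normc_cis mulr1 ger0_norm// expR_ge0.
Qed.

Lemma cint_gauss_fourier1 (a w : R) : 0 < a ->
  cint mu (fun x : R => (expR (- (a * x ^+ 2)))%:C * cis (w * x)) =
  (Num.sqrt (pi / a) * expR (- (w ^+ 2 / (4 * a))))%:C.
Proof.
move=> a0; have s0 : 0 < Num.sqrt a by rewrite sqrtr_gt0.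
have mlin (v : R) : measurable_fun setT (fun x : R => v * x) by exact: mulrl_measurable.
have intf v := cintegrable_gauss_cis (@ltr01 R) (mlin v).
have intfa := cintegrable_gauss_cis a0 (mlin w).
have msc : measurable_fun setT (fun x : R => Num.sqrt a * x).
  exact: mulrl_measurable.
have oppm : measurable_fun setT (fun x : R => - x) by exact: oppr_measurable.
have sE : Num.sqrt a ^+ 2 = a by rewrite sqr_sqrtr// ltW.
have c0 : 0 < (Num.sqrt a)^-1 by rewrite invr_gt0.
apply: complex_ext => /=.
- under eq_Rintegral do rewrite mul0r subr0.
  have := Rintegral_scale s0
    (cintegrable_Re (intf (w / Num.sqrt a))).
  under eq_Rintegral do rewrite exprMn sE mul1r mulrA mulfVK ?gt_eqF// ReM /= mul0r subr0.
  move=> ->; under eq_Rintegral do rewrite ReM /= mul0r subr0.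
  rewrite integral_gauss_cos1 mulrA; congr (_ * expR (- _)).
    by rewrite sqrtrM ?pi_ge0// sqrtrV ?ltW// mulrC.
  by rewrite exprMn exprVn sE -mulrA (mulrC 4) invfM.
(* The imaginary part has an odd integrand, so reflection turns its integral into the opposite. *)
- under eq_Rintegral do rewrite mul0r addr0.
  have := Rintegral_opp (cintegrable_Im intfa).
  under eq_Rintegral do rewrite ImM /= mul0r addr0 sqrrN mulrN sinN mulrN.
  under [in X in _ = X -> _]eq_Rintegral do rewrite ImM /= mul0r addr0.
  have si : mu.-integrable setT (EFin \o (fun x => expR (- (a * x ^+ 2)) * sin (w * x))).
    apply: eq_integrable (cintegrable_Im intfa) => // x _ /=.
    by rewrite mul0r addr0.
  have -> : \int[mu]_x - (expR (- (a * x ^+ 2)) * sin (w * x)) =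
      - \int[mu]_x (expR (- (a * x ^+ 2)) * sin (w * x)).
    rewrite -mulN1r -RintegralZl//; apply: eq_Rintegral => x _; by rewrite mulN1r.
  by move=> H; lra.
Qed.

Lemma cint_gauss_chirp1 (a b : R) : 0 < a ->
  cint mu (fun x : R => (expR (- (a * x ^+ 2)))%:C * cis (b * x ^+ 2)) =
  (Num.sqrt (pi / a) * expR (- (ln (1 + (b / a) ^+ 2) / 4)))%:C * cis (atan (b / a) / 2).
Proof.
move=> a0; have s0 : 0 < Num.sqrt a by rewrite sqrtr_gt0.
have mchirp (v : R) : measurable_fun setT (fun x : R => v * x ^+ 2).
  by apply: measurable_funM => //; exact: exprn_measurable.
have intf := cintegrable_gauss_cis (@ltr01 R) (mchirp (b / a)).
have msc : measurable_fun setT (fun x : R => Num.sqrt a * x).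
  exact: mulrl_measurable.
have sE : Num.sqrt a ^+ 2 = a by rewrite sqr_sqrtr// ltW.
have c0 : 0 < (Num.sqrt a)^-1 by rewrite invr_gt0.
have cs : Num.sqrt (pi / a) = (Num.sqrt a)^-1 * Num.sqrt pi.
  by rewrite sqrtrM ?pi_ge0// sqrtrV ?ltW// mulrC.
have [EC ES] := integral_gauss_chirp1 (b / a).
have /= := cint_scale s0 intf.
have E1 x : 1 * (Num.sqrt a * x) ^+ 2 = a * x ^+ 2 by rewrite exprMn sE mul1r.
have E2 x : b / a * (Num.sqrt a * x) ^+ 2 = b * x ^+ 2.
  by rewrite exprMn sE mulrA mulfVK ?gt_eqF.
under eq_cint do rewrite E1 E2.
move=> ->; rewrite cs -mulrA rmorphM -mulrA; congr (_ * _).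
apply: complex_ext; rewrite ?ReM ?ImM /= ?mul0r ?subr0 ?addr0.
  by under eq_Rintegral do rewrite mul0r subr0; rewrite EC -mulrA.
by under eq_Rintegral do rewrite mul0r addr0; rewrite ES -mulrA.
Qed.

End gaussian_1d_scaled.

(** * Product measures and integration coordinate by coordinate *)

Section product_integrals.
Context d1 d2 (T1 : measurableType d1) (T2 : measurableType d2) {R : realType}.
Variable m1 : {sigma_finite_measure set T1 -> \bar R}.
Variable m2 : {sigma_finite_measure set T2 -> \bar R}.

Lemma cint_prod12 (g : T1 * T2 -> R[i]) : cintegrable (m1 \x m2)%E g ->
  (forall x, cintegrable m2 (fun y => g (x, y))) ->
  cint (m1 \x m2)%E g = cint m1 (fun x => cint m2 (fun y => g (x, y))).
Proof.
move=> gi gx; apply: complex_ext; rewrite /= /Rintegral; congr fine.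
- rewrite -(integral12_prod_meas1 (cintegrable_Re gi)); apply: eq_integral => x _.
  by rewrite EFin_Rintegral//; exact: cintegrable_Re (gx x).
- rewrite -(integral12_prod_meas1 (cintegrable_Im gi)); apply: eq_integral => x _.
  by rewrite EFin_Rintegral//; exact: cintegrable_Im (gx x).
Qed.

Lemma cintegrable_prodM (u : T1 -> R[i]) (v : T2 -> R[i]) :
  cintegrable m1 u -> cintegrable m2 v ->
  cintegrable (m1 \x m2)%E (fun p => u p.1 * v p.2).
Proof.
move=> ui vi; have [mu uoo] := ui; have [mv voo] := vi.
have mf : cmeas (fun p : T1 * T2 => u p.1 * v p.2).
  apply: cmeasM; first exact: (cmeas_comp measurable_fst mu).
  exact: (cmeas_comp measurable_snd mv).
split => //; rewrite fubini_tonelli1//=; first last.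
- by move=> p; rewrite lee_fin normc_ge0.
- exact/measurable_EFinP/measurable_normc.
rewrite /fubini_F.
under eq_integral => x _.
  under eq_integral do rewrite /= normcM EFinM.
  rewrite ge0_integralZl//; last 3 first.
  - exact/measurable_EFinP/measurable_normc.
  - by move=> y _; rewrite lee_fin normc_ge0.
  - by rewrite lee_fin normc_ge0.
  over.
rewrite /= ge0_integralZr//; last 3 first.
- exact/measurable_EFinP/measurable_normc.
- by move=> y _; rewrite lee_fin normc_ge0.
- by apply: integral_ge0 => y _; rewrite lee_fin normc_ge0.
have vf : (\int[m2]_y (normc (v y))%:E)%E \is a fin_num.
  by rewrite ge0_fin_numE//; apply: integral_ge0 => y _; rewrite lee_fin normc_ge0.
rewrite -(fineK vf) muleC lte_mul_pinfty// lee_fin fine_ge0//.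
by apply: integral_ge0 => y _; rewrite lee_fin normc_ge0.
Qed.

Lemma cint_prodM (u : T1 -> R[i]) (v : T2 -> R[i]) :
  cintegrable m1 u -> cintegrable m2 v ->
  cint (m1 \x m2)%E (fun p => u p.1 * v p.2) = cint m1 u * cint m2 v.
Proof.
move=> ui vi; rewrite (cint_prod12 (cintegrable_prodM ui vi)); last first.
  by move=> x; exact: (cintegrableZ (u x) vi).
under eq_cint do rewrite /= cintZ// mulrC.
by rewrite cintZ// mulrC.
Qed.

End product_integrals.

Section coordinates.
Context {R : realType}.
Local Notation mu := (@lebesgue_measure R).
Local Notation RR := (measurableTypeR R).

Let row_cons_transfer n (f : 'rV[R]_n.+1 -> \bar R) :
  measurable_fun setT f -> (forall y, 0 <= f y)%E ->
  (\int[mu \x leb R n]_p f (row_cons p.1 p.2) = 1%:E * \int[leb R n.+1]_y f y)%E.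
Proof.
move=> mf f0; rewrite mul1e ge0_integral_row_cons//.
have mfc : measurable_fun setT (fun p : RR * 'rV[R]_n => f (row_cons p.1 p.2)).
  exact: (measurableT_comp mf (@measurable_row_cons R n)).
by rewrite (fubini_tonelli1 _ mfc).
Qed.

Let row_rcons_transfer n (f : 'rV[R]_n.+1 -> \bar R) :
  measurable_fun setT f -> (forall y, 0 <= f y)%E ->
  (\int[leb R n \x mu]_p f (row_rcons p.1 p.2) = 1%:E * \int[leb R n.+1]_y f y)%E.
Proof.
move=> mf f0; rewrite mul1e ge0_integral_row_rcons//.
have mfc : measurable_fun setT (fun p : 'rV[R]_n * RR => f (row_rcons p.1 p.2)).
  exact: (measurableT_comp mf (@measurable_row_rcons R n)).
by rewrite (fubini_tonelli1 _ mfc).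
Qed.

Lemma cint_row_rcons n (f : 'rV[R]_n.+1 -> R[i]) : cintegrable (leb R n.+1) f ->
  cint (leb R n.+1) f =
    cint (leb R n \x mu)%E (fun p : 'rV[R]_n * RR => f (row_rcons p.1 p.2)) /\
  cintegrable (leb R n \x mu)%E (fun p : 'rV[R]_n * RR => f (row_rcons p.1 p.2)).
Proof.
move=> fi; split.
  rewrite -[LHS]mul1r; apply: esym.
  exact: (@cint_transfer _ _ ('rV[R]_n * RR)%type 'rV[R]_n.+1 R (leb R n \x mu)%E (leb R n.+1)
    (fun p => row_rcons p.1 p.2) 1 (@row_rcons_transfer n) f fi).
exact: (@cintegrable_transfer _ _ ('rV[R]_n * RR)%type 'rV[R]_n.+1 R (leb R n \x mu)%E (leb R n.+1)
    (fun p => row_rcons p.1 p.2) 1 ltr01 (@measurable_row_rcons R n) (@row_rcons_transfer n) f fi).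
Qed.

Let cintegrable_untransfer d (X : measurableType d) n (m : {measure set X -> \bar R})
    (phi : X -> 'rV[R]_n) (f : 'rV[R]_n -> R[i]) :
  (forall f : 'rV[R]_n -> \bar R, measurable_fun setT f -> (forall y, 0 <= f y)%E ->
    (\int[m]_p f (phi p) = 1%:E * \int[leb R n]_y f y)%E) ->
  cmeas f -> cintegrable m (fun x => f (phi x)) -> cintegrable (leb R n) f.
Proof.
move=> H mf [_ foo]; split => //.
have := H (fun y => (normc (f y))%:E); rewrite mul1e => <- //.
  exact/measurable_EFinP/measurable_normc.
by move=> y; rewrite lee_fin normc_ge0.
Qed.

Lemma cint_row_consM n (f : 'rV[R]_n.+1 -> R[i]) (u : RR -> R[i]) (v : 'rV[R]_n -> R[i]) :
  cmeas f -> (forall x t, f (row_cons x t) = u x * v t) ->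
  cintegrable mu u -> cintegrable (leb R n) v ->
  cintegrable (leb R n.+1) f /\ cint (leb R n.+1) f = cint mu u * cint (leb R n) v.
Proof.
move=> mf fE ui vi.
have E : (fun p : RR * 'rV[R]_n => f (row_cons p.1 p.2)) = (fun p => u p.1 * v p.2).
  by apply/funext => p; rewrite fE.
have fi : cintegrable (leb R n.+1) f.
  apply: (cintegrable_untransfer (@row_cons_transfer n)) => //.
  by rewrite E; exact: cintegrable_prodM.
split=> //; rewrite -cint_prodM// -E -[LHS]mul1r; apply: esym.
exact: (@cint_transfer _ _ (RR * 'rV[R]_n)%type 'rV[R]_n.+1 R (mu \x leb R n)%E (leb R n.+1)
    (fun p => row_cons p.1 p.2) 1 (@row_cons_transfer n) f fi).
Qed.

Lemma cint_row_rconsM n (f : 'rV[R]_n.+1 -> R[i]) (u : RR -> R[i]) (v : 'rV[R]_n -> R[i]) :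
  cmeas f -> (forall t x, f (row_rcons t x) = v t * u x) ->
  cintegrable mu u -> cintegrable (leb R n) v ->
  cintegrable (leb R n.+1) f /\ cint (leb R n.+1) f = cint (leb R n) v * cint mu u.
Proof.
move=> mf fE ui vi.
have E : (fun p : 'rV[R]_n * RR => f (row_rcons p.1 p.2)) = (fun p => v p.1 * u p.2).
  by apply/funext => p; rewrite fE.
have fi : cintegrable (leb R n.+1) f.
  apply: (cintegrable_untransfer (@row_rcons_transfer n)) => //.
  by rewrite E; exact: cintegrable_prodM.
by split=> //; rewrite -cint_prodM// -E; case: (cint_row_rcons fi).
Qed.

Lemma cmeas_prod d (T : measurableType d) (I : Type) (s : seq I) (F : I -> T -> R[i]) :
  (forall i, cmeas (F i)) -> cmeas (fun x => \prod_(i <- s) F i x).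
Proof.
move=> mF; elim: s => [|i s IHs].
  by under eq_fun do rewrite big_nil; exact: cmeas_cst.
by under eq_fun do rewrite big_cons; exact: cmeasM.
Qed.

Lemma cint_coord_prod n (F : 'I_n -> R -> R[i]) :
  (forall i, cintegrable mu (F i)) ->
  cintegrable (leb R n) (fun x => \prod_i F i (x 0 i)) /\
  cint (leb R n) (fun x => \prod_i F i (x 0 i)) = \prod_i cint mu (F i).
Proof.
elim: n F => [|n IHn] F iF.
  have E : (fun x : 'rV[R]_0 => \prod_(i < 0) F i (x 0 i)) = fun=> 1.
    by apply/funext => x; rewrite big_ord0.
  have I1 : (\int[leb R 0]_x 1%:E = 1%:E :> \bar R)%E.
    by rewrite (@ge0_integral_leb0 _ _ 0)// => x; rewrite lee_fin.
  rewrite E big_ord0; split.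
    split; first exact: cmeas_cst.
    by under eq_integral do rewrite Normc.normc1; rewrite I1 ltry.
  have -> : (fun=> 1 : R[i]) = (fun _ : 'rV[R]_0 => (1 : R)%:C) by [].
  by rewrite cint_real /Rintegral I1.
have [iv Ev] := IHn (fun i => F (lift ord0 i)) (fun i => iF _).
rewrite big_ord_recl -Ev; apply: cint_row_consM => //.
  apply: cmeas_prod => i; apply: (cmeas_comp (measurable_coord i)).
  by case: (iF i).
move=> x t; rewrite big_ord_recl row_cons0; congr (_ * _).
by apply: eq_bigr => i _; rewrite row_consS.
Qed.

End coordinates.

Section row_maps.
Context {R : realType}.
Context d (T : measurableType d).

Lemma measurable_rowD n (f g : T -> 'rV[R]_n) : measurable_fun setT f ->
  measurable_fun setT g -> measurable_fun setT (fun t => f t + g t).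
Proof.
move=> mf mg; apply: measurable_rowP => i; under eq_fun do rewrite mxE.
apply: measurable_funD; first exact: (measurableT_comp (measurable_coord i) mf).
exact: (measurableT_comp (measurable_coord i) mg).
Qed.

Lemma measurable_rowZ n (f : T -> 'rV[R]_n) (a : R) : measurable_fun setT f ->
  measurable_fun setT (fun t => a *: f t).
Proof.
move=> mf; apply: measurable_rowP => i; under eq_fun do rewrite mxE.
by apply: measurable_funM => //; exact: (measurableT_comp (measurable_coord i) mf).
Qed.

Lemma measurable_rowN n (f : T -> 'rV[R]_n) : measurable_fun setT f ->
  measurable_fun setT (fun t => - f t).
Proof. by move=> /(measurable_rowZ (-1)); under eq_fun do rewrite scaleN1r. Qed.

Lemma measurable_rowB n (f g : T -> 'rV[R]_n) : measurable_fun setT f ->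
  measurable_fun setT g -> measurable_fun setT (fun t => f t - g t).
Proof. by move=> mf mg; apply: measurable_rowD => //; exact: measurable_rowN. Qed.

Lemma measurable_dot n (f g : T -> 'rV[R]_n) : measurable_fun setT f ->
  measurable_fun setT g -> measurable_fun setT (fun t => dot (f t) (g t)).
Proof.
move=> mf mg; apply: measurable_sum => i.
apply: measurable_funM; first exact: (measurableT_comp (measurable_coord i) mf).
exact: (measurableT_comp (measurable_coord i) mg).
Qed.

End row_maps.

Section dot_theory.
Context {R : realType} {n : nat}.
Implicit Types x y z : 'rV[R]_n.

Lemma dotC x y : dot x y = dot y x.
Proof. by apply: eq_bigr => i _; rewrite mulrC. Qed.

Lemma dotDl x y z : dot (x + y) z = dot x z + dot y z.
Proof. by rewrite -big_split; apply: eq_bigr => i _; rewrite mxE mulrDl. Qed.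

Lemma dotZl a x z : dot (a *: x) z = a * dot x z.
Proof. by rewrite /dot big_distrr; apply: eq_bigr => i _; rewrite /= mxE mulrA. Qed.

Lemma dotNl x z : dot (- x) z = - dot x z.
Proof. by rewrite -scaleN1r dotZl mulN1r. Qed.

Lemma dotDr x y z : dot z (x + y) = dot z x + dot z y.
Proof. by rewrite !(dotC z) dotDl. Qed.

Lemma dotZr a x z : dot z (a *: x) = a * dot z x.
Proof. by rewrite !(dotC z) dotZl. Qed.

Lemma dotNr x z : dot z (- x) = - dot z x.
Proof. by rewrite !(dotC z) dotNl. Qed.

Lemma dot0r x : dot x 0 = 0.
Proof. by rewrite -(scale0r 0) dotZr mul0r. Qed.

End dot_theory.

Section continuous_complex.
Context {R : realType} {n : nat}.

Lemma continuous_Re (f : 'rV[R]_n -> R[i]) : continuous f -> continuous (fun x => Re (f x)).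
Proof. by move=> cf x; have /cvg_complexP[] := cf x. Qed.

Lemma continuous_Im (f : 'rV[R]_n -> R[i]) : continuous f -> continuous (fun x => Im (f x)).
Proof. by move=> cf x; have /cvg_complexP[] := cf x. Qed.

Lemma continuous_ReIm (f : 'rV[R]_n -> R[i]) : continuous (fun x => Re (f x)) ->
  continuous (fun x => Im (f x)) -> continuous f.
Proof.
move=> cr ci x.
exact: (proj2 (@cvg_complexP R 'rV[R]_n (nbhs x) _ f (f x)) (conj (cr x) (ci x))).
Qed.

Lemma cmeas_continuous (f : 'rV[R]_n -> R[i]) : continuous f -> cmeas f.
Proof.
move=> cf; split; apply: continuous_measurable_row.
  exact: continuous_Re.
exact: continuous_Im.
Qed.

Lemma cint_affine (f : 'rV[R]_n -> R[i]) (a : R) (v : 'rV[R]_n) : a != 0 ->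
  cintegrable (leb R n) f ->
  cintegrable (leb R n) (fun x => f (a *: x + v)) /\
  cint (leb R n) (fun x => f (a *: x + v)) = ((`|a| ^+ n)^-1)%:C * cint (leb R n) f.
Proof.
move=> a0 fi.
have an0 : 0 < `|a| ^+ n by rewrite exprn_gt0// normr_gt0.
have an0' : 0 < (`|a| ^+ n)^-1 by rewrite invr_gt0.
have H (h : 'rV[R]_n -> \bar R) : measurable_fun setT h -> (forall y, 0 <= h y)%E ->
    (\int[leb R n]_x h (a *: x + v)%R = ((`|a| ^+ n)^-1)%:E * \int[leb R n]_y h y)%E.
  move=> mh h0; rewrite (ge0_integral_affine_row v a0 mh h0) muleA -EFinM.
  by rewrite mulVf ?mul1e// gt_eqF.
split; last exact: (cint_transfer H fi).
exact: (cintegrable_transfer an0' (measurable_affine_row a v) H fi).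
Qed.

Lemma cint_shift (f : 'rV[R]_n -> R[i]) (v : 'rV[R]_n) : cintegrable (leb R n) f ->
  cintegrable (leb R n) (fun x => f (x + v)) /\
  cint (leb R n) (fun x => f (x + v)) = cint (leb R n) f.
Proof.
move=> fi; have [] := cint_affine v (oner_neq0 R) fi.
rewrite normr1 expr1n invr1 mul1r => h <-.
split; first by move: h; under eq_fun do rewrite scale1r.
by apply: eq_cint => x; rewrite scale1r.
Qed.

Lemma integrable_shift (f : 'rV[R]_n -> R) (v : 'rV[R]_n) :
  (leb R n).-integrable setT (EFin \o f) ->
  (leb R n).-integrable setT (EFin \o (fun x => f (x + v))) /\
  \int[leb R n]_x f (x + v) = \int[leb R n]_x f x.
Proof.
move=> fi.
have H (h : 'rV[R]_n -> \bar R) : measurable_fun setT h -> (forall y, 0 <= h y)%E ->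
    (\int[leb R n]_x h (x + v)%R = 1%:E * \int[leb R n]_y h y)%E.
  move=> mh h0; rewrite (ge0_integral_affine_row v (oner_neq0 R) mh h0) normr1 expr1n.
  by rewrite !mul1e; apply: eq_integral => x _; rewrite scale1r.
have mv : measurable_fun setT (fun x : 'rV[R]_n => x + v).
  by apply: measurable_rowD; [exact: measurable_id|exact: measurable_cst].
split; first exact: (integrable_transfer ltr01 mv H fi).
by rewrite (Rintegral_transfer H fi) mul1r.
Qed.

End continuous_complex.

(** * Gaussians in several variables *)

Section gaussian_nd.
Context {R : realType} {n : nat}.
Implicit Types (a : 'I_n -> R) (x w : 'rV[R]_n).

Definition gauss a x : R := expR (- \sum_(i < n) a i * x 0 i ^+ 2).

Lemma gauss_ge0 a x : 0 <= gauss a x. Proof. exact: expR_ge0. Qed.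

Lemma gauss_le1 a x : (forall i, 0 <= a i) -> gauss a x <= 1.
Proof.
by move=> a0; rewrite /gauss expR_le1 oppr_le0 sumr_ge0// => i _; rewrite mulr_ge0// sqr_ge0.
Qed.

Lemma gaussN a x : gauss a (- x) = gauss a x.
Proof. by congr (expR (- _)); apply: eq_bigr => i _; rewrite mxE sqrrN. Qed.

Lemma gauss0 a : gauss a 0 = 1.
Proof.
by rewrite /gauss big1 ?oppr0 ?expR0// => i _; rewrite mxE expr0n mulr0.
Qed.

Lemma gauss_prod a x : gauss a x = \prod_(i < n) expR (- (a i * x 0 i ^+ 2)).
Proof. by rewrite /gauss -sumrN expR_sum. Qed.

Lemma measurable_gauss a : measurable_fun setT (gauss a).
Proof.
apply: (measurableT_comp (@measurable_expR R)); apply: measurable_funN.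
apply: measurable_sum => i; apply: measurable_funM => //.
by apply: measurable_funX; exact: measurable_coord.
Qed.

Lemma cis_sum (I : Type) (s : seq I) (F : I -> R) :
  cis (\sum_(i <- s) F i) = \prod_(i <- s) cis (F i) :> R[i].
Proof.
elim: s => [|i s IHs]; first by rewrite !big_nil cis0.
by rewrite !big_cons cisD IHs.
Qed.

Let gauss_cis_prod a (u : 'I_n -> R -> R) x :
  (gauss a x)%:C * cis (\sum_i u i (x 0 i)) =
  \prod_i ((expR (- (a i * x 0 i ^+ 2)))%:C * cis (u i (x 0 i))).
Proof. by rewrite big_split /= gauss_prod rmorph_prod cis_sum. Qed.

Let gauss_cis a (u : 'I_n -> R -> R) : (forall i, 0 < a i) ->
  (forall i, measurable_fun setT (u i)) ->
  cintegrable (leb R n) (fun x => (gauss a x)%:C * cis (\sum_i u i (x 0 i))) /\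
  cint (leb R n) (fun x => (gauss a x)%:C * cis (\sum_i u i (x 0 i))) =
    \prod_i cint lebesgue_measure
      (fun x : R => (expR (- (a i * x ^+ 2)))%:C * cis (u i x)).
Proof.
move=> a0 mu; have E := funext (gauss_cis_prod a u); rewrite E.
apply: (@cint_coord_prod R n
  (fun i (x : R) => (expR (- (a i * x ^+ 2)))%:C * cis (u i x))) => i.
exact: (cintegrable_gauss_cis (a0 i) (mu i)).
Qed.

Lemma integrable_gauss a : (forall i, 0 < a i) ->
  (leb R n).-integrable setT (EFin \o gauss a).
Proof.
move=> a0; have [iC _] := gauss_cis (u := fun _ _ => 0) a0 (fun=> measurable_cst _).
apply: eq_integrable (cintegrable_norm iC) => // x _; rewrite /comp.
by rewrite normcM normc_R normc_cis mulr1 ger0_norm// gauss_ge0.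
Qed.

Lemma cint_gauss_fourier a w : (forall i, 0 < a i) ->
  cint (leb R n) (fun x => (gauss a x)%:C * cis (dot w x)) =
  (\prod_i (Num.sqrt (pi / a i) * expR (- (w 0 i ^+ 2 / (4 * a i)))))%:C.
Proof.
move=> a0.
have mu i : measurable_fun setT (fun y : R => w 0 i * y) by exact: mulrl_measurable.
have [_ E] := gauss_cis a0 mu.
rewrite rmorph_prod [LHS]E; apply: eq_bigr => i _.
by rewrite cint_gauss_fourier1.
Qed.

Lemma cint_gauss_chirp a b : (forall i, 0 < a i) ->
  cint (leb R n) (fun x => (gauss a x)%:C * cis (b * dot x x)) =
  \prod_i ((Num.sqrt (pi / a i) * expR (- (ln (1 + (b / a i) ^+ 2) / 4)))%:C *
           cis (atan (b / a i) / 2)).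
Proof.
move=> a0.
have mu (i : 'I_n) : measurable_fun setT (fun y : R => b * y ^+ 2).
  by apply: measurable_funM => //; exact: exprn_measurable.
have [_ E] := gauss_cis a0 mu.
under eq_cint => x.
  rewrite /dot big_distrr /=.
  under [X in cis X]eq_bigr do rewrite -expr2.
  over.
rewrite [LHS]E; apply: eq_bigr => i _.
by rewrite cint_gauss_chirp1.
Qed.

Lemma Rintegral_gauss a : (forall i, 0 < a i) ->
  \int[leb R n]_x gauss a x = \prod_i Num.sqrt (pi / a i).
Proof.
move=> a0; have := cint_gauss_fourier 0 a0.
under eq_cint => x.
  rewrite (_ : dot 0 x = 0) ?cis0 ?mulr1; last by rewrite dotC dot0r.
  over.
rewrite cint_real => /(congr1 (@complex.Re R)) /= ->.
apply: eq_bigr => i _; rewrite mxE expr0n mul0r oppr0 expR0 mulr1 //.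
Qed.

End gaussian_nd.

(** * Fourier inversion *)

Section fourier_inversion.
Context {R : realType} {n : nat}.
Implicit Types (f : 'rV[R]_n -> R[i]) (y : 'rV[R]_n).

Lemma cvg_complexM (I : Type) (F : set_system I) {FF : Filter F} (u v : I -> R[i])
    (a b : R[i]) :
  u @ F --> a -> v @ F --> b -> (fun i => u i * v i) @ F --> a * b.
Proof.
move=> /cvg_complexP[ua1 ua2] /cvg_complexP[vb1 vb2]; apply/cvg_complexP; split.
  rewrite ReM; under eq_fun do rewrite ReM.
  by apply: cvgB; apply: cvgM.
rewrite ImM; under eq_fun do rewrite ImM.
by apply: cvgD; apply: cvgM.
Qed.

Lemma cvg_real_complex (I : Type) (F : set_system I) {FF : Filter F} (u : I -> R) (a : R) :
  u @ F --> a -> (fun i => (u i)%:C) @ F --> a%:C.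
Proof. by move=> ua; apply/cvg_complexP; split=> //=; exact: cvg_cst. Qed.

Lemma cvg_continuous_row (f : 'rV[R]_n -> R) (u : nat -> 'rV[R]_n) (l : 'rV[R]_n) :
  continuous f -> u k @[k --> \oo] --> l -> f (u k) @[k --> \oo] --> f l.
Proof. by move=> cf ul; apply: cvg_comp; [exact: ul|exact: cf]. Qed.

Lemma cvg_continuous_complex f (u : nat -> 'rV[R]_n) (l : 'rV[R]_n) :
  continuous f -> u k @[k --> \oo] --> l -> f (u k) @[k --> \oo] --> f l.
Proof. by move=> cf ul; apply: cvg_comp; [exact: ul|exact: cf]. Qed.

Lemma cvg_scale_row (s : nat -> R) (s0 : R) (x : 'rV[R]_n) :
  s k @[k --> \oo] --> s0 -> s k *: x @[k --> \oo] --> s0 *: x.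
Proof. by move=> h; apply: cvgZr_tmp. Qed.

(** Stated after rescaling: the concentration of the Gaussian at [y] has become pointwise
    convergence of f(s u + y) to f(y), under the fixed majorant [B * gauss a u]. *)
Lemma approx_identity (a : 'I_n -> R) f (B : R) (s : nat -> R) y :
  (forall i, 0 < a i) -> continuous f -> (forall x, normc (f x) <= B) ->
  s k @[k --> \oo] --> 0 ->
  cint (leb R n) (fun u => (gauss a u)%:C * f (s k *: u + y)) @[k --> \oo] -->
  (\int[leb R n]_u gauss a u)%:C * f y.
Proof.
move=> a0 cf fB s0.
have gi := integrable_gauss a0.
have mg : cmeas (fun u : 'rV[R]_n => (gauss a u)%:C).
  exact: (cmeas_real (measurable_gauss a)).
have mfs k : cmeas (fun u : 'rV[R]_n => f (s k *: u + y)).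
  exact: (cmeas_comp (measurable_affine_row _ _) (cmeas_continuous cf)).
have -> : (\int[leb R n]_u gauss a u)%:C * f y =
    cint (leb R n) (fun u => (gauss a u)%:C * f y).
  under [RHS]eq_cint do rewrite mulrC.
  rewrite cintZ ?cint_real 1?mulrC//.
  apply: (cintegrable_le mg _ gi) => u.
  by rewrite normc_R ger0_norm// gauss_ge0.
apply: (cint_dominated (g := fun u => B * gauss a u)).
- by move=> k; exact: cmeasM.
- by apply: cmeasM => //; exact: cmeas_cst.
- move=> u; apply: cvg_complexM; first exact: cvg_cst.
  apply: cvg_continuous_complex => //.
  rewrite -[X in _ --> X]add0r; apply: cvgD; last exact: cvg_cst.
  by rewrite -(scale0r u); exact: cvg_scale_row.
- move=> k u; rewrite normcM normc_R ger0_norm ?gauss_ge0// mulrC.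
  by rewrite ler_wpM2r// gauss_ge0.
- exact: (integrableZl measurableT B gi).
Qed.

(** Without the prefactor (2 pi hbar)^(-n/2), which is tracked separately as [stft_cst]. *)
Definition ft (hbar : R) f (xi : 'rV[R]_n) : R[i] :=
  cint (leb R n) (fun y => cis (- (dot xi y / hbar)) * f y).

Lemma cmeas_cis_dot (hbar : R) d (T : measurableType d) (u v : T -> 'rV[R]_n) :
  measurable_fun setT u -> measurable_fun setT v ->
  cmeas (fun t => cis (dot (u t) (v t) / hbar) : R[i]).
Proof.
by move=> mu mv; apply: cmeas_cis; apply: measurable_funM => //; exact: measurable_dot.
Qed.

Lemma cmeas_cis_dotN (hbar : R) d (T : measurableType d) (u v : T -> 'rV[R]_n) :
  measurable_fun setT u -> measurable_fun setT v ->
  cmeas (fun t => cis (- (dot (u t) (v t) / hbar)) : R[i]).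
Proof.
move=> mu mv; apply: cmeas_cis; apply: measurable_funN.
by apply: measurable_funM => //; exact: measurable_dot.
Qed.

Lemma cintegrable_cisM d (T : measurableType d) (mu : {measure set T -> \bar R})
    (u : T -> R) (f : T -> R[i]) : measurable_fun setT u ->
  cintegrable mu f -> cintegrable mu (fun t => cis (u t) * f t).
Proof.
move=> mu' fi; apply: (cintegrable_le _ _ (cintegrable_norm fi)).
  by apply: cmeasM; [exact: cmeas_cis|case: fi].
by move=> t; rewrite normcM normc_cis mul1r.
Qed.

Lemma cmeas_ft hbar f : cmeas f -> cmeas (ft hbar f).
Proof.
move=> mf; apply: (@cmeas_cint_param _ _ 'rV[R]_n 'rV[R]_n R (leb R n)
  (fun p => cis (- (dot p.1 p.2 / hbar)) * f p.2)).
apply: cmeasM; first by apply: cmeas_cis_dotN; [exact: measurable_fst|exact: measurable_snd].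
exact: (cmeas_comp measurable_snd mf).
Qed.

Lemma measurable_dotc (hbar : R) (xi : 'rV[R]_n) :
  measurable_fun setT (fun y => - (dot xi y / hbar)).
Proof.
apply: measurable_funN; apply: measurable_funM => //.
by apply: measurable_dot; [exact: measurable_cst|exact: measurable_id].
Qed.

Lemma gauss_cst (c : R) (x : 'rV[R]_n) : gauss (fun=> c) x = expR (- (c * dot x x)).
Proof.
by rewrite /gauss /dot big_distrr; congr (expR (- _)); apply: eq_bigr => i _; rewrite expr2.
Qed.

(** The inverse integral is damped by a Gaussian of width 1/s. Fubini turns it into an average of
    [f] around [y] at scale s; both sides are then followed as s tends to 0, by dominated
    convergence and by [approx_identity]. *)
Lemma fourier_inversion (hbar : R) f (B : R) y : 0 < hbar ->
  continuous f -> (forall x, normc (f x) <= B) ->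
  cintegrable (leb R n) f -> cintegrable (leb R n) (ft hbar f) ->
  f y = (((2 * pi * hbar) ^+ n)^-1)%:C *
    cint (leb R n) (fun xi => cis (dot xi y / hbar) * ft hbar f xi).
Proof.
move=> h0 cf fB fi fti.
(* For this exponent the Gaussian is its own transform up to the factor [K] = (2 pi hbar)^(n/2),
   which is also its mass; hence the constant [K * K] in the formula. *)
pose c0 := (2 * hbar)^-1.
have c00 : 0 < c0 by rewrite invr_gt0 mulr_gt0.
pose s k : R := k.+1%:R^-1.
have s0 k : 0 < s k by rewrite invr_gt0.
have scvg : s k @[k --> \oo] --> 0 by exact: cvg_harmonic.
pose g (c : R) : 'rV[R]_n -> R := gauss (fun=> c).
have pih : 0 < 2 * pi * hbar by rewrite !mulr_gt0// pi_gt0.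
pose K : R := Num.sqrt (2 * pi * hbar) ^+ n.
have picE : pi / c0 = 2 * pi * hbar by rewrite /c0 invrK mulrCA mulrA.
have Ig : \int[leb R n]_u g c0 u = K.
  by rewrite /g Rintegral_gauss// picE big_const_ord iter_mulr_1.
have KK : K * K = (2 * pi * hbar) ^+ n by rewrite -exprMn -expr2 sqr_sqrtr// ltW.
have sc0 k : 0 < s k ^+ 2 * c0 by rewrite mulr_gt0// exprn_gt0.
have gi k : (leb R n).-integrable setT (EFin \o g (s k ^+ 2 * c0)).
  by apply: integrable_gauss => i; exact: sc0.
have mg c : measurable_fun setT (g c) by exact: measurable_gauss.
have key k : cint (leb R n) (fun xi => (g (s k ^+ 2 * c0) xi)%:C *
      (cis (dot xi y / hbar) * ft hbar f xi)) =
    K%:C * cint (leb R n) (fun u => (g c0 u)%:C * f (s k *: u + y)).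
  pose F (p : 'rV[R]_n * 'rV[R]_n) := (g (s k ^+ 2 * c0) p.2)%:C *
    (cis (dot p.2 y / hbar) * (cis (- (dot p.2 p.1 / hbar)) * f p.1)).
  have mF : cmeas F.
    apply: cmeasM; first exact: (cmeas_real (measurableT_comp (mg _) measurable_snd)).
    apply: cmeasM; first by apply: cmeas_cis_dot; [exact: measurable_snd|exact: measurable_cst].
    apply: cmeasM; last exact: (cmeas_comp measurable_fst (cmeas_continuous cf)).
    by apply: cmeas_cis_dotN; [exact: measurable_snd|exact: measurable_fst].
  have Fb z xi : normc (F (z, xi)) <= normc (f z) * g (s k ^+ 2 * c0) xi.
    rewrite /F !normcM !normc_cis !mul1r normc_R ger0_norm ?gauss_ge0//.
    by rewrite mulrC.
  have := cfubini mF Fb (fun=> normc_ge0 _) (cintegrable_norm fi) (fun=> gi k)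
    (fun=> lexx _) (fun _ xi => gauss_le1 _ (fun=> ltW (sc0 k))).
  have inner z : cint (leb R n) (fun xi => F (z, xi)) =
      f z * (K / s k ^+ n * g (c0 / s k ^+ 2) (y - z))%:C.
    have E xi : F (z, xi) = f z * ((g (s k ^+ 2 * c0) xi)%:C *
        cis (dot (hbar^-1 *: (y - z)) xi)).
      have -> : dot (hbar^-1 *: (y - z)) xi = dot xi y / hbar + - (dot xi z / hbar).
        by rewrite dotZl dotDl dotNl !(dotC xi) mulrBr !(mulrC hbar^-1).
      by rewrite cisD /F /=; ring.
    rewrite (eq_cint _ E) cintZ; last first.
      apply: (cintegrable_le _ _ (gi k)).
        apply: cmeasM; first exact: (cmeas_real (mg _)).
        apply: cmeas_cis; apply: measurable_dot; first exact: measurable_cst.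
        exact: measurable_id.
      by move=> xi; rewrite normcM normc_cis mulr1 normc_R ger0_norm// gauss_ge0.
    rewrite cint_gauss_fourier//; congr (_ * _%:C).
    have -> : K / s k ^+ n = \prod_(i < n) (Num.sqrt (2 * pi * hbar) / s k).
      by rewrite big_const_ord iter_mulr_1 expr_div_n.
    rewrite /g gauss_prod -big_split; apply: eq_bigr => i _ /=; congr (_ * expR (- _)).
      rewrite invfM mulrCA mulrC picE sqrtrM ?ltW// sqrtrV ?exprn_ge0 ?ltW//.
      by rewrite sqrtr_sqr gtr0_norm.
    rewrite !mxE /c0; field.
    by rewrite !gt_eqF.
  under eq_cint do rewrite inner.
  have outer xi : cint (leb R n) (fun z => F (z, xi)) =
      (g (s k ^+ 2 * c0) xi)%:C * (cis (dot xi y / hbar) * ft hbar f xi).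
    rewrite /F /= cintZ; last first.
      by apply: cintegrableZ; apply: cintegrable_cisM => //; exact: measurable_dotc.
    rewrite cintZ //.
    by apply: cintegrable_cisM => //; exact: measurable_dotc.
  under [in X in _ = X]eq_cint do rewrite outer.
  move=> <-.
  pose f' z := f z * (K / s k ^+ n * g (c0 / s k ^+ 2) (y - z))%:C.
  have f'i : cintegrable (leb R n) f'.
    apply: (cintegrable_le _ _ (integrableZl measurableT (K / s k ^+ n) (cintegrable_norm fi))).
      apply: cmeasM; first by case: fi.
      apply: cmeas_real; apply: measurable_funM => //.
      apply: (measurableT_comp (mg _)); apply: measurable_rowB; first exact: measurable_cst.
      exact: measurable_id.
    have Ks : 0 <= K / s k ^+ n by rewrite divr_ge0 ?exprn_ge0 ?sqrtr_ge0// ltW.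
    move=> z; rewrite /f' normcM mulrC normc_R normrM ger0_norm// ger0_norm ?gauss_ge0//.
    rewrite ler_wpM2r ?normc_ge0// ler_piMr// gauss_le1// => _.
    by rewrite divr_ge0 ?exprn_ge0 ?ltW.
  have [_] := cint_affine y (lt0r_neq0 (s0 k)) f'i.
  rewrite gtr0_norm// => E.
  have -> : cint (leb R n) f' = (s k ^+ n)%:C * cint (leb R n) (fun x => f' (s k *: x + y)).
    by rewrite E mulrA -rmorphM divff ?mul1r// expf_neq0// gt_eqF.
  have E' u : f' (s k *: u + y) = (K / s k ^+ n)%:C * ((g c0 u)%:C * f (s k *: u + y)).
    rewrite /f' rmorphM mulrC -mulrA; congr (_ * (_%:C * _)).
    rewrite opprD addrCA subrr addr0 /g gaussN /gauss; congr (expR (- _)).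
    apply: eq_bigr => i _; rewrite mxE exprMn mulrA divfK//.
    by rewrite expf_neq0// gt_eqF.
  rewrite (eq_cint _ E') cintZ; last first.
    apply: (cintegrable_le _ _ (integrableZl measurableT B (integrable_gauss (fun=> c00)))).
      apply: cmeasM; first exact: (cmeas_real (mg _)).
      exact: (cmeas_comp (measurable_affine_row _ _) (cmeas_continuous cf)).
    move=> u; rewrite normcM normc_R ger0_norm ?gauss_ge0// mulrC.
    by rewrite ler_wpM2r// gauss_ge0.
  rewrite mulrA -rmorphM; congr (_%:C * _).
  by rewrite mulrCA divff ?mulr1// expf_neq0// gt_eqF.
have lim1 : cint (leb R n) (fun xi => (g (s k ^+ 2 * c0) xi)%:C *
      (cis (dot xi y / hbar) * ft hbar f xi)) @[k --> \oo] -->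
    K%:C * (K%:C * f y).
  under eq_fun do rewrite key.
  apply: cvg_complexM; first exact: cvg_cst.
  by rewrite -Ig; exact: (@approx_identity (fun=> c0) f B s y (fun=> c00) cf fB scvg).
have mdot : measurable_fun setT (fun xi : 'rV[R]_n => dot xi y / hbar).
  apply: measurable_funM => //; apply: measurable_dot; first exact: measurable_id.
  exact: measurable_cst.
have icf := cintegrable_cisM mdot fti.
have lim2 : cint (leb R n) (fun xi => (g (s k ^+ 2 * c0) xi)%:C *
      (cis (dot xi y / hbar) * ft hbar f xi)) @[k --> \oo] -->
    cint (leb R n) (fun xi => cis (dot xi y / hbar) * ft hbar f xi).
  apply: (cint_dominated _ _ _ _ (cintegrable_norm fti)).
  - by move=> k; apply: cmeasM; [exact: (cmeas_real (mg _))|case: icf].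
  - by case: icf.
  - move=> xi; rewrite -[X in _ --> X]mul1r.
    apply: cvg_complexM; last exact: cvg_cst.
    apply: cvg_real_complex; under eq_fun do rewrite /g gauss_cst.
    have e0 : - (s k ^+ 2 * c0 * dot xi xi) @[k --> \oo] --> (0 : R).
      rewrite -[X in _ --> X]oppr0; apply: cvgN.
      rewrite -(mul0r (dot xi xi)); apply: cvgM; last exact: cvg_cst.
      rewrite -(mul0r c0); apply: cvgM; last exact: cvg_cst.
      by under eq_fun do rewrite expr2; rewrite -(mul0r 0); exact: cvgM.
    by rewrite -expR0; apply: cvg_comp; [exact: e0|exact: continuous_expR].
  - move=> k xi; rewrite !normcM normc_cis mul1r normc_R ger0_norm ?gauss_ge0//.
    rewrite ler_piMl ?normc_ge0// gauss_le1// => _; exact: ltW.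
have := cvg_unique (@norm_hausdorff _ _) lim1 lim2 => <-.
rewrite !mulrA -!rmorphM -mulrA KK mulVf ?mul1r//.
by rewrite expf_neq0// gt_eqF.
Qed.

End fourier_inversion.

(** * Schwartz functions *)

Section weights.
Context {R : realType} {n : nat}.
Implicit Types (x y : 'rV[R]_n).

(** An integrable majorant that is a product over the coordinates, so that its integrability is that
    of 1/(1 + x^2) on the line. *)
Definition cauchy_weight x : R := \prod_(i < n) (1 + x 0 i ^+ 2)^-1.

Lemma cauchy_weight_gt0 x : 0 < cauchy_weight x.
Proof. by apply: prodr_gt0 => i _; rewrite invr_gt0 ltr_pwDl// sqr_ge0. Qed.

Lemma integrable_cauchy_weight : (leb R n).-integrable setT (EFin \o cauchy_weight).
Proof.
have c1 : cintegrable lebesgue_measure (fun x : R => (oneDsqr x)^-1%:C).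
  have m1 : measurable_fun setT (fun x : R => (oneDsqr x)^-1).
    exact: (continuous_measurable_fun (@continuous_oneDsqrV R)).
  split; first exact: (cmeas_real m1).
  have E (x : R) : (normc (oneDsqr x)^-1%:C)%:E = (oneDsqr x)^-1%:E :> \bar R.
    by rewrite normc_R ger0_norm// invr_ge0.
  under eq_integral do rewrite E.
  rewrite ge0_symfun_integralT.
  - have -> : [set x : R | (0 <= x)%R] = `[0%R, +oo[%classic.
      by apply/seteqP; split => x /=; rewrite in_itv /= andbT.
    by rewrite integral0y_oneDsqr -EFinM ltry.
  - by move=> x; rewrite invr_ge0.
  - exact: continuous_oneDsqrV.
  - by move=> x; rewrite /oneDsqr /= sqrrN.
have [ci _] := @cint_coord_prod R n (fun _ (r : R) => (oneDsqr r)^-1%:C) (fun=> c1).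
apply: eq_integrable (cintegrable_norm ci) => // x _; rewrite /comp -rmorph_prod normc_R.
by rewrite ger0_norm// ltW// cauchy_weight_gt0.
Qed.

Lemma le_row_norm x i : `|x 0 i| <= `|x|.
Proof.
rewrite [leRHS]/Num.norm /= mx_normrE.
exact: (le_bigmax _ (fun ij : 'I_1 * 'I_n => `|x ij.1 ij.2|) (0, i)).
Qed.

(** The norm being the maximum norm, the product of the 1 + x_i^2 is at most (1 + |x|^2)^n <= 2^n (1
    + |x|^(2n)); boundedness together with decay of order 2n is therefore enough. *)
Lemma decay_weight (r : R) x (C : R) : `|r| <= C -> `|x| ^+ (2 * n) * `|r| <= C ->
  `|r| <= 2 ^+ n * (2 * C) * cauchy_weight x.
Proof.
move=> rC xC.
have P0 : 0 < \prod_(i < n) (1 + x 0 i ^+ 2).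
  by apply: prodr_gt0 => i _; rewrite ltr_pwDl// sqr_ge0.
rewrite /cauchy_weight prodfV ler_pdivlMr// mulrC.
have x0 := normr_ge0 x.
have P1 : \prod_(i < n) (1 + x 0 i ^+ 2) <= (1 + `|x| ^+ 2) ^+ n.
  rewrite -[X in _ ^+ X]card_ord -prodr_const; apply: ler_prod => i _.
  rewrite addr_ge0 ?sqr_ge0//= lerD2l -(real_normK (num_real (x 0 i))).
  by rewrite lerXn2r ?nnegrE// le_row_norm.
have P2 : (1 + `|x| ^+ 2) ^+ n <= 2 ^+ n * (1 + `|x| ^+ (2 * n)).
  have [x1|x1] := leP (`|x| ^+ 2) 1.
    apply: (@le_trans _ _ (2 ^+ n)); last by rewrite ler_peMr ?exprn_ge0// lerDl exprn_ge0.
    by rewrite lerXn2r ?nnegrE ?addr_ge0 ?exprn_ge0//; lra.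
  apply: (@le_trans _ _ ((2 * `|x| ^+ 2) ^+ n)).
    by rewrite lerXn2r ?nnegrE ?addr_ge0 ?mulr_ge0 ?exprn_ge0//; lra.
  by rewrite exprMn -exprM ler_wpM2l ?exprn_ge0// lerDr.
apply: (le_trans (ler_wpM2r (normr_ge0 r) (le_trans P1 P2))).
rewrite -mulrA ler_wpM2l ?exprn_ge0//; lra.
Qed.

(** A displacement by at most 1 along an axis changes one factor of the weight, by a bounded ratio.
    This dominates difference quotients, whose intermediate points are displaced in this way. *)
Lemma cauchy_weight_shift x (j : 'I_n) (s : R) : 0 <= s <= 1 ->
  cauchy_weight (s *: delta_mx 0 j + x) <= 3 * cauchy_weight x.
Proof.
move=> s01; rewrite /cauchy_weight (bigD1 j)//= [in leRHS](bigD1 j)//= mulrA.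
have -> : \prod_(i < n | i != j) (1 + (s *: delta_mx 0 j + x) 0 i ^+ 2)^-1 =
          \prod_(i < n | i != j) (1 + x 0 i ^+ 2)^-1.
  by apply: eq_bigr => i ij; rewrite !mxE (negbTE ij) andbF mulr0 add0r.
apply: ler_wpM2r.
  by apply: prodr_ge0 => i _; rewrite invr_ge0 addr_ge0// sqr_ge0.
rewrite !mxE !eqxx mulr1.
have p0 (y : R) : 0 < 1 + y ^+ 2 by rewrite ltr_pwDl// sqr_ge0.
rewrite ler_pdivlMr// mulrC ler_pdivrMr//.
have := sqr_ge0 (x 0 j + 2 * s); have := sqr_ge0 (s + x 0 j).
by case/andP: s01 => s0 s1; set r := x 0 j; nra.
Qed.

End weights.

Section directional_derivative.
Context {R : realType}.

Lemma is_derive_line (n : nat) (f : 'rV[R]_n -> R) (v x : 'rV[R]_n) (t df : R) :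
  is_derive (t *: v + x) v f df -> is_derive t (1 : R) (fun t : R => f (t *: v + x)) df.
Proof.
move=> [d1 d2].
have E : (fun h : R => h^-1 *: (((fun t => f (t *: v + x)) \o shift t) (h *: 1) -
      f (t *: v + x))) =
    (fun h => h^-1 *: ((f \o shift (t *: v + x)) (h *: v) - f (t *: v + x))).
  apply/funext => h /=; congr (_ *: (f _ - _)).
  by rewrite scalerDl -addrA /GRing.scale /= mulr1.
by split; rewrite /derivable /derive E.
Qed.

Lemma line_is_derive (n : nat) (f : 'rV[R]_n -> R) (v x : 'rV[R]_n) (df : R) :
  is_derive (0 : R) (1 : R) (fun t : R => f (t *: v + x)) df -> is_derive x v f df.
Proof.
move=> [d1 d2].
have E : (fun h : R => h^-1 *: (((fun t => f (t *: v + x)) \o shift 0) (h *: 1) -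
      f (0 *: v + x))) =
    (fun h => h^-1 *: ((f \o shift x) (h *: v) - f x)).
  apply/funext => h /=; rewrite scale0r add0r; congr (_ *: (f (_ *: _ + _) - _)).
  by rewrite addr0 /GRing.scale /= mulr1.
by split; [rewrite /derivable -E|rewrite /derive -E].
Qed.

Lemma derive_seq (f : R -> R) (x df : R) (t : nat -> R) : is_derive x (1 : R) f df ->
  (forall k, t k != 0) -> t k @[k --> \oo] --> 0 ->
  (f (t k + x) - f x) / t k @[k --> \oo] --> df.
Proof.
move=> [d1 d2] t0 tcvg.
have : (fun h => h^-1 *: ((f \o shift x) (h *: (1 : R)) - f x)) @ 0^' --> df.
  by rewrite -d2; exact: d1.
move/cvgr_dnbhsP => /(_ t (conj t0 tcvg)).
by under eq_fun do rewrite /GRing.scale /= mulr1 mulrC.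
Qed.

End directional_derivative.

Section schwartz_fourier.
Context {R : realType} {n : nat}.
Implicit Types (u : 'rV[R]_n -> R).

Lemma rschwartz_partial u j : rschwartz u -> rschwartz ('D_(delta_mx 0 j) u).
Proof.
move=> su s; have := su (rcons s j).
by rewrite /iter_partial foldr_rcons.
Qed.

Lemma rschwartz_differentiable u : rschwartz u -> forall x, differentiable u x.
Proof. by move=> su x; have [+ _] := su [::]; apply. Qed.

Lemma rschwartz_continuous u : rschwartz u -> continuous u.
Proof. by move=> su x; exact/differentiable_continuous/rschwartz_differentiable. Qed.

Lemma rschwartz_measurable u : rschwartz u -> measurable_fun setT u.
Proof. by move=> su; exact: (continuous_measurable_row (rschwartz_continuous su)). Qed.

Lemma rschwartz_weight u : rschwartz u ->
  exists2 C, 0 <= C & forall x, `|u x| <= C * cauchy_weight x.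
Proof.
move=> su; have [_ bu] := su [::].
have [C0 b0] := bu 0%N; have [C1 b1] := bu (2 * n)%N.
have C00 : 0 <= C0 by apply: le_trans (b0 0); rewrite expr0 mul1r.
exists (2 ^+ n * (2 * Num.max C0 C1)).
  by rewrite !mulr_ge0 ?exprn_ge0// le_max C00.
move=> x; apply: decay_weight.
  by rewrite le_max; have := b0 x; rewrite expr0 mul1r => ->.
by rewrite le_max b1 orbT.
Qed.

Lemma rschwartz_integrable u : rschwartz u -> (leb R n).-integrable setT (EFin \o u).
Proof.
move=> su; have [C C0 uC] := rschwartz_weight su.
apply: le_integrable (integrableZl measurableT C integrable_cauchy_weight) => //.
  by apply/measurable_EFinP; exact: rschwartz_measurable.
by move=> x _ /=; rewrite lee_fin (le_trans (uC x)) ?ler_norm.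
Qed.

Lemma rschwartz_cintegrable u : rschwartz u -> cintegrable (leb R n) (fun x => (u x)%:C).
Proof.
move=> su; apply: (cintegrable_le _ _ (integrable_norm (rschwartz_integrable su))).
  exact: (cmeas_real (rschwartz_measurable su)).
by move=> x; rewrite normc_R.
Qed.

(** The transforms of the difference quotients of [u] have two limits. Dominated convergence gives
    the transform of the derivative; translation invariance rewrites them as (exp(i t th) - 1)/t
    times the transform of [u], whose limit is the other side. *)
Lemma ft_partial (hbar : R) u j xi : rschwartz u ->
  ft hbar (fun x => ('D_(delta_mx 0 j) u x)%:C) xi =
  (0 +i* (xi 0 j / hbar)) * ft hbar (fun x => (u x)%:C) xi.
Proof.
move=> su; pose v : 'rV[R]_n := delta_mx 0 j.
pose th := xi 0 j / hbar.
pose t (k : nat) : R := k.+1%:R^-1.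
have t0 k : 0 < t k by rewrite invr_gt0.
have tn0 k : t k != 0 by rewrite gt_eqF.
have tcvg : t k @[k --> \oo] --> 0 by exact: cvg_harmonic.
have dl (x : 'rV[R]_n) (s : R) : is_derive s (1 : R) (fun s : R => u (s *: v + x))
    ('D_v u (s *: v + x)).
  apply: is_derive_line; apply: DeriveDef => //.
  by apply: diff_derivable; exact: rschwartz_differentiable.
pose e (x : 'rV[R]_n) : R[i] := cis (- (dot xi x / hbar)).
have me : cmeas e by apply: cmeas_cis; exact: measurable_dotc.
have muC := cmeas_real (rschwartz_measurable su).
have mq k : measurable_fun setT (fun x => (u (t k *: v + x) - u x) / t k).
  apply: measurable_funM => //; apply: measurable_funB; last exact: rschwartz_measurable.
  apply: (measurableT_comp (rschwartz_measurable su)).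
  by apply: measurable_rowD; [exact: measurable_cst|exact: measurable_id].
have [C C0 DC] := rschwartz_weight (rschwartz_partial j su).
have lim1 : cint (leb R n) (fun x => e x * ((u (t k *: v + x) - u x) / t k)%:C)
    @[k --> \oo] --> ft hbar (fun x => ('D_v u x)%:C) xi.
  apply: (cint_dominated _ _ _ _ (integrableZl measurableT (3 * C) integrable_cauchy_weight)).
  - by move=> k; apply: cmeasM => //; exact: (cmeas_real (mq k)).
  - apply: cmeasM => //.
    exact: (cmeas_real (rschwartz_measurable (rschwartz_partial j su))).
  - move=> x; apply: cvg_complexM; first exact: cvg_cst.
    apply: cvg_real_complex; have := derive_seq (dl x 0) tn0 tcvg.
    rewrite scale0r add0r; under eq_fun do rewrite addr0; exact.
  (* By the mean value theorem the quotient is a value of the derivative at a point displaced by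
     less than [t k], and [t k] <= 1. *)
  - move=> k x; rewrite normcM normc_cis mul1r normc_R.
    have cl : {within `[0, t k], continuous (fun s => u (s *: v + x))}.
      apply: continuous_subspaceT; apply: dfun_continuous => s.
      by exists ('D_v u (s *: v + x)).
    have [c] := MVT (t0 k) (fun s _ => dl x s) cl.
    rewrite scale0r add0r in_itv /= subr0 => /andP[c0 ct] ->; rewrite mulfK//.
    apply: le_trans (DC _) _; rewrite (mulrC 3) -mulrA ler_wpM2l//.
    apply: cauchy_weight_shift; rewrite ltW//= (le_trans (ltW ct))//.
    by rewrite invf_le1// ler1n.
have E k : cint (leb R n) (fun x => e x * ((u (t k *: v + x) - u x) / t k)%:C) =
    ((cis (t k * th) - 1) * (t k)^-1%:C) * ft hbar (fun x => (u x)%:C) xi.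
  have iu := cintegrable_cisM (measurable_dotc hbar xi) (rschwartz_cintegrable su).
  have [iu' Eu'] := cint_shift (t k *: v) iu.
  pose G x := e (x + t k *: v) * (u (x + t k *: v))%:C.
  have eE x : e x = cis (t k * th) * e (x + t k *: v).
    rewrite /e -cisD; congr cis; rewrite dotDr dotZr.
    have -> : dot xi v = xi 0 j.
      rewrite /dot (bigD1 j)//= big1 ?addr0 => [|i ij]; rewrite mxE ?eqxx ?mulr1//.
      by rewrite (negbTE ij) mulr0.
    rewrite /th; ring.
  have E1 x : e x * ((u (t k *: v + x) - u x) / t k)%:C =
      ((t k)^-1%:C * cis (t k * th)) * G x - (t k)^-1%:C * (e x * (u x)%:C).
    rewrite rmorphM rmorphB.
    transitivity ((t k)^-1%:C * (e x * (u (t k *: v + x))%:C) - (t k)^-1%:C * (e x * (u x)%:C)).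
      by ring.
    by congr (_ - _); rewrite eE /G (addrC x); ring.
  rewrite (eq_cint _ E1) cintB; last 2 first.
  - exact: cintegrableZ.
  - exact: cintegrableZ.
  by rewrite !cintZ// /G Eu' -/(ft hbar (fun x => (u x)%:C) xi); ring.
have lim2 : cint (leb R n) (fun x => e x * ((u (t k *: v + x) - u x) / t k)%:C)
    @[k --> \oo] --> (0 +i* th) * ft hbar (fun x => (u x)%:C) xi.
  under eq_fun do rewrite E.
  apply: cvg_complexM; last exact: cvg_cst.
  have dth (f : R -> R) (df : R) : is_derive (0 : R) (1 : R) f df ->
      (f (t k * th) - f 0) / t k @[k --> \oo] --> df * th.
    move=> df0.
    have d2 : is_derive (0 : R) (1 : R) (fun s => f (s * th)) (df * th).
      have dm : is_derive (0 : R) (1 : R) (fun s : R => s * th) th.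
        eapply is_derive_eq; first by dfun.
        by rewrite /=; ring.
      by apply: (@dfun_comp R f (fun s => s * th)) => //; rewrite mul0r.
    have := derive_seq d2 tn0 tcvg; rewrite mul0r.
    by under eq_fun do rewrite addr0; exact.
  have dc := dth _ _ (is_derive_cos 0); have ds := dth _ _ (is_derive_sin 0).
  rewrite sin0 oppr0 mul0r cos0 in dc; rewrite cos0 mul1r sin0 in ds.
  apply/cvg_complexP; split.
    under eq_fun do rewrite ReM ReB /= mulr0 subr0; exact: dc.
  by under eq_fun do rewrite ImM ImB /= mulr0 add0r; exact: ds.
exact: (cvg_unique (@norm_hausdorff _ _) lim1 lim2).
Qed.

(** Differentiating 2n times in direction j multiplies the transform by a factor of modulus
    (|xi_j|/hbar)^(2n). Taking for j a coordinate realizing the maximum norm of xi gives decay of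
    order 2n, which suffices for integrability. *)
Lemma ft_rschwartz_weight (hbar : R) u : 0 < hbar -> rschwartz u ->
  exists C, forall xi, normc (ft hbar (fun x => (u x)%:C) xi) <= C * cauchy_weight xi.
Proof.
move=> h0 su.
have bnd (w : 'rV[R]_n -> R) : rschwartz w -> exists2 C, 0 <= C &
    forall xi, normc (ft hbar (fun x => (w x)%:C) xi) <= C.
  move=> sw; exists (\int[leb R n]_x `|w x|); first exact: Rintegral_ge0.
  move=> xi; apply: normc_cint_le.
  - apply: cmeasM; first by apply: cmeas_cis; exact: measurable_dotc.
    exact: (cmeas_real (rschwartz_measurable sw)).
  - by move=> x; rewrite normcM normc_cis mul1r normc_R.
  - exact: (integrable_norm (rschwartz_integrable sw)).
have sit s : rschwartz (iter_partial s u).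
  by elim: s => [//|j s IHs]; exact: rschwartz_partial.
have pw j k xi : normc (ft hbar (fun x => (iter_partial (nseq k j) u x)%:C) xi) =
    (`|xi 0 j| / hbar) ^+ k * normc (ft hbar (fun x => (u x)%:C) xi).
  elim: k => [|k IHk]; first by rewrite expr0 mul1r.
  rewrite [ft _ _ _](@ft_partial hbar (iter_partial (nseq k j) u) j xi)// normcM IHk exprS mulrA; congr (_ * _ * _).
  by rewrite /= expr0n add0r sqrtr_sqr normrM normfV (gtr0_norm h0).
have [C0 C00 b0] := bnd _ su.
have /choice[C1 b1] (j : 'I_n) : exists C : R, 0 <= C /\ forall xi : 'rV[R]_n, `|xi 0 j| ^+ (2 * n) *
    normc (ft hbar (fun x => (u x)%:C) xi) <= C.
  have [C Cge bC] := bnd _ (sit (nseq (2 * n) j)).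
  exists (hbar ^+ (2 * n) * C); split; first by rewrite mulr_ge0// exprn_ge0// ltW.
  move=> xi; have := bC xi; rewrite pw exprMn exprVn.
  by rewrite mulrAC ler_pdivrMr ?exprn_gt0// (mulrC C).
pose C := C0 + \sum_j C1 j.
have S0 : 0 <= \sum_j C1 j by apply: sumr_ge0 => j _; case: (b1 j).
exists (2 ^+ n * (2 * C)) => xi.
set r := normc _; have r0 : 0 <= r by exact: normc_ge0.
rewrite -(ger0_norm r0); apply: decay_weight; rewrite ger0_norm//.
  by apply: le_trans (b0 xi) _; rewrite lerDl.
have [x0|xn0] := eqVneq `|xi| 0.
  rewrite x0; case: (2 * n)%N => [|m]; first by rewrite expr0 mul1r (le_trans (b0 xi))// lerDl.
  by rewrite expr0n mul0r addr_ge0.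
have [[i j] /= E] := mx_norm_neq0 xn0.
have {E} E : `|xi| = `|xi 0 j| by rewrite [LHS]E (ord1 i).
rewrite E; have [_ /(_ xi) h] := b1 j; apply: (le_trans h).
rewrite /C (bigD1 j)//= addrCA lerDl addr_ge0// sumr_ge0// => k _.
by case: (b1 k).
Qed.

Lemma ft_schwartz_integrable (hbar : R) (f : 'rV[R]_n -> R[i]) : 0 < hbar -> schwartz f ->
  cintegrable (leb R n) (ft hbar f).
Proof.
move=> h0 [sr si]; have [C1 b1] := ft_rschwartz_weight h0 sr.
have [C2 b2] := ft_rschwartz_weight h0 si.
have E xi : ft hbar f xi = ft hbar (fun x => (Re (f x))%:C) xi +
    (0 +i* 1) * ft hbar (fun x => (Im (f x))%:C) xi.
  have ir := cintegrable_cisM (measurable_dotc hbar xi) (rschwartz_cintegrable sr).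
  have ii := cintegrable_cisM (measurable_dotc hbar xi) (rschwartz_cintegrable si).
  rewrite /ft -cintZ// -cintD//; last exact: cintegrableZ.
  apply: eq_cint => x; rewrite mulrCA -mulrDr; congr (_ * _).
  by apply: complex_ext; rewrite ?ReD ?ImD ?ReM ?ImM /=; ring.
have mfx : cmeas f.
  by split; exact: rschwartz_measurable.
apply: (cintegrable_le _ _ (integrableZl measurableT (C1 + C2) integrable_cauchy_weight)).
  exact: cmeas_ft.
move=> xi; rewrite E mulrDl; apply: le_trans (le_normcD _ _) _; apply: lerD; first exact: b1.
by rewrite normcM /= expr0n add0r expr1n sqrtr1 mul1r; exact: b2.
Qed.

Lemma schwartz_integrable (f : 'rV[R]_n -> R[i]) : schwartz f -> cintegrable (leb R n) f.
Proof.
move=> [sr si]; apply: cintegrable_comp.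
- by split; exact: rschwartz_measurable.
- exact: rschwartz_integrable.
- exact: rschwartz_integrable.
Qed.

Lemma schwartz_continuous (f : 'rV[R]_n -> R[i]) : schwartz f -> continuous f.
Proof.
move=> [/rschwartz_continuous cr /rschwartz_continuous ci].
exact: continuous_ReIm.
Qed.

Lemma schwartz_bounded (f : 'rV[R]_n -> R[i]) : schwartz f ->
  exists B, forall x, normc (f x) <= B.
Proof.
move=> [sr si]; have [_ /(_ 0%N)[B1 b1]] := sr [::]; have [_ /(_ 0%N)[B2 b2]] := si [::].
exists (B1 + B2) => x; apply: le_trans (normc_le _) _; apply: lerD.
  by have := b1 x; rewrite expr0 mul1r.
by have := b2 x; rewrite expr0 mul1r.
Qed.

End schwartz_fourier.

Section schwartz_gaussian.
Context {R : realType} {n : nat}.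
Implicit Types (x v : 'rV[R]_n) (p : 'rV[R]_n -> R).

(** Polynomial functions: the products of a polynomial and a Gaussian are stable under directional
    derivatives, which the induction over [iter_partial] needs. *)
Inductive poly_fun : ('rV[R]_n -> R) -> Prop :=
| poly_fun_cst c : poly_fun (fun=> c)
| poly_fun_coord i : poly_fun (fun x => x 0 i)
| poly_funD p1 p2 : poly_fun p1 -> poly_fun p2 -> poly_fun (fun x => p1 x + p2 x)
| poly_funM p1 p2 : poly_fun p1 -> poly_fun p2 -> poly_fun (fun x => p1 x * p2 x).

Lemma poly_fun_differentiable p x : poly_fun p -> differentiable p x.
Proof.
elim=> {p} [c|i|p1 p2 _ h1 _ h2|p1 p2 _ h1 _ h2].
- exact: differentiable_cst.
- exact: differentiable_coord.
- exact: differentiableD.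
- exact: differentiableM.
Qed.

Lemma is_derive_poly_fun p v : poly_fun p ->
  exists2 p', poly_fun p' & forall x, is_derive x v p (p' x).
Proof.
elim=> {p} [c|i|p1 p2 _ [q1 pq1 d1] _ [q2 pq2 d2]|p1 p2 P1 [q1 pq1 d1] P2 [q2 pq2 d2]].
- by exists (fun=> 0); [exact: poly_fun_cst|move=> x; exact: is_derive_cst].
- exists (fun=> v 0 i); [exact: poly_fun_cst|move=> x; apply: line_is_derive].
  have -> : (fun t => (t *: v + x) 0 i) = (fun t => t * v 0 i + x 0 i).
    by apply/funext => t; rewrite !mxE.
  eapply is_derive_eq; first by dfun.
  by rewrite /=; ring.
- exists (fun x => q1 x + q2 x); [exact: poly_funD|move=> x; exact: is_deriveD].
- exists (fun x => p1 x * q2 x + p2 x * q1 x).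
    by apply: poly_funD; exact: poly_funM.
  by move=> x; exact: is_deriveM.
Qed.

Lemma poly_fun_growth p : poly_fun p ->
  exists C m, 0 <= C /\ forall x, `|p x| <= C * (1 + `|x|) ^+ m.
Proof.
elim=> {p} [c|i|p1 p2 _ [C1 [m1 [c1 h1]]] _ [C2 [m2 [c2 h2]]]
           |p1 p2 _ [C1 [m1 [c1 h1]]] _ [C2 [m2 [c2 h2]]]].
- by exists `|c|, 0%N; split => // x; rewrite expr0 mulr1.
- exists 1, 1%N; split => // x; rewrite mul1r expr1.
  by apply: le_trans (le_row_norm x i) _; rewrite lerDr.
- exists (C1 + C2), (m1 + m2)%N; split; first exact: addr_ge0.
  move=> x; have x1 : 1 <= 1 + `|x| by rewrite lerDl.
  apply: le_trans (ler_normD _ _) _; rewrite mulrDl; apply: lerD.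
    apply: le_trans (h1 x) _; rewrite ler_wpM2l//.
    by apply: ler_weXn2l => //; exact: leq_addr.
  apply: le_trans (h2 x) _; rewrite ler_wpM2l//.
  by apply: ler_weXn2l => //; exact: leq_addl.
- exists (C1 * C2), (m1 + m2)%N; split; first exact: mulr_ge0.
  move=> x; rewrite normrM exprD mulrACA.
  exact: ler_pM.
Qed.

Variable a : 'I_n -> R.
Hypothesis a0 : forall i, 0 < a i.

Let qform x := \sum_(i < n) a i * x 0 i ^+ 2.

Let qform_poly : poly_fun qform.
Proof.
rewrite /qform; elim: (index_enum _) => [|i s IHs].
  by under eq_fun do rewrite big_nil; exact: poly_fun_cst.
under eq_fun do rewrite big_cons expr2.
apply: poly_funD => //; apply: poly_funM; first exact: poly_fun_cst.
by apply: poly_funM; exact: poly_fun_coord.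
Qed.

Let poly_funN p : poly_fun p -> poly_fun (fun x => - p x).
Proof.
move=> pp; under eq_fun do rewrite -mulN1r.
by apply: poly_funM => //; exact: poly_fun_cst.
Qed.

Let gauss_differentiable x : differentiable (gauss a) x.
Proof.
apply: (@differentiable_comp _ _ _ _ (fun x => - qform x) expR).
  exact/poly_fun_differentiable/poly_funN.
exact/derivable1_diffP.
Qed.

Let derive_poly_gauss p v : poly_fun p ->
  exists2 p', poly_fun p' & 'D_v (fun x => p x * gauss a x) = (fun x => p' x * gauss a x).
Proof.
move=> pp; have [q pq dq] := is_derive_poly_fun v pp.
have [r pr dr] := is_derive_poly_fun v (poly_funN qform_poly).
exists (fun x => q x + p x * r x).
  by apply: poly_funD => //; exact: poly_funM.
apply/funext => x.
have dg : is_derive x v (gauss a) (gauss a x * r x).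
  apply: line_is_derive.
  have := dr x; rewrite -{1}(add0r x) -{1}(scale0r v) => /is_derive_line h.
  apply: is_derive_eq (dfun_expR h) _.
  by rewrite scale0r add0r.
have d := is_deriveM (dq x) dg.
rewrite (@derive_val _ _ _ _ _ _ _ d) /GRing.scale /=; ring.
Qed.

Let iter_poly_gauss p s : poly_fun p ->
  exists2 p', poly_fun p' & iter_partial s (fun x => p x * gauss a x) =
                            (fun x => p' x * gauss a x).
Proof.
move=> pp; elim: s => [|j s [q pq E]]; first by exists p.
have [r pr Er] := derive_poly_gauss (delta_mx 0 j) pq.
by exists r => //; rewrite /= -Er -E.
Qed.

Let gauss_decay m : exists C, forall x, (1 + `|x|) ^+ m * gauss a x <= C.
Proof.
have [c c0 ca] : exists2 c, 0 < c & forall x, c * `|x| ^+ 2 <= qform x.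
  (* The default value 1 keeps [c] positive when [n] is 0. *)
  pose c := \big[Num.min/1]_(i < n) a i.
  have c0 : 0 < c by apply/bigmin_gtP.
  exists c => // x; have q0 : 0 <= qform x.
    by apply: sumr_ge0 => i _; rewrite mulr_ge0 ?sqr_ge0// ltW.
  have [->|xn0] := eqVneq `|x| 0; first by rewrite expr0n mulr0.
  have [[i j] /= E] := mx_norm_neq0 xn0.
  have {E} E : `|x| = `|x 0 j| by rewrite [LHS]E (ord1 i).
  rewrite E real_normK ?num_real// /qform (bigD1 j)//=.
  apply: (@le_trans _ _ (a j * x 0 j ^+ 2)).
    by rewrite ler_wpM2r ?sqr_ge0// /c; apply: bigmin_le_cond.
  by rewrite lerDl sumr_ge0// => k _; rewrite mulr_ge0 ?sqr_ge0// ltW.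
(* [K] is such that (1 + r)^2 <= 2 (1 + r^2) <= K (1 + c r^2/k). The k-th power of the last factor
   is at most exp(c r^2), and the successor keeps k nonzero. *)
pose k := m.+1; pose K := 2 * (1 + k%:R / c).
have k0 : 0 < k%:R :> R by [].
have kc0 : 0 <= k%:R / c by rewrite divr_ge0// ltW.
have K1 : 1 <= K by rewrite /K; move: kc0; set d := k%:R / c => kc0; lra.
exists (K ^+ k) => x; set r := `|x|.
have r0 : 0 <= r by exact: normr_ge0.
have h1 : (1 + r) ^+ m <= ((1 + r) ^+ 2) ^+ k.
  rewrite -exprM; apply: ler_weXn2l; first by rewrite lerDl.
  by rewrite /k mul2n -addnn; apply: leq_trans (leq_addr _ _); exact: leqnSn.
have h2 : (1 + r) ^+ 2 <= K * (1 + c * r ^+ 2 / k%:R).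
  have d0 : 0 <= k%:R / c by rewrite divr_ge0// ltW.
  have e0 : 0 <= c * r ^+ 2 / k%:R by rewrite divr_ge0// mulr_ge0 ?exprn_ge0// ltW.
  have de : k%:R / c * (c * r ^+ 2 / k%:R) = r ^+ 2 by field; rewrite !gt_eqF.
  rewrite /K; set d := k%:R / c in d0 de *; set e := c * r ^+ 2 / k%:R in e0 de *.
  have := sqr_ge0 (1 - r); nra.
have h3 : (1 + c * r ^+ 2 / k%:R) ^+ k <= expR (qform x).
  apply: (@le_trans _ _ (expR (c * r ^+ 2))); last by rewrite ler_expR; exact: ca.
  have -> : expR (c * r ^+ 2) = expR (c * r ^+ 2 / k%:R) ^+ k.
    by rewrite -expRM_natr divfK// gt_eqF.
  apply: lerXn2r; rewrite ?nnegrE ?expR_ge0 ?expR_ge1Dx//.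
  by rewrite addr_ge0// divr_ge0// mulr_ge0 ?exprn_ge0// ltW.
rewrite /gauss -/(qform x) expRN ler_pdivrMr ?expR_gt0//.
apply: (le_trans h1); apply: (@le_trans _ _ ((K * (1 + c * r ^+ 2 / k%:R)) ^+ k)).
  by apply: lerXn2r; rewrite ?nnegrE ?exprn_ge0 ?addr_ge0// (le_trans _ h2)// exprn_ge0// addr_ge0.
rewrite exprMn ler_wpM2l// exprn_ge0// (le_trans _ K1)//.
Qed.

Lemma rschwartz_poly_gauss p : poly_fun p -> rschwartz (fun x => p x * gauss a x).
Proof.
move=> pp s; have [q pq ->] := iter_poly_gauss s pp; split.
  move=> x; apply: differentiableM; last exact: gauss_differentiable.
  exact: poly_fun_differentiable.
move=> k; have [C [m [C0 qC]]] := poly_fun_growth pq.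
have [D gD] := gauss_decay (k + m); exists (C * D) => x.
rewrite normrM (ger0_norm (gauss_ge0 _ _)).
apply: (@le_trans _ _ (C * ((1 + `|x|) ^+ (k + m) * gauss a x))); last by rewrite ler_wpM2l.
rewrite !mulrA ler_wpM2r ?gauss_ge0// exprD mulrCA; apply: ler_pM => //.
  by apply: lerXn2r; rewrite ?nnegrE ?addr_ge0// lerDr.
Qed.

Lemma schwartz_gauss (c : R) : schwartz (fun x => (c * gauss a x)%:C).
Proof.
split.
  exact/rschwartz_poly_gauss/poly_fun_cst.
have := rschwartz_poly_gauss (poly_fun_cst 0).
by under eq_fun do rewrite mul0r.
Qed.

End schwartz_gaussian.

(** * The short-time Fourier transform *)

Lemma ge0_integral_le_add d (T : measurableType d) (R : realType)
    (mu : {measure set T -> \bar R}) (f f1 f2 : T -> R) :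
  measurable_fun setT f -> measurable_fun setT f1 -> measurable_fun setT f2 ->
  (forall x, 0 <= f x) -> (forall x, 0 <= f1 x) -> (forall x, 0 <= f2 x) ->
  (forall x, f x <= f1 x + f2 x) ->
  (\int[mu]_x (f x)%:E <= \int[mu]_x (f1 x)%:E + \int[mu]_x (f2 x)%:E)%E.
Proof.
move=> /measurable_EFinP mf /measurable_EFinP mf1 /measurable_EFinP mf2 f0 f10 f20 ff.
rewrite -ge0_integralD//; last 2 first.
- by move=> x _; rewrite lee_fin.
- by move=> x _; rewrite lee_fin.
apply: ge0_le_integral => //.
- by move=> x _; rewrite lee_fin.
- exact: emeasurable_funD.
- by move=> x _; rewrite -EFinD lee_fin.
Qed.

Section stft_theory.
Context {R : realType} {n : nat}.
Variable hbar : R.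
Implicit Types (g h : 'rV[R]_n -> R[i]) (x xi y : 'rV[R]_n).

Definition bcont h := continuous h /\ exists C, forall x, normc (h x) <= C.

(* Enough regularity of a window for all estimates below; Schwartz windows qualify. *)
Definition nice_window g := bcont g /\ cintegrable (leb R n) g.

Lemma schwartz_nice_window g : schwartz g -> nice_window g.
Proof.
move=> sg; split; last exact: schwartz_integrable.
by split; [exact: schwartz_continuous|exact: schwartz_bounded].
Qed.

Definition stft_cst : R := (2 * pi * hbar) `^ (- (n%:R / 2)).

Lemma bcontB h1 h2 : bcont h1 -> bcont h2 -> bcont (fun x => h1 x - h2 x).
Proof.
move=> [c1 [C1 b1]] [c2 [C2 b2]]; split; last first.
  exists (C1 + C2) => x; apply: le_trans (le_normcD _ _) _.
  by rewrite normcN; exact: lerD.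
apply: continuous_ReIm.
  have -> : (fun x => Re (h1 x - h2 x)) = (fun x => Re (h1 x)) - (fun x => Re (h2 x)).
    by apply/funext => x; rewrite ReB.
  by move=> x; apply: continuousB; [exact: (continuous_Re c1)|exact: (continuous_Re c2)].
have -> : (fun x => Im (h1 x - h2 x)) = (fun x => Im (h1 x)) - (fun x => Im (h2 x)).
  by apply/funext => x; rewrite ImB.
by move=> x; apply: continuousB; [exact: (continuous_Im c1)|exact: (continuous_Im c2)].
Qed.

Lemma bcont_cmeas h : bcont h -> cmeas h.
Proof. by case=> ch _; exact: cmeas_continuous. Qed.

Lemma measurable_subx x : measurable_fun setT (fun y : 'rV[R]_n => y - x).
Proof. by apply: measurable_rowB; [exact: measurable_id|exact: measurable_cst]. Qed.

Lemma cintegrable_window g h x : bcont h -> nice_window g ->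
  cintegrable (leb R n) (fun y => h y * conjc (g (y - x))).
Proof.
move=> bh [bg ig]; have [_ [C hC]] := bh.
have [igs _] := cint_shift (- x) ig.
apply: (cintegrable_le _ _ (integrableZl measurableT C (cintegrable_norm igs))).
  apply: cmeasM; first exact: bcont_cmeas.
  by apply: cmeas_conj; exact: (cmeas_comp (measurable_subx x) (bcont_cmeas bg)).
by move=> y; rewrite normcM normc_conjc ler_wpM2r ?normc_ge0.
Qed.

Lemma stftE g h x xi : bcont h -> nice_window g ->
  stft hbar g h x xi = stft_cst%:C * ft hbar (fun y => h y * conjc (g (y - x))) xi.
Proof.
move=> bh ng; rewrite /stft cintegralE; last first.
  under eq_fun do rewrite -mulrA.
  apply: cmeasM; first by apply: cmeas_cis; exact: measurable_dotc.
  by case: (cintegrable_window x bh ng).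
by congr (_ * _); apply: eq_cint => y; rewrite mulrA.
Qed.

Lemma stft_cst_ge0 : 0 <= stft_cst. Proof. exact: powR_ge0. Qed.

Lemma stft_bounded g h : bcont h -> nice_window g ->
  exists C, forall x xi, normc (stft hbar g h x xi) <= C.
Proof.
move=> bh ng; have [_ [C hC]] := bh; have [bg ig] := ng.
exists (stft_cst * (C * \int[leb R n]_y normc (g y))) => x xi.
rewrite stftE// normcM normc_R ger0_norm ?stft_cst_ge0// ler_wpM2l ?stft_cst_ge0//.
have [igs _] := cint_shift (- x) ig.
have [igs' <-] := integrable_shift (- x) (cintegrable_norm ig).
rewrite -RintegralZl//; apply: normc_cint_le.
- apply: cmeasM; first by apply: cmeas_cis; exact: measurable_dotc.
  by case: (cintegrable_window x bh ng).
- move=> y; rewrite !normcM normc_cis mul1r normc_conjc.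
  by rewrite ler_wpM2r ?normc_ge0.
- exact: (integrableZl measurableT C igs').
Qed.

(** Moves [x] from the window to [h]. Continuity in [x] then follows from that of [h], with a
    majorant, a multiple of |g|, that does not depend on [x]. *)
Lemma stft_shiftE g h x xi : bcont h -> nice_window g ->
  stft hbar g h x xi = stft_cst%:C * (cis (- (dot xi x / hbar)) *
    ft hbar (fun y => h (y + x) * conjc (g y)) xi).
Proof.
move=> bh ng; rewrite stftE//; congr (_ * _).
have iw := cintegrable_cisM (measurable_dotc hbar xi) (cintegrable_window x bh ng).
have [iw' E] := cint_shift x iw.
rewrite /ft -E -cintZ.
  apply: eq_cint => y; rewrite [RHS]mulrA -cisD addrK; congr (cis _ * _).
  by rewrite dotDr mulrDl opprD addrC.
have -> : (fun y => cis (- (dot xi y / hbar)) * (h (y + x) * conjc (g y))) =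
    (fun y => cis (dot xi x / hbar) * (cis (- (dot xi (y + x) / hbar)) *
       (h (y + x) * conjc (g (y + x - x))))).
  apply/funext => y; rewrite [RHS]mulrA -cisD addrK; congr (cis _ * _).
  by rewrite dotDr mulrDl opprD addrCA subrr addr0.
exact: cintegrableZ.
Qed.

Lemma stft_cvg g h (u : nat -> 'rV[R]_n) x xi : bcont h -> nice_window g ->
  u k @[k --> \oo] --> x ->
  stft hbar g h (u k) xi @[k --> \oo] --> stft hbar g h x xi.
Proof.
move=> bh ng ux; have [ch [C hC]] := bh; have [bg ig] := ng.
rewrite stft_shiftE//; under eq_fun do rewrite stft_shiftE//.
have mcis : cmeas (fun y : 'rV[R]_n => cis (- (dot xi y / hbar)) : R[i]).
  by apply: cmeas_cis; exact: measurable_dotc.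
have mh z : cmeas (fun y => h (y + z)).
  apply: (cmeas_comp _ (bcont_cmeas bh)).
  by apply: measurable_rowD; [exact: measurable_id|exact: measurable_cst].
have mw z : cmeas (fun y => cis (- (dot xi y / hbar)) * (h (y + z) * conjc (g y))).
  by apply: cmeasM => //; apply: cmeasM => //; apply: cmeas_conj; exact: bcont_cmeas.
apply: cvg_complexM; first exact: cvg_cst.
apply: cvg_complexM.
  have e : - (dot xi (u k) / hbar) @[k --> \oo] --> - (dot xi x / hbar).
    apply: cvgN; apply: cvgM; last exact: cvg_cst.
    rewrite /dot; elim: (index_enum _) => [|i s IHs].
      by under eq_fun do rewrite big_nil; rewrite big_nil; exact: cvg_cst.
    under eq_fun do rewrite big_cons; rewrite big_cons; apply: cvgD => //.
    apply: cvgM; first exact: cvg_cst.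
    by apply: (cvg_continuous_row (f := fun y : 'rV[R]_n => y 0 i)) => //; exact: coord_continuous.
  apply/cvg_complexP; split => /=; apply: cvg_comp; try exact: e.
    exact: continuous_cos.
  exact: continuous_sin.
apply: (@cint_dominated _ _ R (leb R n)
  (fun k y => cis (- (dot xi y / hbar)) * (h (y + u k) * conjc (g y)))
  (fun y => cis (- (dot xi y / hbar)) * (h (y + x) * conjc (g y)))
  (fun y => C * normc (g y)) (fun k => mw (u k)) (mw x)).
- move=> y; apply: cvg_complexM; first exact: cvg_cst.
  apply: cvg_complexM; last exact: cvg_cst.
  by apply: cvg_continuous_complex => //; apply: cvgD => //; exact: cvg_cst.
- move=> k y; rewrite !normcM normc_cis mul1r normc_conjc.
  by rewrite ler_wpM2r ?normc_ge0.
- exact: (integrableZl measurableT C (cintegrable_norm ig)).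
Qed.

Lemma cmeas_stft g h d (T : measurableType d) (u v : T -> 'rV[R]_n) :
  bcont h -> nice_window g -> measurable_fun setT u -> measurable_fun setT v ->
  cmeas (fun t => stft hbar g h (u t) (v t)).
Proof.
move=> bh ng mu mv; have [bg _] := ng.
under eq_fun do rewrite stftE//.
apply: cmeasM; first exact: cmeas_cst.
have mu1 : measurable_fun setT (fun p : T * 'rV[R]_n => u p.1) := measurableT_comp mu measurable_fst.
have mv1 : measurable_fun setT (fun p : T * 'rV[R]_n => v p.1) := measurableT_comp mv measurable_fst.
apply: (@cmeas_cint_param _ _ T 'rV[R]_n R (leb R n)
  (fun p => cis (- (dot (v p.1) p.2 / hbar)) * (h p.2 * conjc (g (p.2 - u p.1))))).
apply: cmeasM; first by apply: cmeas_cis_dotN => //; exact: measurable_snd.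
apply: cmeasM; first exact: (cmeas_comp measurable_snd (bcont_cmeas bh)).
apply: cmeas_conj; apply: (cmeas_comp _ (bcont_cmeas bg)).
by apply: measurable_rowB => //; exact: measurable_snd.
Qed.

Definition stft_sup g h xi : R := sup [set normc (stft hbar g h x xi) | x in setT].

Section fixed_pair.
Variables (g h : 'rV[R]_n -> R[i]).
Hypotheses (bh : bcont h) (ng : nice_window g).

Let ub xi : has_ubound [set normc (stft hbar g h x xi) | x in setT].
Proof. by have [C bC] := stft_bounded bh ng; exists C => _ [x _ <-]. Qed.

Let ne xi : [set normc (stft hbar g h x xi) | x in setT] !=set0.
Proof. by exists (normc (stft hbar g h 0 xi)), 0. Qed.

Lemma stft_le_sup x xi : normc (stft hbar g h x xi) <= stft_sup g h xi.
Proof. by apply: ub_le_sup; [exact: ub|exists x]. Qed.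

Lemma stft_sup_ge0 xi : 0 <= stft_sup g h xi.
Proof. exact: le_trans (normc_ge0 _) (stft_le_sup 0 xi). Qed.

Lemma stft_sup_le xi C : (forall x, normc (stft hbar g h x xi) <= C) -> stft_sup g h xi <= C.
Proof. by move=> bC; apply: ge_sup; [exact: ne|move=> _ [x _ <-]]. Qed.

Lemma stft_sup_bounded : exists C, forall xi, stft_sup g h xi <= C.
Proof.
by have [C bC] := stft_bounded bh ng; exists C => xi; exact: stft_sup_le.
Qed.

Lemma stft_sup_ereal xi : ereal_sup [set (normc (stft hbar g h x xi))%:E | x in setT] =
  (stft_sup g h xi)%:E.
Proof. by rewrite -ereal_sup_EFin// image_comp. Qed.

(** By continuity in the window centre, the supremum over all [x] is attained along the countable
    set of grid points, and a countable supremum of measurable functions is measurable. *)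
Lemma measurable_stft_sup : measurable_fun setT (stft_sup g h).
Proof.
(* Enumerates all grid points of all meshes. The default 0 for codes without a preimage is harmless,
   being one more centre. *)
pose pt (k : nat) : 'rV[R]_n :=
  if unpickle k is Some p then grid_point p.1 (p.2 : 'rV[int]_n) else 0.
pose u (k : nat) xi := (normc (stft hbar g h (pt k) xi))%:E.
apply/measurable_EFinP.
have -> : EFin \o stft_sup g h = (fun xi => esups (u ^~ xi) 0%N).
  apply/funext => xi; apply/eqP; rewrite eq_le; apply/andP; split; last first.
    apply: ge_ereal_sup => _ [k _ <-]; rewrite lee_fin; exact: stft_le_sup.
  rewrite /= -stft_sup_ereal; apply: ge_ereal_sup => _ [x _ <-].
  have xcvg := @cvg_grid_point R n x.
  have /cvg_normcP := stft_cvg (xi := xi) bh ng xcvg.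
  set v := stft hbar g h x xi => /cvgrPdist_lt Hv.
  apply/lee_addgt0Pr => e e0; have [k _ /(_ k (leqnn k))] := Hv _ e0.
  rewrite /= sub0r normrN ger0_norm ?normc_ge0// => Hk.
  pose m := pickle (k, grid k x).
  have ptm : pt m = grid_point k (grid k x) by rewrite /pt /m pickleK.
  apply: (@le_trans _ _ (u m xi + e%:E)%E); last first.
    by apply: leeD2r; apply: ereal_sup_ubound; exists m.
  rewrite /u ptm -EFinD lee_fin.
  have := le_normcD (stft hbar g h (grid_point k (grid k x)) xi)
    (v - stft hbar g h (grid_point k (grid k x)) xi).
  rewrite addrC subrK => /le_trans; apply.
  by rewrite lerD2l normcB_sym; exact: ltW.
apply: measurable_fun_esups => k; apply/measurable_EFinP/measurable_normc.
by apply: cmeas_stft => //; exact: measurable_cst.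
Qed.

Lemma normMinf1E : normMinf1 hbar g h = (\int[leb R n]_xi (stft_sup g h xi)%:E)%E.
Proof.
rewrite ge0_integral_leb.
- by apply: eq_integral => t _; rewrite stft_sup_ereal.
- by apply/measurable_EFinP; exact: measurable_stft_sup.
- by move=> xi; rewrite lee_fin stft_sup_ge0.
Qed.

Lemma integrable_stft_sup : (normMinf1 hbar g h < +oo)%E ->
  (leb R n).-integrable setT (EFin \o stft_sup g h).
Proof.
rewrite normMinf1E => foo; apply/integrableP; split.
  by apply/measurable_EFinP; exact: measurable_stft_sup.
by under eq_integral do rewrite /= ger0_norm ?stft_sup_ge0//.
Qed.

End fixed_pair.

Lemma stftB g h1 h2 x xi : bcont h1 -> bcont h2 -> nice_window g ->
  stft hbar g (fun y => h1 y - h2 y) x xi = stft hbar g h1 x xi - stft hbar g h2 x xi.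
Proof.
move=> b1 b2 ng; rewrite !stftE//; last exact: bcontB.
rewrite -mulrBr; congr (_ * _).
have i1 := cintegrable_cisM (measurable_dotc hbar xi) (cintegrable_window x b1 ng).
have i2 := cintegrable_cisM (measurable_dotc hbar xi) (cintegrable_window x b2 ng).
by rewrite /ft -cintB//; apply: eq_cint => y; rewrite mulrBl mulrBr.
Qed.

Lemma normMinf1B g h1 h2 : bcont h1 -> bcont h2 -> nice_window g ->
  (normMinf1 hbar g (fun y => h1 y - h2 y)%R <= normMinf1 hbar g h1 + normMinf1 hbar g h2)%E.
Proof.
move=> b1 b2 ng; have b12 := bcontB b1 b2; rewrite !normMinf1E//.
apply: ge0_integral_le_add.
- exact: measurable_stft_sup.
- exact: measurable_stft_sup.
- exact: measurable_stft_sup.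
- by move=> xi; exact: stft_sup_ge0.
- by move=> xi; exact: stft_sup_ge0.
- by move=> xi; exact: stft_sup_ge0.
- move=> xi; apply: stft_sup_le => // x.
  rewrite stftB//; apply: le_trans (le_normcD _ _) _; rewrite normcN.
  by apply: lerD; exact: stft_le_sup.
Qed.

End stft_theory.

(** * Change of window *)

Section convolution.
Context {R : realType} {n : nat}.

(** Integrating in xi first, translation invariance bounds the double integral by the product of the
    masses. The bound on [F] makes the inner integral finite for every xi and not just for almost
    every one. *)
Lemma integrable_convolution (k F : 'rV[R]_n -> R) (C : R) :
  measurable_fun setT k -> measurable_fun setT F ->
  (forall x, 0 <= k x) -> (forall x, 0 <= F x) -> (forall x, F x <= C) ->
  (leb R n).-integrable setT (EFin \o k) -> (leb R n).-integrable setT (EFin \o F) ->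
  (forall xi, (leb R n).-integrable setT (EFin \o (fun eta => k eta * F (xi - eta)))) /\
  (leb R n).-integrable setT (EFin \o (fun xi => \int[leb R n]_eta (k eta * F (xi - eta)))).
Proof.
move=> mk mF k0 F0 FC ik iF.
have msub xi : measurable_fun setT (fun eta : 'rV[R]_n => xi - eta).
  by apply: measurable_rowB; [exact: measurable_cst|exact: measurable_id].
have sec xi : (leb R n).-integrable setT (EFin \o (fun eta => k eta * F (xi - eta))).
  apply: le_integrable (integrableZl measurableT C ik) => //.
    apply/measurable_EFinP; apply: measurable_funM => //.
    exact: (measurableT_comp mF (msub xi)).
  move=> eta _; rewrite /= lee_fin !normrM mulrC (ger0_norm (F0 _)).
  by rewrite ler_wpM2r// (le_trans (FC _))// ler_norm.
split => //.
pose f (p : 'rV[R]_n * 'rV[R]_n) := (k p.2 * F (p.1 - p.2))%:E.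
have mf : measurable_fun setT f.
  apply/measurable_EFinP; apply: measurable_funM; first exact: (measurableT_comp mk measurable_snd).
  apply: (measurableT_comp mF).
  by apply: measurable_rowB; [exact: measurable_fst|exact: measurable_snd].
have fi : (leb R n \x leb R n)%E.-integrable setT f.
  apply/integrable21ltyP => //.
  have inner eta : (\int[leb R n]_xi `|f (xi, eta)| =
      (k eta * \int[leb R n]_xi F xi)%:E)%E.
    have [iFs EFs] := integrable_shift (- eta) iF.
    rewrite -EFs -RintegralZl// EFin_Rintegral; last exact: (integrableZl measurableT _ iFs).
    by apply: eq_integral => xi _; rewrite /f /= ger0_norm// mulr_ge0.
  under eq_integral do rewrite inner mulrC.
  have := integrableZl measurableT (\int[leb R n]_xi F xi) ik.
  by move/(integrable_lty measurableT).
have := integrable_fubini_F fi; apply: eq_integrable => // xi _.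
by rewrite /= EFin_Rintegral.
Qed.

End convolution.

Section window_change.
Context {R : realType} {n : nat}.
Variable hbar : R.
Hypothesis h0 : 0 < hbar.

(** Narrow Gaussians centred at [x0] form an approximate identity: if all these integrals vanished,
    their rescaled limit, a positive multiple of conj (g x0), would vanish too. *)
Lemma gauss_window_neq0 (g : 'rV[R]_n -> R[i]) (x0 : 'rV[R]_n) :
  nice_window g -> g x0 != 0 ->
  exists2 P : R, 0 < P &
    cint (leb R n) (fun s => conjc (g s) * (gauss (fun=> P) (s - x0))%:C) != 0.
Proof.
move=> [[cg [B gB]] ig] gx0.
have cg' : continuous (fun s => conjc (g s)).
  apply: continuous_ReIm.
    by under eq_fun do rewrite Re_conjc; exact: continuous_Re.
  under eq_fun do rewrite Im_conjc.
  by move=> x; exact: (cvgN (@continuous_Im R n g cg x)).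
pose s (k : nat) : R := k.+1%:R^-1.
have s0 k : 0 < s k by rewrite invr_gt0.
have scvg : s k @[k --> \oo] --> 0 by exact: cvg_harmonic.
have gB' x : normc (conjc (g x)) <= B by rewrite normc_conjc.
have lim := @approx_identity R n (fun=> 1) _ B s x0 (fun=> ltr01) cg' gB' scvg.
apply: contrapT => noP.
have z k : cint (leb R n) (fun u => (gauss (fun=> 1) u)%:C * conjc (g (s k *: u + x0))) = 0.
  pose P := (s k ^+ 2)^-1.
  have P0 : 0 < P by rewrite invr_gt0 exprn_gt0.
  have E : cint (leb R n) (fun s => conjc (g s) * (gauss (fun=> P) (s - x0))%:C) = 0.
    by apply/eqP; apply: contrapT => /negP H; apply: noP; exists P.
  have fi : cintegrable (leb R n) (fun s => conjc (g s) * (gauss (fun=> P) (s - x0))%:C).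
    apply: (cintegrable_le _ _ (cintegrable_norm ig)).
      apply: cmeasM; first exact: cmeas_continuous.
      by apply: cmeas_real; apply: (measurableT_comp (measurable_gauss _)); exact: measurable_subx.
    move=> y; rewrite normcM normc_conjc normc_R ger0_norm ?gauss_ge0//.
    by rewrite ler_piMr ?normc_ge0// gauss_le1// => _; exact: ltW.
  have [_] := cint_affine x0 (lt0r_neq0 (s0 k)) fi.
  rewrite E mulr0 => <-; apply: eq_cint => u; rewrite addrK mulrC.
  congr (_ * _%:C); rewrite /gauss; congr (expR (- _)); apply: eq_bigr => i _.
  by rewrite mxE exprMn [RHS]mulrA mulVf// expf_neq0// gt_eqF.
have Z := cvg_unique (@norm_hausdorff _ _) lim (_ : _ --> 0).
have /eqP : (\int[leb R n]_u gauss (fun=> 1 : R) u)%:C * conjc (g x0) = 0.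
  by apply: Z; under eq_fun do rewrite z; exact: cvg_cst.
rewrite mulf_eq0 conjc_eq0 (negbTE gx0) orbF Rintegral_gauss => [/eqP/(congr1 (@complex.Re R))/= E|i]; last exact: ltr01.
have : 0 < \prod_(i < n) Num.sqrt (pi / (fun=> 1 : R) i).
  by apply: prodr_gt0 => i _; rewrite sqrtr_gt0 divr1 pi_gt0.
by rewrite E ltxx.
Qed.

(** Writing a Gaussian as a superposition of characters converts multiplication by it into an
    average over frequency shifts. *)
Lemma gauss_fourier_inv (A : 'I_n -> R) : (forall i, 0 < A i) ->
  exists2 N : R, 0 < N & forall v : 'rV[R]_n, (gauss A v)%:C =
    (N^-1)%:C * cint (leb R n) (fun eta => (gauss (fun i => (4 * A i * hbar ^+ 2)^-1) eta)%:C *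
      cis (dot eta v / hbar)).
Proof.
move=> A0; pose a i := (4 * A i * hbar ^+ 2)^-1.
have a0 i : 0 < a i by rewrite invr_gt0 !mulr_gt0// exprn_gt0.
exists (\prod_i Num.sqrt (pi / a i)).
  by apply: prodr_gt0 => i _; rewrite sqrtr_gt0 divr_gt0 ?pi_gt0.
move=> v; have := cint_gauss_fourier (hbar^-1 *: v) a0.
rewrite -/a big_split /= => E.
under eq_cint => eta do rewrite mulrC -(mulrC hbar^-1) -dotZr dotC mulrC.
rewrite E -rmorphM /=; congr (_%:C); rewrite mulrA mulVf ?mul1r; last first.
  by rewrite gt_eqF// prodr_gt0 // => i _; rewrite sqrtr_gt0 divr_gt0 ?pi_gt0.
rewrite gauss_prod; apply: eq_bigr => i _; congr (expR (- _)).
rewrite mxE /a; have := A0 i; have := h0 => hh AA.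
by field; rewrite !gt_eqF.
Qed.

End window_change.

Lemma normcMR (R : realType) (r : R) (z : R[i]) : 0 <= r -> normc (r%:C * z) = r * normc z.
Proof. by move=> r0; rewrite (normcM r%:C z) normc_R ger0_norm. Qed.

Section window_change.
Context {R : realType} {n : nat}.
Variable hbar : R.
Hypothesis h0 : 0 < hbar.
Variables (g h : 'rV[R]_n -> R[i]).
Hypotheses (bh : bcont h) (ng : nice_window g).
Local Notation mu := (leb R n).

Let W xi z (y : 'rV[R]_n) := cis (- (dot xi y / hbar)) * (h y * conjc (g (y - z))).

Let iW xi z : cintegrable mu (W xi z).
Proof. exact: (cintegrable_cisM (measurable_dotc hbar xi) (cintegrable_window z bh ng)). Qed.

Let cmeas_Wgauss xi A (z m : 'rV[R]_n) :
  cmeas (fun y : 'rV[R]_n => (gauss A (y - m))%:C * W xi z y).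
Proof.
apply: cmeasM; last by case: (iW xi z).
by apply: cmeas_real; apply: (measurableT_comp (measurable_gauss _)); exact: measurable_subx.
Qed.

(** The Gaussian factor in [y] averages the transform over the frequencies xi - eta. Its centre [m]
    only contributes a phase, and the window centre [z] is absorbed by the supremum, so the bound is
    uniform in both. *)
Lemma stft_gauss_le (A : 'I_n -> R) : (forall i, 0 < A i) ->
  exists2 N : R, 0 < N & forall m z xi,
    @stft_cst R n hbar * normc (cint mu (fun y : 'rV[R]_n => (gauss A (y - m))%:C * W xi z y)) <=
    N * \int[mu]_eta (gauss (fun i => (4 * A i * hbar ^+ 2)^-1) eta *
      stft_sup hbar g h (xi - eta)).
Proof.
move=> A0; have [N N0 NE] := gauss_fourier_inv h0 A0.
set a := fun i => _ in NE *.
have a0 i : 0 < a i by rewrite /a invr_gt0 !mulr_gt0// exprn_gt0.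
have Ni0 : 0 < N^-1 by rewrite invr_gt0.
exists N^-1 => // m z xi.
have mg : cmeas (fun eta : 'rV[R]_n => (gauss a eta)%:C) by exact: cmeas_real (measurable_gauss a).
pose F (p : 'rV[R]_n * 'rV[R]_n) := W xi z p.1 * ((gauss a p.2)%:C * cis (dot p.2 (p.1 - m) / hbar)).
have mF : cmeas F.
  apply: cmeasM; first by apply: (cmeas_comp measurable_fst); case: (iW xi z).
  apply: cmeasM; first exact: (cmeas_comp measurable_snd mg).
  apply: cmeas_cis; apply: measurable_funM => //; apply: measurable_dot; first exact: measurable_snd.
  by apply: measurable_rowB; [exact: measurable_fst|exact: measurable_cst].
have Fb y eta : normc (F (y, eta)) <= normc (W xi z y) * gauss a eta.
  by rewrite /F !(normcM (W _ _ _)) normcM normc_cis mulr1 normc_R ger0_norm ?gauss_ge0.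
have iga := integrable_gauss a0.
have := cfubini mF Fb (fun=> normc_ge0 _) (cintegrable_norm (iW xi z)) (fun=> iga)
    (fun=> lexx _) (fun _ eta => gauss_le1 _ (fun i => ltW (a0 i))).
have igc v : cintegrable mu (fun eta : 'rV[R]_n => (gauss a eta)%:C * cis (dot eta v / hbar)).
  apply: (cintegrable_le _ _ iga).
    apply: cmeasM => //; apply: cmeas_cis; apply: measurable_funM => //.
    by apply: measurable_dot; [exact: measurable_id|exact: measurable_cst].
  by move=> eta; rewrite normcM normc_cis mulr1 normc_R ger0_norm ?gauss_ge0.
have iWG : cintegrable mu (fun y : 'rV[R]_n => (gauss A (y - m))%:C * W xi z y).
  apply: (cintegrable_le (cmeas_Wgauss xi A z m) _ (cintegrable_norm (iW xi z))) => y.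
  rewrite normcM normc_R ger0_norm ?gauss_ge0// ler_piMl ?normc_ge0// gauss_le1// => i.
  exact: ltW.
have inner y : cint mu (fun eta => F (y, eta)) = N%:C * ((gauss A (y - m))%:C * W xi z y).
  transitivity (W xi z y * cint mu (fun eta : 'rV[R]_n => (gauss a eta)%:C * cis (dot eta (y - m) / hbar))).
    by rewrite -(cintZ _ (igc (y - m))).
  rewrite NE; set I := cint mu _.
  by rewrite [RHS]mulrA (mulrA N%:C) -rmorphM /= divff ?gt_eqF// mul1r mulrC.
under eq_cint do rewrite inner.
rewrite (cintZ _ iWG).
have c0 : 0 < @stft_cst R n hbar by rewrite powR_gt0// !mulr_gt0 ?pi_gt0.
pose K (eta : 'rV[R]_n) := (gauss a eta)%:C * (cis (- (dot eta m / hbar)) * stft hbar g h z (xi - eta)).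
have outer eta : cint mu (fun y => F (y, eta)) = ((@stft_cst R n hbar)^-1)%:C * K eta.
  rewrite /K stftE// [X in _ = X](_ : _ = (gauss a eta)%:C * (cis (- (dot eta m / hbar)) *
      ft hbar (fun y => h y * conjc (g (y - z))) (xi - eta))); last first.
    have -> : ((@stft_cst R n hbar)^-1)%:C = (@stft_cst R n hbar)%:C^-1 by rewrite fmorphV.
    by field; rewrite -(rmorph0 (real_complex R)) (inj_eq (@complexI R)) gt_eqF.
  have ifw := cintegrable_cisM (measurable_dotc hbar (xi - eta)) (cintegrable_window z bh ng).
  rewrite /ft -(cintZ _ ifw) -cintZ; last exact: cintegrableZ.
  apply: eq_cint => y; rewrite /F /W /=.
  have -> : - (dot xi y / hbar) = - (dot (xi - eta) y / hbar) - (dot eta y / hbar).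
    by rewrite dotDl dotNl; ring.
  have -> : dot eta (y - m) / hbar = dot eta y / hbar - (dot eta m / hbar).
    by rewrite dotDr dotNr mulrBl.
  rewrite !cisD; set c1 := cis (- (dot eta y / hbar)); set c2 := cis (dot eta y / hbar).
  have c12 : c1 * c2 = 1 by rewrite /c1 /c2 -cisD addNr cis0.
  by rewrite -[RHS]mul1r -c12 /=; ring.
have msub : measurable_fun setT (fun eta : 'rV[R]_n => xi - eta).
  by apply: measurable_rowB; [exact: measurable_cst|exact: measurable_id].
have mK : cmeas K.
  apply: cmeasM => //; apply: cmeasM.
    by apply: cmeas_cis_dotN; [exact: measurable_id|exact: measurable_cst].
  by apply: cmeas_stft => //; exact: measurable_cst.
have Kb eta : normc (K eta) <= gauss a eta * stft_sup hbar g h (xi - eta).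
  rewrite /K (normcM (gauss a eta)%:C) (normcM (cis _)) normc_cis mul1r normc_R ger0_norm ?gauss_ge0//.
  rewrite ler_wpM2l ?gauss_ge0//.
  exact: (stft_le_sup hbar bh ng).
have iKs : mu.-integrable setT (EFin \o (fun eta => gauss a eta * stft_sup hbar g h (xi - eta))).
  have [C HC] := stft_sup_bounded hbar bh ng.
  apply: le_integrable (integrableZl measurableT C iga) => //.
    apply/measurable_EFinP; apply: measurable_funM; first exact: measurable_gauss.
    exact: (measurableT_comp (measurable_stft_sup hbar bh ng) msub).
  move=> eta _; rewrite /= lee_fin !normrM mulrC; apply: ler_wpM2r => //.
  by rewrite ger0_norm ?stft_sup_ge0// (le_trans (HC _))// ler_norm.
rewrite [X in _ = X -> _](eq_cint _ outer).
rewrite cintZ; last exact: (cintegrable_le mK Kb iKs).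
move=> /(congr1 (fun w => ((@stft_cst R n hbar)%:C * (N^-1)%:C) * w)).
set X := cint mu (fun y => _ * W xi z y).
rewrite [LHS]mulrA -(mulrA _ (N^-1)%:C) -rmorphM /= mulVf ?gt_eqF// mulr1.
rewrite [RHS]mulrA -(mulrA _ (N^-1)%:C) -!rmorphM /= mulrCA divff ?gt_eqF// mulr1.
move=> /(congr1 (fun w => normc w)); rewrite !normcM !normc_R !gtr0_norm// => ->.
by rewrite ler_wpM2l ?(ltW Ni0)//; exact: normc_cint_le.
Qed.

(** Weighted mean of [w] and [x], the centre of the product of the Gaussians of exponents [P] around
    [w] and [b] around [x]. *)
Let m (P : R) (b : 'I_n -> R) (w x : 'rV[R]_n) : 'rV[R]_n :=
  \row_i ((P * w 0 i + b i * x 0 i) / (P + b i)).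

Let gaussMgauss P b w x y : 0 < P -> (forall i, 0 < b i) ->
  gauss (fun=> P) (y - w) * gauss b (y - x) =
  gauss (fun i => P * b i / (P + b i)) (w - x) * gauss (fun i => P + b i) (y - m P b w x).
Proof.
move=> P0 b0; rewrite !gauss_prod -!big_split; apply: eq_bigr => i _ /=.
rewrite -!expRD !mxE; congr expR; field.
by rewrite gt_eqF// addr_gt0.
Qed.

(* [int conj (g (y - z)) gauss P (y - z - x0) dz] is a nonzero constant, so it can
   be inserted into the new transform; completing the square turns the product
   of the two Gaussians in [y] into a single one, which [stft_gauss_le] bounds by
   an average of shifts of [stft_sup]. *)
Lemma window_change (x0 : 'rV[R]_n) (kappa : R) (b : 'I_n -> R) : 0 <= kappa ->
  (forall i, 0 < b i) -> g x0 != 0 -> nice_window (fun y => (kappa * gauss b y)%:C) ->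
  (normMinf1 hbar g h < +oo)%E ->
  (normMinf1 hbar (fun y => (kappa * gauss b y)%:C) h < +oo)%E.
Proof.
move=> k0 b0 gx0; set G := fun y : 'rV[R]_n => _%:C => nG foo.
have [P P0 c_neq0] := gauss_window_neq0 ng gx0.
set c := cint _ _ in c_neq0.
have A0 i : 0 < P + b i by rewrite addr_gt0.
pose B i := P * b i / (P + b i).
have B0 i : 0 < B i by rewrite divr_gt0// mulr_gt0.
have [N N0 NE] := stft_gauss_le A0.
pose a i := (4 * (P + b i) * hbar ^+ 2)^-1.
have a0 i : 0 < a i by rewrite /a invr_gt0 !mulr_gt0// exprn_gt0.
have cst0 : 0 < @stft_cst R n hbar by rewrite powR_gt0// !mulr_gt0 ?pi_gt0.
pose K xi := \int[mu]_eta (gauss a eta * stft_sup hbar g h (xi - eta)).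
have iG := integrable_gauss B0.
(* The constant of [stft_gauss_le], times the mass in [z] of the Gaussian left over by completing
   the square, divided by the modulus of the inserted constant [c]. *)
pose Q := kappa * (\int[mu]_z gauss B z) * N / normc c.
have nc0 : 0 < normc c.
  by rewrite lt_neqAle normc_ge0 andbT eq_sym; apply: contra c_neq0 => /eqP/normc_eq0P ->.
have [_ [C hC]] := bh; have [bg ig] := ng; have [cg [Bg gB]] := bg.
have bound x xi : normc (stft hbar G h x xi) <= Q * K xi.
  pose U y := cis (- (dot xi y / hbar)) * (h y * conjc (G (y - x))).
  have iU : cintegrable mu U.
    exact: (cintegrable_cisM (measurable_dotc hbar xi) (cintegrable_window x bh nG)).
  pose F (p : 'rV[R]_n * 'rV[R]_n) := U p.1 *
    (conjc (g (p.1 - p.2)) * (gauss (fun=> P) (p.1 - p.2 - x0))%:C).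
  have msub : measurable_fun setT (fun p : 'rV[R]_n * 'rV[R]_n => p.1 - p.2).
    by apply: measurable_rowB; [exact: measurable_fst|exact: measurable_snd].
  have mF : cmeas F.
    apply: cmeasM; first by apply: (cmeas_comp measurable_fst); case: iU.
    apply: cmeasM; first by apply: cmeas_conj; exact: (cmeas_comp msub (bcont_cmeas bg)).
    apply: cmeas_real; apply: (measurableT_comp (measurable_gauss _)).
    by apply: measurable_rowB => //; exact: measurable_cst.
  have gP1 (v : 'rV[R]_n) : gauss (fun=> P) v <= 1 by apply: gauss_le1 => _; exact: ltW.
  have Fb y z : normc (F (y, z)) <= normc (U y) * normc (g (y - z)).
    rewrite /F (normcM (U y)) ler_wpM2l ?normc_ge0// normcM normc_conjc normc_R.
    by rewrite ger0_norm ?gauss_ge0// ler_piMr ?normc_ge0.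
  have refl (f : 'rV[R]_n -> R[i]) y : cintegrable mu f ->
      cintegrable mu (fun z => f (y - z)) /\ cint mu (fun z => f (y - z)) = cint mu f.
    move=> fi; have N1 : (-1 : R) != 0 by rewrite oppr_eq0 oner_neq0.
    have [] := cint_affine y N1 fi.
    rewrite normrN normr1 expr1n invr1 mul1r => If <-.
    have E z : -1 *: z + y = y - z by rewrite scaleN1r addrC.
    split; first by move: If; under eq_fun do rewrite E.
    by apply: eq_cint => z; rewrite E.
  have igy y : mu.-integrable setT (EFin \o (fun z => normc (g (y - z)))).
    by have [] := refl g y ig => /cintegrable_norm.
  have igM y : \int[mu]_z normc (g (y - z)) <= \int[mu]_z normc (g z).
    have ng' : cintegrable mu (fun z => (normc (g z))%:C).
      apply: (cintegrable_le _ _ (cintegrable_norm ig)).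
        by apply: cmeas_real; apply: measurable_normc; exact: bcont_cmeas.
      by move=> z; rewrite normc_R ger0_norm ?normc_ge0.
    have [_] := refl _ y ng'; rewrite !cint_real => /(congr1 (@complex.Re R)) /= ->.
    exact: lexx.
  have FU := cfubini mF Fb (fun=> normc_ge0 _) (cintegrable_norm iU) igy igM (fun y z => gB (y - z)).
  have icc : cintegrable mu (fun s => conjc (g s) * (gauss (fun=> P) (s - x0))%:C).
    apply: (cintegrable_le _ _ (cintegrable_norm ig)).
      apply: cmeasM; first by apply: cmeas_conj; exact: bcont_cmeas.
      by apply: cmeas_real; apply: (measurableT_comp (measurable_gauss _)); exact: measurable_subx.
    move=> y; rewrite (normcM (conjc (g y))) normc_conjc normc_R (ger0_norm (gauss_ge0 _ _)).
    by apply: ler_piMr; [exact: normc_ge0|exact: gP1].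
  have inner y : cint mu (fun z => F (y, z)) = c * U y.
    have [icy Ey] := refl _ y icc.
    by rewrite /F /= (cintZ _ icy) Ey mulrC.
  have outer z : cint mu (fun y => F (y, z)) = (kappa * gauss B (z + x0 - x))%:C *
      cint mu (fun y : 'rV[R]_n => (gauss (fun i => P + b i) (y - m P b (z + x0) x))%:C * W xi z y).
    rewrite -cintZ; last first.
      apply: (cintegrable_le (cmeas_Wgauss xi _ z _) _ (cintegrable_norm (iW xi z))) => y.
      rewrite (normcM (gauss _ _)%:C) normc_R (ger0_norm (gauss_ge0 _ _)).
      apply: ler_piMl; first exact: normc_ge0.
      by apply: gauss_le1 => i; exact: ltW.
    apply: eq_cint => y; rewrite /F /U /W /G; cbn [fst snd]; rewrite -addrA -opprD.
    rewrite conjc_real.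
    have := gaussMgauss (z + x0) x y P0 b0; rewrite -/B => E.
    transitivity (W xi z y * (kappa * (gauss (fun=> P) (y - (z + x0)) * gauss b (y - x)))%:C).
      by rewrite /W !rmorphM /=; ring.
    by rewrite E /W !rmorphM /=; ring.
  have := etrans (esym (eq_cint _ inner)) (etrans FU (eq_cint _ outer)).
  rewrite (cintZ _ iU); set S := (X in _ = X -> _) => ES.
  have NE' z : normc (cint mu (fun y : 'rV[R]_n => (gauss (fun i => P + b i) (y - m P b (z + x0) x))%:C * W xi z y))
      <= (@stft_cst R n hbar)^-1 * (N * K xi).
    by rewrite (ler_pdivlMl _ _ cst0); exact: (NE (m P b (z + x0) x) z xi).
  have SB : @stft_cst R n hbar * normc S <= kappa * (\int[mu]_z gauss B z) * (N * K xi).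
    have [iGs EGs] := integrable_shift (x0 - x) iG.
    have KS : normc S <= \int[mu]_z ((kappa * ((@stft_cst R n hbar)^-1 * (N * K xi))) * gauss B (z + (x0 - x))).
      apply: normc_cint_le.
      - under eq_fun do rewrite -outer.
        have mF' : cmeas (fun p : 'rV[R]_n * 'rV[R]_n => F (p.2, p.1)).
          exact: (cmeas_comp (@measurable_swap _ _ 'rV[R]_n 'rV[R]_n) mF).
        exact: (cmeas_cint_param (leb R n) mF').
      - move=> z; rewrite (normcMR _ (mulr_ge0 k0 (gauss_ge0 B (z + x0 - x)))) -addrA mulrAC.
        apply: ler_wpM2r; first exact: gauss_ge0.
        apply: ler_wpM2l; first exact: k0.
        exact: NE'.
      - exact: (integrableZl measurableT _ iGs).
    have IK k : \int[mu]_z (k * gauss B (z + (x0 - x))) = k * \int[mu]_z gauss B z.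
      by rewrite (RintegralZl _ measurableT iGs) EGs.
    rewrite IK in KS; clearbody S.
    rewrite -(ler_pdivlMl _ _ cst0); apply: le_trans KS _.
    by move: (K xi) (Rintegral _ _ _) => k ig1; rewrite le_eqVlt; apply/orP; left; apply/eqP; ring.
  rewrite (stftE _ _ _ bh nG) (normcMR _ (ltW cst0)) -[ft _ _ _]/(cint mu U).
  have QK : Q * K xi = kappa * (\int[mu]_z gauss B z) * (N * K xi) / normc c.
    by rewrite /Q (mulrAC _ _ (K xi)) -(mulrA _ N).
  rewrite QK (ler_pdivlMr _ _ nc0) -(mulrA (@stft_cst R n hbar)) (mulrC _ (normc c)) -(normcM c (cint mu U)) ES.
  exact: SB.
rewrite normMinf1E//.
have [C1 HC1] := stft_sup_bounded hbar bh ng.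
have ms := measurable_stft_sup hbar bh ng.
have [_ iK] := integrable_convolution (measurable_gauss a) ms
  (fun x => gauss_ge0 a x) (fun xi => stft_sup_ge0 hbar bh ng xi) HC1 (integrable_gauss a0)
  (integrable_stft_sup bh ng foo).
have iGs : mu.-integrable setT (EFin \o stft_sup hbar G h).
  apply: le_integrable (integrableZl measurableT Q iK) => //.
    by apply/measurable_EFinP; exact: measurable_stft_sup.
  move=> xi _; rewrite /= lee_fin ger0_norm ?stft_sup_ge0//.
  by apply: le_trans (ler_norm _); apply: stft_sup_le => // x; exact: bound.
have := integrable_lty measurableT iGs; apply: le_lt_trans.
by apply: ge0_le_integral => //; do ?[by move=> ? _; rewrite lee_fin ?stft_sup_ge0]; apply/measurable_EFinP; exact: measurable_stft_sup.
Qed.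

End window_change.

(** * Restriction and extension of the variables *)

(** Continuity established by dominated convergence or by uniform limits comes along sequences, and
    this turns it into topological continuity. *)
Lemma continuous_seq (R : realType) n (f : 'rV[R]_n -> R[i]) :
  (forall (u : nat -> 'rV[R]_n) x, u k @[k --> \oo] --> x -> f (u k) @[k --> \oo] --> f x) ->
  continuous f.
Proof.
move=> H x; apply: contrapT => nc.
have [A [nA nfA]] : exists A, nbhs (f x) A /\ ~ nbhs x (f @^-1` A).
  by apply: contrapT => /forallNP nE; apply: nc => A nA; apply: contrapT => nfA; exact: (nE A).
have /choice[u Hu] (k : nat) : exists y, ball x (k.+1%:R^-1 : R) y /\ ~ A (f y).
  apply: contrapT => /forallNP nE; apply: nfA.
  apply: (filterS _ (nbhsx_ballx x (k.+1%:R^-1 : R) _)); last by rewrite invr_gt0.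
  by move=> y By; apply: contrapT => nAy; exact: (nE y).
have ux : u k @[k --> \oo] --> x.
  apply/cvgrPdist_lt => e e0; near=> k; have [+ _] := Hu k.
  rewrite -ball_normE /= => /lt_trans; apply.
  by near: k; exact: near_infty_natSinv_lt (PosNum e0).
have [k _ /(_ k (leqnn k))] := H u x ux A nA.
by have [_] := Hu k.
Unshelve. all: by end_near. Qed.

Section inversion.
Context {R : realType} {n : nat}.
Variable hbar : R.
Hypothesis h0 : 0 < hbar.
Variables (g h : 'rV[R]_n -> R[i]).
Hypotheses (bh : bcont h) (ng : nice_window g).
Local Notation mu := (leb R n).

Lemma stft_cst_gt0 k : 0 < @stft_cst R k hbar.
Proof. by rewrite powR_gt0// !mulr_gt0 ?pi_gt0. Qed.

Lemma stft_cst_sqr k : @stft_cst R k hbar * @stft_cst R k hbar = ((2 * pi * hbar) ^+ k)^-1.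
Proof.
have p0 : 0 < 2 * pi * hbar by rewrite !mulr_gt0 ?pi_gt0.
rewrite /stft_cst -powRD; last by apply/implyP => _; rewrite gt_eqF.
by rewrite -opprD -splitr powRN powR_mulrn// ltW.
Qed.

Lemma stft_cstS k : @stft_cst R k.+1 hbar = @stft_cst R k hbar * @stft_cst R 1 hbar.
Proof.
have p0 : 0 < 2 * pi * hbar by rewrite !mulr_gt0 ?pi_gt0.
rewrite /stft_cst -powRD; last by apply/implyP => _; rewrite gt_eqF.
by rewrite -opprD -mulrDl -natrD addn1.
Qed.

Lemma stft_inversion x y : cintegrable mu (stft hbar g h x) ->
  h y * conjc (g (y - x)) =
  (@stft_cst R n hbar)%:C * cint mu (fun xi => cis (dot xi y / hbar) * stft hbar g h x xi).
Proof.
move=> iV; have [bg _] := ng.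
pose f y := h y * conjc (g (y - x)).
have [ch [C hC]] := bh; have [cg [B gB]] := bg.
have C0 : 0 <= C by exact: le_trans (normc_ge0 _) (hC 0).
have fb z : normc (f z) <= C * B.
  by rewrite /f (normcM (h z)) normc_conjc ler_pM ?normc_ge0.
have cf : continuous f.
  apply: continuous_seq => u l ul; apply: cvg_complexM.
    exact: (cvg_continuous_complex ch ul).
  have E : u k - x @[k --> \oo] --> l - x by apply: cvgB => //; exact: cvg_cst.
  have /cvg_complexP[gr gi] := cvg_continuous_complex cg E.
  apply/cvg_complexP; split.
    by under eq_fun do rewrite Re_conjc; rewrite Re_conjc.
  by under eq_fun do rewrite Im_conjc; rewrite Im_conjc; exact: cvgN.
have cst0 := stft_cst_gt0 n.
have Vft xi : ft hbar f xi = ((@stft_cst R n hbar)^-1)%:C * stft hbar g h x xi.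
  rewrite (stftE _ _ _ bh ng) (mulrA (_^-1)%:C) -rmorphM /= mulVf ?gt_eqF//.
  by rewrite (mul1r (ft _ _ _)).
have ift : cintegrable mu (ft hbar f).
  by rewrite (funext Vft); exact: cintegrableZ.
rewrite -/(f y) (fourier_inversion y h0 cf fb (cintegrable_window x bh ng) ift).
rewrite -stft_cst_sqr.
have mdot : measurable_fun setT (fun xi : 'rV[R]_n => dot xi y / hbar).
  apply: measurable_funM => //; apply: measurable_dot; first exact: measurable_id.
  exact: measurable_cst.
have E xi : cis (dot xi y / hbar) * ft hbar f xi =
    ((@stft_cst R n hbar)^-1)%:C * (cis (dot xi y / hbar) * stft hbar g h x xi).
  by rewrite Vft (mulrCA (cis _)).
rewrite (eq_cint _ E) (cintZ _ (cintegrable_cisM mdot iV)) (mulrA _ (_^-1)%:C) -rmorphM /=.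
by rewrite -(mulrA _ (@stft_cst R n hbar)) divff ?gt_eqF// mulr1.
Qed.

Lemma cintegrable_stft x : (normMinf1 hbar g h < +oo)%E -> cintegrable mu (stft hbar g h x).
Proof.
move=> foo; apply: (cintegrable_le _ _ (integrable_stft_sup bh ng foo)).
  exact: (cmeas_stft hbar bh ng (@measurable_cst _ _ _ 'rV[R]_n setT x) (@measurable_id _ 'rV[R]_n setT)).
by move=> xi; exact: (stft_le_sup hbar bh ng).
Qed.

(** By inversion, [h] times the translated window is an integral of the transform. At y = x this
    makes the norm control the uniform norm, so Cauchy sequences in [C0] converge uniformly as
    functions. *)
Lemma normc_mul_window_le x y :
  ((normc (h y) * normc (g (y - x)))%:E <=
   (@stft_cst R n hbar)%:E * normMinf1 hbar g h)%E.
Proof.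
have [foo|] := boolP (normMinf1 hbar g h < +oo)%E; last first.
  rewrite -leNgt leye_eq => /eqP ->.
  by rewrite gt0_muley ?leey// lte_fin stft_cst_gt0.
have iV := cintegrable_stft x foo.
rewrite normMinf1E// -EFin_Rintegral; last exact: integrable_stft_sup.
rewrite -EFinM lee_fin -(normc_conjc (g (y - x))) -(normcM (h y)) (stft_inversion y iV).
rewrite (normcMR _ (ltW (stft_cst_gt0 n))); apply: ler_wpM2l; first exact: ltW (stft_cst_gt0 n).
apply: normc_cint_le; last exact: integrable_stft_sup.
  apply: cmeasM; last by case: iV.
  apply: cmeas_cis; apply: measurable_funM => //; apply: measurable_dot; first exact: measurable_id.
  exact: measurable_cst.
by move=> xi; rewrite (normcM (cis _)) normc_cis mul1r; exact: (stft_le_sup hbar bh ng).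
Qed.

End inversion.

Lemma cvg_row (R : realType) n (u : nat -> 'rV[R]_n) (l : 'rV[R]_n) :
  (forall i, u k 0 i @[k --> \oo] --> l 0 i) -> u k @[k --> \oo] --> l.
Proof.
move=> ul; apply/cvgrPdist_lt => e e0.
have : \forall k \near \oo, forall i, `|l 0 i - u k 0 i| < e.
  by apply: filter_forall => i; have /cvgrPdist_lt := ul i; exact.
apply: filterS => k uk.
rewrite /Num.norm /= mx_normrE; apply/bigmax_ltP; split=> // -[i j] _ /=.
by rewrite ord1 !mxE.
Qed.

Lemma cvg_coord_row (R : realType) n (u : nat -> 'rV[R]_n) (l : 'rV[R]_n) i :
  u k @[k --> \oo] --> l -> u k 0 i @[k --> \oo] --> l 0 i.
Proof.
move=> ul; apply: (cvg_continuous_row (f := fun y : 'rV[R]_n => y 0 i)) => //.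
exact: coord_continuous.
Qed.

Lemma cvg_row_rcons (R : realType) n (u : nat -> 'rV[R]_n) (l : 'rV[R]_n) (v : nat -> R) (s : R) :
  u k @[k --> \oo] --> l -> v k @[k --> \oo] --> s ->
  row_rcons (u k) (v k) @[k --> \oo] --> row_rcons l s.
Proof.
move=> ul vs; apply: cvg_row => i; have [j ->|->] := unliftP ord_max i.
  by under eq_fun do rewrite row_rcons_widen; rewrite row_rcons_widen; exact: cvg_coord_row.
by under eq_fun do rewrite row_rcons_max; rewrite row_rcons_max.
Qed.

Section shift1.
Context {R : realType}.
Local Notation RR := (measurableTypeR R).
Local Notation mu := (@lebesgue_measure R).

Lemma shift_transfer (v : R) (f : RR -> \bar R) :
  measurable_fun setT f -> (forall y, 0 <= f y)%E ->
  (\int[mu]_x f (x - v)%R = 1%:E * \int[mu]_y f y)%E.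
Proof.
move=> mf f0; rewrite mul1e (ge0_integral_affine (- v) (oner_neq0 R) mf f0) normr1 mul1e.
by apply: eq_integral => x _; rewrite mul1r.
Qed.

Let mshift (v : R) : measurable_fun setT (fun s : RR => s - v : RR).
Proof. by apply: measurable_funB => //; exact: measurable_cst. Qed.

Lemma integrable_shift1 (f : RR -> R) (v : R) : mu.-integrable setT (EFin \o f) ->
  mu.-integrable setT (EFin \o (fun s : RR => f (s - v))).
Proof.
exact: (@integrable_transfer _ _ RR RR R mu mu (fun s => s - v) 1 ltr01 (mshift v) (shift_transfer v) f).
Qed.

Lemma cint_shift1 (f : RR -> R[i]) (v : R) : cintegrable mu f ->
  cint mu (fun s : RR => f (s - v)) = cint mu f.
Proof.
rewrite -[RHS]mul1r.
exact: (@cint_transfer _ _ RR RR R mu mu (fun s => s - v) 1 (shift_transfer v) f).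
Qed.

End shift1.

Section windows.
Context {R : realType}.
Variables (hbar : R) (q : nat -> R).
Hypotheses (h0 : 0 < hbar) (q0 : forall j, 0 < q j).
Local Notation RR := (measurableTypeR R).
Local Notation mu1 := (@lebesgue_measure R).
Local Notation kap n := (@stft_cst R n hbar).
Local Notation win := (window hbar q).

Definition wcoef (j : nat) : R := q j / (2 * hbar).

Lemma wcoef_gt0 j : 0 < wcoef j.
Proof. by rewrite divr_gt0// mulr_gt0. Qed.

Lemma windowE n : @window R hbar q n = fun x => (kap n * gauss (fun i : 'I_n => wcoef i) x)%:C.
Proof.
apply/funext => x; rewrite /window /gauss /wcoef; congr (_ * expR (- _))%:C.
by rewrite mulr_suml; apply: eq_bigr => i _; rewrite mulrAC.
Qed.

Lemma schwartz_window n : schwartz (@window R hbar q n).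
Proof. by rewrite windowE; apply: schwartz_gauss => i; exact: wcoef_gt0. Qed.

Lemma nice_window_window n : nice_window (@window R hbar q n).
Proof. exact: schwartz_nice_window (schwartz_window n). Qed.

Lemma window0 n : @window R hbar q n 0 = (kap n)%:C.
Proof. by rewrite windowE gauss0 mulr1. Qed.

Lemma conjc_window n x : conjc (@window R hbar q n x) = @window R hbar q n x.
Proof. by rewrite windowE conjc_real. Qed.

Definition win1 (j : nat) (s : R) : R := kap 1 * expR (- (wcoef j * s ^+ 2)).

Lemma win1_ge0 j s : 0 <= win1 j s.
Proof. by rewrite mulr_ge0 ?stft_cst_ge0 ?expR_ge0. Qed.

Lemma win1_le j s : win1 j s <= kap 1.
Proof.
by rewrite ler_piMr ?stft_cst_ge0// expR_le1 oppr_le0 mulr_ge0 ?sqr_ge0// ltW// wcoef_gt0.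
Qed.

Lemma measurable_win1 j s0 : measurable_fun setT (fun s : R => win1 j (s - s0)).
Proof.
apply: measurable_funM => //; apply: (measurableT_comp (@measurable_gauss1 R (wcoef j))).
by apply: measurable_funB => //; exact: measurable_cst.
Qed.

Lemma widen_ord_max n (j : 'I_n) : widen_ord (leqnSn n) j = lift ord_max j.
Proof. by apply: val_inj; rewrite /= /bump leqNgt ltn_ord. Qed.

Lemma sum_rcons n (F : nat -> R -> R) (t : 'rV[R]_n) (s : R) :
  \sum_(i < n.+1) F i (row_rcons t s 0 i) = \sum_(i < n) F i (t 0 i) + F n s.
Proof.
rewrite big_ord_recr /=; congr (_ + F n _); last exact: row_rcons_max.
by apply: eq_bigr => i _; rewrite widen_ord_max row_rcons_widen.
Qed.

Lemma gauss_rcons n (t : 'rV[R]_n) s : gauss (fun i : 'I_n.+1 => wcoef i) (row_rcons t s) =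
  gauss (fun i : 'I_n => wcoef i) t * expR (- (wcoef n * s ^+ 2)).
Proof.
by rewrite /gauss (sum_rcons (fun i y => wcoef i * y ^+ 2)) opprD expRD.
Qed.

Lemma dot_rcons n (t t' : 'rV[R]_n) s s' :
  dot (row_rcons t s) (row_rcons t' s') = dot t t' + s * s'.
Proof.
rewrite /dot big_ord_recr /= !row_rcons_max; congr (_ + _).
by apply: eq_bigr => i _; rewrite widen_ord_max !row_rcons_widen.
Qed.

Lemma row_rconsB n (t t' : 'rV[R]_n) s s' :
  row_rcons t s - row_rcons t' s' = row_rcons (t - t') (s - s').
Proof.
have E (y y' : 'rV[R]_n.+1) i : (y - y') 0 i = y 0 i - y' 0 i by rewrite !mxE.
apply: esym; apply: row_rconsP => [|j]; first by rewrite E !row_rcons_max.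
by rewrite E !row_rcons_widen !mxE.
Qed.

Lemma window_rcons n (t : 'rV[R]_n) s :
  window hbar q (row_rcons t s) = window hbar q t * (win1 n s)%:C.
Proof. by rewrite !windowE gauss_rcons stft_cstS// -rmorphM /= /win1 mulrACA. Qed.

Lemma bcont_section n (h : 'rV[R]_n.+1 -> R[i]) (s : R) : bcont h ->
  bcont (fun t : 'rV[R]_n => h (row_rcons t s)).
Proof.
move=> [ch [C hC]]; split; last by exists C => t; exact: hC.
apply: continuous_seq => u l ul; apply: (cvg_continuous_complex ch).
by apply: cvg_row_rcons => //; exact: cvg_cst.
Qed.

Lemma integrable_win1 j s0 : mu1.-integrable setT (EFin \o (fun s : RR => win1 j (s - s0))).
Proof.
have [ig _] := integral_gauss (wcoef_gt0 j).
exact: (integrable_shift1 s0 (integrableZl measurableT _ ig)).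
Qed.

(** Both the window and the character split, and Fubini puts the last variable outermost. Thus the
    transform of [h] is the one-variable transform, with window [win1 n], of the function that takes
    s to the n-variable transform of the section of [h] at s. *)
Lemma stft_rcons n (h : 'rV[R]_n.+1 -> R[i]) (x xi : 'rV[R]_n) (s0 eta : R) : bcont h ->
  stft hbar (@window R hbar q n.+1) h (row_rcons x s0) (row_rcons xi eta) =
  (kap 1)%:C * cint mu1 (fun s : RR => cis (- (eta * s / hbar)) *
    (stft hbar (@window R hbar q n) (fun t => h (row_rcons t s)) x xi * (win1 n (s - s0))%:C)).
Proof.
move=> bh; have nw := nice_window_window n; have nwS := nice_window_window n.+1.
have [_ [C hC]] := bh.
rewrite (stftE _ _ _ bh nwS) /ft.
set f := fun y : 'rV[R]_n.+1 => _.
have fi : cintegrable (leb R n.+1) f.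
  exact: (cintegrable_cisM (measurable_dotc hbar _) (cintegrable_window _ bh nwS)).
pose v s t := cis (- (dot xi t / hbar)) * (h (row_rcons t s) * conjc (window hbar q (t - x))).
pose u s := cis (- (eta * s / hbar)) * (win1 n (s - s0))%:C.
have fE t s : f (row_rcons t s) = u s * v s t.
  rewrite /f dot_rcons row_rconsB !conjc_window window_rcons /u /v conjc_window.
  by rewrite mulrDl opprD cisD; ring.
have fN t s : normc (f (row_rcons t s)) <= (C * normc (window hbar q (t - x))) * win1 n (s - s0).
  rewrite fE /u /v !normcM !normc_cis !mul1r normc_conjc normc_R (ger0_norm (win1_ge0 _ _)) mulrC.
  by apply: ler_wpM2r; [exact: win1_ge0|apply: ler_wpM2r; [exact: normc_ge0|exact: hC]].
have [-> ifp] := cint_row_rcons fi.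
have C0 : 0 <= C by exact: le_trans (normc_ge0 _) (hC 0).
have mfp : cmeas (fun p : 'rV[R]_n * RR => f (row_rcons p.1 p.2)) by case: ifp.
have iw1 := integrable_win1 n s0.
have [_ igw] := nw; have [igs _] := cint_shift (- x) igw.
have ia := integrableZl measurableT C (cintegrable_norm igs).
have sec t : cintegrable mu1 (fun s : RR => f (row_rcons t s)).
  apply: (cintegrable_le (g := fun s : RR => (C * normc (window hbar q (t - x))) * win1 n (s - s0))).
  - exact: (cmeas_comp (pair1_measurable t) mfp).
  - exact: fN.
  - exact: (integrableZl measurableT _ iw1).
rewrite (cint_prod12 ifp sec).
have Cw0 t : 0 <= C * normc (window hbar q (t - x)) by rewrite mulr_ge0 ?normc_ge0.
rewrite (cfubini mfp fN Cw0 ia (fun=> iw1) (fun=> lexx _) (fun _ s => win1_le n _)).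
have mfp' : cmeas (fun p : RR * 'rV[R]_n => f (row_rcons p.2 p.1)).
  exact: (cmeas_comp (@measurable_swap _ _ RR 'rV[R]_n) mfp).
have iI : cintegrable mu1 (fun s : RR => cint (leb R n) (fun t => f (row_rcons t s))).
  apply: (cintegrable_le (g := fun s : RR =>
      (\int[leb R n]_t (C * normc (window hbar q (t - x)))) * win1 n (s - s0))).
  - exact: (cmeas_cint_param (leb R n) mfp').
  - move=> s; rewrite mulrC -(RintegralZl _ measurableT ia); apply: normc_cint_le.
    + exact: (cmeas_comp (pair2_measurable s) mfp).
    + by move=> t; rewrite mulrC; exact: fN.
    + exact: (integrableZl measurableT _ ia).
  - exact: (integrableZl measurableT _ iw1).
have inner s : cint (leb R n) (fun t => f (row_rcons t s)) = ((kap n)^-1)%:C *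
    (cis (- (eta * s / hbar)) *
    (stft hbar (@window R hbar q n) (fun t => h (row_rcons t s)) x xi * (win1 n (s - s0))%:C)).
  have bhs := bcont_section s bh.
  have iv := cintegrable_cisM (measurable_dotc hbar xi) (cintegrable_window x bhs nw).
  rewrite (eq_cint _ (fE^~ s)) (cintZ _ iv) (stftE _ _ _ bhs nw) /ft /u /v.
  set I := cint _ _.
  rewrite -!mulrA; set w1 := cis _; set w2 := (win1 _ _)%:C.
  have kk : ((kap n)^-1)%:C * (kap n)%:C = 1.
    by rewrite -rmorphM /= mulVf// gt_eqF ?stft_cst_gt0.
  by rewrite -[LHS]mul1r -kk; ring.
have W s : cis (- (eta * s / hbar)) *
    (stft hbar (@window R hbar q n) (fun t => h (row_rcons t s)) x xi * (win1 n (s - s0))%:C) =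
    (kap n)%:C * cint (leb R n) (fun t => f (row_rcons t s)).
  rewrite inner (mulrA (kap n)%:C) -rmorphM /= divff ?mul1r// gt_eqF//; exact: stft_cst_gt0.
transitivity ((kap 1)%:C * cint mu1 (fun s : RR => (kap n)%:C *
    cint (leb R n) (fun t => f (row_rcons t s)))); last first.
  by congr (_ * _); apply: eq_cint => s; rewrite W.
by rewrite (cintZ _ iI) (stft_cstS h0 n) rmorphM /= -(mulrA (kap n)%:C) mulrCA.
Qed.

End windows.

Section stft_limits.
Context {R : realType} {n : nat}.
Variable hbar : R.
Implicit Types g h : 'rV[R]_n -> R[i].

Lemma stft_le g h (C : R) x xi : bcont h -> nice_window g -> (forall y, normc (h y) <= C) ->
  normc (stft hbar g h x xi) <= @stft_cst R n hbar * (C * \int[leb R n]_y normc (g y)).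
Proof.
move=> bh ng hC; have [bg ig] := ng.
rewrite (stftE _ _ _ bh ng) (normcMR _ (stft_cst_ge0 hbar)); apply: ler_wpM2l.
  exact: stft_cst_ge0.
have [igs' <-] := integrable_shift (- x) (cintegrable_norm ig).
rewrite -(RintegralZl _ measurableT igs'); apply: normc_cint_le.
- apply: cmeasM; first by apply: cmeas_cis; exact: measurable_dotc.
  by case: (cintegrable_window x bh ng).
- move=> y; rewrite (normcM (cis _)) (normcM (h y)) normc_cis mul1r normc_conjc.
  by apply: ler_wpM2r; [exact: normc_ge0|exact: hC].
- exact: (integrableZl measurableT C igs').
Qed.

Lemma stft_cvg_fun g (h_ : nat -> 'rV[R]_n -> R[i]) h (C : R) x xi :
  (forall k, bcont (h_ k)) -> bcont h -> nice_window g ->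
  (forall k y, normc (h_ k y) <= C) -> (forall y, h_ k y @[k --> \oo] --> h y) ->
  stft hbar g (h_ k) x xi @[k --> \oo] --> stft hbar g h x xi.
Proof.
move=> bh_ bh ng hC h_h; have [bg ig] := ng.
rewrite (stftE _ _ _ bh ng); under eq_fun do rewrite (stftE _ _ _ (bh_ _) ng).
apply: cvg_complexM; first exact: cvg_cst.
have mcis : cmeas (fun y : 'rV[R]_n => cis (- (dot xi y / hbar)) : R[i]).
  by apply: cmeas_cis; exact: measurable_dotc.
have mw h' : bcont h' ->
    cmeas (fun y => cis (- (dot xi y / hbar)) * (h' y * conjc (g (y - x)))).
  by move=> bh'; apply: cmeasM => //; case: (cintegrable_window x bh' ng).
have [igs' _] := integrable_shift (- x) (cintegrable_norm ig).
apply: (@cint_dominated _ _ R (leb R n)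
  (fun k y => cis (- (dot xi y / hbar)) * (h_ k y * conjc (g (y - x))))
  (fun y => cis (- (dot xi y / hbar)) * (h y * conjc (g (y - x))))
  (fun y => C * normc (g (y - x))) (fun k => mw _ (bh_ k)) (mw _ bh)).
- move=> y; apply: cvg_complexM; first exact: cvg_cst.
  by apply: cvg_complexM; [exact: h_h|exact: cvg_cst].
- move=> k y; rewrite (normcM (cis _)) (normcM (h_ k y)) normc_cis mul1r normc_conjc.
  by apply: ler_wpM2r; [exact: normc_ge0|exact: hC].
- exact: (integrableZl measurableT C igs').
Qed.

End stft_limits.

Section row1.
Context {R : realType}.
Local Notation RR := (measurableTypeR R).
Local Notation mu1 := (@lebesgue_measure R).

(** Identifies the line with ['rV[R]_1], so that [stft_inversion] also covers the one-variable
    transforms that arise when a variable is split off. *)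
Definition row1 (x : R) : 'rV[R]_1 := row_rcons (0 : 'rV[R]_0) x.

Lemma row1E x : row1 x 0 0 = x.
Proof.
transitivity (row1 x 0 ord_max); last exact: row_rcons_max.
by congr (row1 x 0 _); apply: val_inj.
Qed.

Lemma row1_transfer (f : 'rV[R]_1 -> \bar R) :
  measurable_fun setT f -> (forall y, 0 <= f y)%E ->
  (\int[mu1]_x f (row1 x) = 1%:E * \int[leb R 1]_y f y)%E.
Proof.
move=> mf f0; rewrite mul1e ge0_integral_row_rcons// (ge0_integral_leb0 0)// => t.
exact: integral_ge0.
Qed.

Lemma cint_row1 (f : 'rV[R]_1 -> R[i]) : cintegrable (leb R 1) f ->
  cint (leb R 1) f = cint mu1 (fun x : RR => f (row1 x)).
Proof.
rewrite -[LHS]mul1r => fi; apply: esym.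
exact: (@cint_transfer _ _ RR 'rV[R]_1 R mu1 (leb R 1) row1 1 row1_transfer f fi).
Qed.

End row1.

Section restriction.
Context {R : realType}.
Variables (hbar : R) (q : nat -> R).
Hypotheses (h0 : 0 < hbar) (q0 : forall j, 0 < q j).
Local Notation RR := (measurableTypeR R).
Local Notation mu1 := (@lebesgue_measure R).
Local Notation kap n := (@stft_cst R n hbar).
Local Notation win n := (@window R hbar q n).

Let nice_win1 j : nice_window (fun v : 'rV[R]_1 => (win1 hbar q j (v 0 0))%:C).
Proof.
have -> : (fun v : 'rV[R]_1 => (win1 hbar q j (v 0 0))%:C) =
    (fun v => (kap 1 * gauss (fun=> wcoef hbar q j) v)%:C).
  by apply/funext => v; rewrite /win1 /gauss big_ord1.
by apply/schwartz_nice_window/schwartz_gauss => _; exact: wcoef_gt0.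
Qed.

(* Evaluating at [0] in the last variable is integrating the transform over the
   last frequency, by one-dimensional Fourier inversion. *)
Lemma normMinf1_section n (h : 'rV[R]_n.+1 -> R[i]) : bcont h ->
  (normMinf1 hbar (win n) (fun t => h (row_rcons t 0)) <= normMinf1 hbar (win n.+1) h)%E.
Proof.
move=> bh; have nw := nice_window_window h0 q0 n; have nwS := nice_window_window h0 q0 n.+1.
have bs s := bcont_section s bh; have [_ [C hC]] := bh.
have mF := measurable_stft_sup hbar bh nwS.
have F0 := stft_sup_ge0 hbar bh nwS.
have mF' xi : measurable_fun setT (fun eta : RR => stft_sup hbar (win n.+1) h (row_rcons xi eta)).
  apply: (measurableT_comp mF).
  exact: (measurableT_comp (@measurable_row_rcons R n) (pair1_measurable xi)).
rewrite (normMinf1E hbar (bs 0) nw) (normMinf1E hbar bh nwS).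
rewrite ge0_integral_row_rcons; [|exact/measurable_EFinP|by move=> y; rewrite lee_fin].
apply: ge0_le_integral => //.
- by move=> xi _; rewrite lee_fin (stft_sup_ge0 hbar (bs 0) nw).
- by apply/measurable_EFinP; exact: (measurable_stft_sup hbar (bs 0) nw).
- apply: (@measurable_fun_fubini_tonelli_F _ _ _ _ _ mu1
    (fun p : 'rV[R]_n * RR => (stft_sup hbar (win n.+1) h (row_rcons p.1 p.2))%:E)).
    by apply/measurable_EFinP; exact: (measurableT_comp mF (@measurable_row_rcons R n)).
  by move=> p; rewrite lee_fin.
move=> xi _.
(* The norm of [h] is not assumed finite; where the integral over the last frequency diverges, the
   bound is trivial. *)
have [foo|] := boolP (\int[mu1]_eta (stft_sup hbar (win n.+1) h (row_rcons xi eta))%:E < +oo)%E; last first.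
  by rewrite -leNgt leye_eq => /eqP ->; rewrite leey.
pose G (v : 'rV[R]_1) := stft_sup hbar (win n.+1) h (row_rcons xi (v 0 0)).
have mG : measurable_fun setT G by exact: (measurableT_comp (mF' xi) (measurable_coord 0)).
have G0 v : 0 <= G v by exact: F0.
have GE : (\int[mu1]_eta (stft_sup hbar (win n.+1) h (row_rcons xi eta))%:E =
    \int[leb R 1]_v (G v)%:E)%E.
  rewrite -[RHS]mul1e -row1_transfer; [|exact/measurable_EFinP|by move=> v; rewrite lee_fin].
  by apply: eq_integral => eta _; rewrite /G row1E.
have iG : (leb R 1).-integrable setT (EFin \o G).
  apply/integrableP; split; first exact/measurable_EFinP.
  by under eq_integral do rewrite /= ger0_norm//; rewrite -GE.
rewrite GE -EFin_Rintegral// lee_fin; apply: stft_sup_le => x.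
(* As a function of the last variable, the transform of the sections; by [stft_rcons] its own
   transform centred at 0 is the full transform centred at [row_rcons x 0]. *)
pose h1 (v : 'rV[R]_1) := stft hbar (win n) (fun t => h (row_rcons t (v 0 0))) x xi.
have bh1 : bcont h1.
  split; last by eexists => v; apply: (stft_le hbar x xi (bs _) nw) => y; exact: hC.
  apply: continuous_seq => u l ul.
  apply: (@stft_cvg_fun R n hbar (win n) (fun k t => h (row_rcons t (u k 0 0))) _ C) => //.
  move=> t; have [ch _] := bh; apply: (cvg_continuous_complex ch).
  by apply: cvg_row_rcons; [exact: cvg_cst|exact: cvg_coord_row].
pose g1 (v : 'rV[R]_1) := (win1 hbar q n (v 0 0))%:C.
have ng1 : nice_window g1 := nice_win1 n.
have VE v : stft hbar g1 h1 0 v = stft hbar (win n.+1) h (row_rcons x 0) (row_rcons xi (v 0 0)).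
  rewrite (stftE _ _ _ bh1 ng1) (stft_rcons h0 q0) // /ft cint_row1; last first.
    exact: (cintegrable_cisM (measurable_dotc hbar v) (cintegrable_window 0 bh1 ng1)).
  congr (_ * _); apply: eq_cint => s.
  by rewrite /h1 /g1 conjc_real row1E !subr0 row1E /dot big_ord1 row1E.
have iV : cintegrable (leb R 1) (stft hbar g1 h1 0).
  apply: (cintegrable_le _ _ iG).
    exact: (cmeas_stft hbar bh1 ng1 (@measurable_cst _ _ _ 'rV[R]_1 setT 0) (@measurable_id _ 'rV[R]_1 setT)).
  by move=> v; rewrite VE; exact: (stft_le_sup hbar bh nwS).
have := stft_inversion h0 bh1 ng1 0 iV.
have k1 : 0 < kap 1 by exact: stft_cst_gt0.
(* The value of the window at 0 is the very constant in the inversion formula. The two cancel, so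
   the restriction has norm at most 1, with no constant to accumulate over the variables. *)
have g10 : g1 (0 - 0) = (kap 1)%:C.
  by rewrite /g1 /win1 subr0 mxE expr0n mulr0 oppr0 expR0 mulr1.
rewrite g10 conjc_real mulrC => /(congr1 (fun z => normc z)).
rewrite !(normcMR _ (ltW k1)) => /(mulfI (lt0r_neq0 k1)).
have -> : h1 0 = stft hbar (win n) (fun t => h (row_rcons t 0)) x xi by rewrite /h1 mxE.
move=> ->; apply: normc_cint_le => //.
  apply: cmeasM; last by case: iV.
  apply: cmeas_cis; apply: measurable_funM => //; apply: measurable_dot; first exact: measurable_id.
  exact: measurable_cst.
move=> v; rewrite (normcM (cis _)) normc_cis mul1r VE.
exact: (stft_le_sup hbar bh nwS).
Qed.

End restriction.

Section extension.
Context {R : realType}.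
Variables (hbar : R) (q : nat -> R).
Hypotheses (h0 : 0 < hbar) (q0 : forall j, 0 < q j).
Local Notation RR := (measurableTypeR R).
Local Notation mu1 := (@lebesgue_measure R).
Local Notation kap n := (@stft_cst R n hbar).
Local Notation win n := (@window R hbar q n).

Definition row_init n (y : 'rV[R]_n.+1) : 'rV[R]_n := \row_j y 0 (lift ord_max j).

Lemma row_initK n (t : 'rV[R]_n) s : row_init (row_rcons t s) = t.
Proof. by apply/rowP => j; rewrite mxE row_rcons_widen. Qed.

Lemma row_rcons_init n (y : 'rV[R]_n.+1) : row_rcons (row_init y) (y 0 ord_max) = y.
Proof. by apply: row_rconsP => // j; rewrite mxE. Qed.

Lemma bcont_init n (h : 'rV[R]_n -> R[i]) : bcont h -> bcont (fun y => h (row_init y)).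
Proof.
move=> [ch [C hC]]; split; last by exists C => y; exact: hC.
apply: continuous_seq => u l ul; apply: (cvg_continuous_complex ch); apply: cvg_row => i.
by under eq_fun do rewrite mxE; rewrite mxE; exact: cvg_coord_row.
Qed.

(* The modulus of the one-dimensional transform of the constant [1]. *)
Definition omega j (eta : R) : R := kap 1 * (kap 1 *
  (Num.sqrt (pi / wcoef hbar q j) * expR (- ((eta / hbar) ^+ 2 / (4 * wcoef hbar q j))))).

Lemma omega_gt0 j eta : 0 < omega j eta.
Proof.
have w0 := wcoef_gt0 h0 q0 j; have k0 := stft_cst_gt0 h0 1.
apply: mulr_gt0 => //; apply: mulr_gt0 => //; apply: mulr_gt0; last exact: expR_gt0.
by rewrite sqrtr_gt0 divr_gt0 ?pi_gt0.
Qed.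

Lemma omegaE j eta : omega j eta = kap 1 * (kap 1 * Num.sqrt (pi / wcoef hbar q j)) *
  expR (- ((2 * hbar ^+ 2 * (q j / hbar))^-1 * eta ^+ 2)).
Proof.
rewrite /omega -!mulrA; congr (_ * (_ * (_ * expR (- _)))); rewrite /wcoef; field.
by rewrite !gt_eqF.
Qed.

(** The mass is exactly 1 because window and transform carry the same prefactor: its square times
    the Gaussian integrals, of product 2 pi hbar, is 1. *)
Lemma integral_omega j : (\int[mu1]_eta (omega j eta)%:E = 1)%E /\ measurable_fun setT (omega j).
Proof.
have c0 : 0 < (2 * hbar ^+ 2 * (q j / hbar))^-1.
  by rewrite invr_gt0 !mulr_gt0// ?exprn_gt0 ?invr_gt0.
have [ig Ig] := integral_gauss c0.
have E : omega j = fun eta => kap 1 * (kap 1 * Num.sqrt (pi / wcoef hbar q j)) *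
    expR (- ((2 * hbar ^+ 2 * (q j / hbar))^-1 * eta ^+ 2)) by apply/funext => eta; rewrite omegaE.
split; last by rewrite E; apply: measurable_funM => //; exact: measurable_gauss1.
rewrite E -EFin_Rintegral; last exact: (integrableZl measurableT _ ig).
rewrite (RintegralZl _ measurableT ig) Ig; congr (_%:E).
rewrite -2!(mulrA (kap 1)) -sqrtrM; last by rewrite divr_ge0 ?pi_ge0// ltW// wcoef_gt0.
rewrite (mulrA (kap 1) (kap 1)) stft_cst_sqr// expr1.
have -> : pi / wcoef hbar q j * (pi / (2 * hbar ^+ 2 * (q j / hbar))^-1) = (2 * pi * hbar) ^+ 2.
  by rewrite /wcoef; field; rewrite !gt_eqF.
have p0 : 0 < 2 * pi * hbar by rewrite !mulr_gt0 ?pi_gt0.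
by rewrite sqrtr_sqr gtr0_norm// mulVf// gt_eqF.
Qed.

Lemma cint_win1 j eta s0 :
  cint mu1 (fun s : RR => cis (- (eta * s / hbar)) * (win1 hbar q j (s - s0))%:C) =
  cis (- (eta * s0 / hbar)) * (omega j eta / kap 1)%:C.
Proof.
have w0 := wcoef_gt0 h0 q0 j; have k0 := stft_cst_gt0 h0 1.
have ml : measurable_fun setT (fun s : R => (- (eta / hbar)) * s) by exact: mulrl_measurable.
have ic := cintegrable_gauss_cis w0 ml.
pose f (s : RR) := (kap 1)%:C * ((expR (- (wcoef hbar q j * s ^+ 2)))%:C * cis (- (eta / hbar) * s)).
have ick : cintegrable mu1 f by exact: cintegrableZ.
transitivity (cint mu1 (fun s : RR => cis (- (eta * s0 / hbar)) * f (s - s0))).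
  apply: eq_cint => s; rewrite /f /win1 rmorphM /=.
  have -> : - (eta * s / hbar) = - (eta * s0 / hbar) + - (eta / hbar) * (s - s0) by ring.
  by rewrite cisD /=; ring.
have ifs : cintegrable mu1 (fun s : RR => f (s - s0)).
  apply: (@cintegrable_transfer _ _ RR RR R mu1 mu1 (fun s => s - s0) 1 ltr01 _ _ f ick).
    by apply: measurable_funB => //; exact: measurable_cst.
  exact: shift_transfer.
rewrite (cintZ _ ifs) (cint_shift1 s0 ick) (cintZ _ ic); congr (_ * _).
rewrite (cint_gauss_fourier1 _ w0) -rmorphM /=; congr (_%:C).
by rewrite /omega [RHS]mulrAC divff ?gt_eqF// mul1r sqrrN.
Qed.

Lemma stft_init n (h : 'rV[R]_n -> R[i]) (x xi : 'rV[R]_n) (s0 eta : R) : bcont h ->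
  stft hbar (win n.+1) (fun y => h (row_init y)) (row_rcons x s0) (row_rcons xi eta) =
  (stft hbar (win n) h x xi * cis (- (eta * s0 / hbar))) * (omega n eta)%:C.
Proof.
move=> bh; have k0 := stft_cst_gt0 h0 1.
rewrite (stft_rcons h0 q0) //; last exact: bcont_init.
have iw : cintegrable mu1 (fun s : RR => cis (- (eta * s / hbar)) * (win1 hbar q n (s - s0))%:C).
  have ml : measurable_fun setT (fun s : RR => - (eta * s / hbar)).
    apply: measurable_funN; apply: measurable_funM => //; exact: mulrl_measurable.
  have mw := measurable_win1 hbar q n s0.
  apply: (cintegrable_le _ _ (integrable_win1 h0 q0 n s0)).
    by apply: cmeasM; [exact: cmeas_cis|exact: cmeas_real].
  by move=> s; rewrite (normcM (cis _)) normc_cis mul1r normc_R ger0_norm// win1_ge0.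
transitivity ((kap 1)%:C * (stft hbar (win n) h x xi *
    cint mu1 (fun s : RR => cis (- (eta * s / hbar)) * (win1 hbar q n (s - s0))%:C))).
  congr (_ * _); rewrite -(cintZ _ iw); apply: eq_cint => s.
  by under [in LHS]eq_fun do rewrite row_initK; rewrite (mulrCA (cis _)).
have kk : (kap 1)%:C * (omega n eta / kap 1)%:C = (omega n eta)%:C.
  by rewrite -rmorphM /= mulrC divfK// gt_eqF.
rewrite cint_win1 -kk; move: (stft _ _ _ _ _) (cis _) (_%:C) (_%:C) => a b c d; ring.
Qed.

(** A dummy variable multiplies the modulus of the transform by [omega n eta], which does not depend
    on the centre. The supremum factors, and the extra frequency integrates to 1. *)
Lemma normMinf1_init n (h : 'rV[R]_n -> R[i]) : bcont h ->
  normMinf1 hbar (win n.+1) (fun y => h (row_init y)) = normMinf1 hbar (win n) h.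
Proof.
move=> bh; have bhi := bcont_init bh.
have nw := nice_window_window h0 q0 n; have nwS := nice_window_window h0 q0 n.+1.
have F0 := stft_sup_ge0 hbar bh nw.
have mF := measurable_stft_sup hbar bhi nwS.
have normE x s0 xi eta : normc (stft hbar (win n.+1) (fun y => h (row_init y))
    (row_rcons x s0) (row_rcons xi eta)) = normc (stft hbar (win n) h x xi) * omega n eta.
  rewrite (stft_init _ _ _ _ bh) (normcM (_ * _)) (normcM (stft _ _ _ _ _) (cis _)) normc_cis mulr1.
  by rewrite normc_R gtr0_norm// omega_gt0.
have supE xi eta : stft_sup hbar (win n.+1) (fun y => h (row_init y)) (row_rcons xi eta) =
    stft_sup hbar (win n) h xi * omega n eta.
  apply/eqP; rewrite eq_le; apply/andP; split.
    apply: stft_sup_le => y; rewrite -(row_rcons_init y) normE.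
    apply: ler_wpM2r; first exact: (ltW (omega_gt0 n eta)).
    exact: (stft_le_sup hbar bh nw).
  rewrite -(ler_pdivlMr _ _ (omega_gt0 n eta)); apply: stft_sup_le => x.
  rewrite (ler_pdivlMr _ _ (omega_gt0 n eta)) -(normE x 0); exact: (stft_le_sup hbar bhi nwS).
rewrite (normMinf1E hbar bh nw) (normMinf1E hbar bhi nwS).
rewrite ge0_integral_row_rcons; [|exact/measurable_EFinP|].
  apply: eq_integral => xi _; have [io mo] := integral_omega n.
  under eq_integral do rewrite supE EFinM.
  rewrite ge0_integralZl//; first by rewrite io mule1.
  - exact/measurable_EFinP.
  - by move=> eta _; rewrite lee_fin ltW// omega_gt0.
  - by rewrite lee_fin.
by move=> y; rewrite lee_fin (stft_sup_ge0 hbar bhi nwS).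
Qed.

End extension.

(** * Fresnel integrals *)

Lemma measurable_dot_div (R : realType) n (hbar : R) d (T : measurableType d)
    (u v : T -> 'rV[R]_n) : measurable_fun setT u -> measurable_fun setT v ->
  measurable_fun setT (fun t => dot (u t) (v t) / hbar).
Proof. by move=> mu mv; apply: measurable_funM => //; exact: measurable_dot. Qed.

Section fresnel_limit.
Context {R : realType} {n : nat}.
Variable hbar : R.
Hypothesis h0 : 0 < hbar.
Variables (g h : 'rV[R]_n -> R[i]).
Hypotheses (bh : bcont h) (ng : nice_window g) (foo : (normMinf1 hbar g h < +oo)%E).
Local Notation mu := (leb R n).
Local Notation kap := (@stft_cst R n hbar).
Local Notation V := (stft hbar g h).
Local Notation F := (stft_sup hbar g h).

Definition chirp (s : R) (y : 'rV[R]_n) : R[i] := cis (s * (dot y y / (2 * hbar))).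

(** The [D] of the overview. *)
Definition chirp_window : R[i] := cint mu (fun z => chirp (-1) z * conjc (g z)).

Definition chirp_stft : R[i] := cint mu (fun xi => chirp (-1) xi * V (- xi) xi).

Lemma normc_chirp s y : normc (chirp s y) = 1. Proof. exact: normc_cis. Qed.

Lemma cmeas_chirp d (T : measurableType d) s (u : T -> 'rV[R]_n) : measurable_fun setT u ->
  cmeas (fun t => chirp s (u t)).
Proof.
move=> mu'; apply: cmeas_cis; apply: measurable_funM => //; apply: measurable_funM => //.
exact: measurable_dot.
Qed.

(** The squares in [y] cancel and leave a character of frequency [xi]. Read against conj (g (y +
    xi)), this is the transform at frequency [xi] with window centred at [- xi]. *)
Lemma chirpD (xi y : 'rV[R]_n) : chirp 1 y * chirp (-1) (xi + y) =
  chirp (-1) xi * cis (- (dot xi y / hbar)).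
Proof.
rewrite /chirp -!cisD; congr (cis _); rewrite !dotDl !dotDr (dotC y xi); field.
by rewrite gt_eqF.
Qed.

Let iF := integrable_stft_sup bh ng foo.

Let VF x xi : normc (V x xi) <= F xi.
Proof. exact: (stft_le_sup hbar bh ng). Qed.

Section fixed_cutoff.
Variables (phi : 'rV[R]_n -> R[i]).
Hypothesis sphi : schwartz phi.
Local Notation phih := (ft hbar phi).

Let nphi : nice_window phi := schwartz_nice_window sphi.

Let iphih : cintegrable mu phih.
Proof. exact: ft_schwartz_integrable. Qed.

Let phih_bounded : exists B, forall eta, normc (phih eta) <= B.
Proof.
have [bp ip] := nphi; exists (\int[mu]_y normc (phi y)) => eta.
apply: normc_cint_le; last exact: cintegrable_norm.
  by have [] := cintegrable_cisM (measurable_dotc hbar eta) ip.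
by move=> y; rewrite (normcM (cis _)) normc_cis mul1r.
Qed.

Let kap0 : 0 < kap := stft_cst_gt0 h0 n.

Let kapVK : (kap^-1)%:C * kap%:C = 1.
Proof. by rewrite -rmorphM /= mulVf// gt_eqF. Qed.

Let kap2K : (kap ^+ 2)%:C * (kap ^- 2)%:C = 1.
Proof. by rewrite -rmorphM /= divff// expf_neq0// gt_eqF. Qed.

Let kap2V : (kap ^+ 2)%:C * (kap^-1)%:C = kap%:C.
Proof. by rewrite -rmorphM /= expr2 mulfK// gt_eqF. Qed.

Lemma schwartz_inversion y :
  cint mu (fun eta => cis (dot eta y / hbar) * phih eta) = (kap ^- 2)%:C * phi y.
Proof.
have [[cp [B pB]] ip] := nphi.
rewrite (fourier_inversion y h0 cp pB ip iphih) -stft_cst_sqr// -expr2.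
by rewrite (mulrA (kap ^- 2)%:C) -rmorphM /= mulVf ?mul1r// expf_neq0// gt_eqF.
Qed.

Variable eps : R.
Hypothesis eps0 : 0 < eps.

Let w y := h y * phi (eps *: y).

Let iphie : cintegrable mu (fun y => phi (eps *: y)).
Proof.
have [_ ip] := nphi; have [+ _] := cint_affine 0 (lt0r_neq0 eps0) ip.
by under eq_fun do rewrite addr0.
Qed.

Let iw : cintegrable mu w.
Proof.
have [_ [C hC]] := bh.
apply: (cintegrable_le _ _ (integrableZl measurableT C (cintegrable_norm iphie))).
  by apply: cmeasM; [exact: bcont_cmeas|case: iphie].
by move=> y; rewrite (normcM (h y)); apply: ler_wpM2r; [exact: normc_ge0|exact: hC].
Qed.

Let Z xi := cint mu (fun y => cis (- (dot xi y / hbar)) * (w y * conjc (g (y + xi)))).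

(** The integral defining [chirp_window] is unchanged by z = xi + y for each y; exchanging the
    integrals and applying [chirpD] isolates the character in [y]. *)
Let cutoff_fubini : cint mu (fun y => chirp 1 y * w y) * chirp_window =
  cint mu (fun xi => chirp (-1) xi * Z xi).
Proof.
have [bg ig] := ng; have [cg [B gB]] := bg.
pose G z := chirp (-1) z * conjc (g z).
have mconj : cmeas (fun z => conjc (g z)) by apply: cmeas_conj; exact: bcont_cmeas.
have mG : cmeas G by apply: cmeasM => //; exact: (cmeas_chirp (-1) (@measurable_id _ 'rV[R]_n setT)).
have GE z : normc (G z) = normc (g z).
  by rewrite /G (normcM (chirp _ _)) normc_chirp mul1r normc_conjc.
have iG : cintegrable mu G.
  by apply: (cintegrable_le mG _ (cintegrable_norm ig)) => z; rewrite GE.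
have icw : cintegrable mu (fun y => chirp 1 y * w y).
  apply: (cintegrable_le _ _ (cintegrable_norm iw)).
    by apply: cmeasM; [exact: (cmeas_chirp 1 (@measurable_id _ 'rV[R]_n setT))|case: iw].
  by move=> y; rewrite (normcM (chirp _ _)) normc_chirp mul1r.
pose f (p : 'rV[R]_n * 'rV[R]_n) := (chirp 1 p.1 * w p.1) * G (p.2 + p.1).
have mf : cmeas f.
  apply: cmeasM; first exact: (@cmeas_comp _ _ _ _ _ fst _ measurable_fst (proj1 icw)).
  apply: (cmeas_comp (phi := fun p : 'rV[R]_n * 'rV[R]_n => p.2 + p.1) _ mG).
  by apply: measurable_rowD; [exact: measurable_snd|exact: measurable_fst].
have fb y xi : normc (f (y, xi)) <= normc (chirp 1 y * w y) * normc (g (xi + y)).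
  by rewrite /f (normcM (chirp 1 y * w y)) GE.
have ig' y := (integrable_shift y (cintegrable_norm ig)).1.
have igE y := (integrable_shift y (cintegrable_norm ig)).2.
have igM y : \int[mu]_xi normc (g (xi + y)) <= \int[mu]_z normc (g z) by rewrite igE.
have FU := cfubini mf fb (fun=> normc_ge0 _) (cintegrable_norm icw) ig' igM (fun y xi => gB (xi + y)).
transitivity (cint mu (fun y => cint mu (fun xi => f (y, xi)))).
  rewrite mulrC -(cintZ _ icw); apply: eq_cint => y.
  have [iGs EGs] := cint_shift y iG.
  have E : cint mu (fun xi => f (y, xi)) = (chirp 1 y * w y) * cint mu (fun xi => G (xi + y)).
    exact: (cintZ (chirp 1 y * w y) iGs).
  by rewrite E EGs mulrC.
rewrite FU; apply: eq_cint => xi.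
have iz : cintegrable mu (fun y => cis (- (dot xi y / hbar)) * (w y * conjc (g (y + xi)))).
  apply: (cintegrable_cisM (measurable_dotc hbar xi)).
  apply: (cintegrable_le _ _ (integrableZl measurableT B (cintegrable_norm iw))).
    apply: cmeasM; first by case: iw.
    apply: (cmeas_comp (phi := fun y : 'rV[R]_n => y + xi) _ mconj).
    by apply: measurable_rowD; [exact: measurable_id|exact: measurable_cst].
  move=> y; rewrite (normcM (w y)) normc_conjc mulrC.
  by apply: ler_wpM2r; [exact: normc_ge0|exact: gB].
rewrite -(cintZ _ iz); apply: eq_cint => y.
rewrite [RHS]mulrA -chirpD /f /G; cbn [fst snd]; rewrite (addrC y xi).
move: (chirp 1 y) (w y) (chirp _ _) (conjc _) => a b c d; ring.
Qed.

(** The inversion formula for phi(eps y) is a superposition of characters, each of which shifts the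
    frequency of the transform of [h] by eps eta. *)
Let cutoff_stft xi : Z xi = kap%:C * cint mu (fun eta => phih eta * V (- xi) (xi - eps *: eta)).
Proof.
have [bg ig] := ng; have [B pB] := phih_bounded; have [_ [C hC]] := bh.
have iW := cintegrable_window (- xi) bh ng.
pose U y := cis (- (dot xi y / hbar)) * (h y * conjc (g (y - - xi))).
have iU : cintegrable mu U := cintegrable_cisM (measurable_dotc hbar xi) iW.
pose f (p : 'rV[R]_n * 'rV[R]_n) := U p.1 * (cis (dot p.2 (eps *: p.1) / hbar) * phih p.2).
have mf : cmeas f.
  apply: cmeasM; first exact: (@cmeas_comp _ _ _ _ _ fst _ measurable_fst (proj1 iU)).
  apply: cmeasM; last exact: (@cmeas_comp _ _ _ _ _ snd _ measurable_snd (proj1 iphih)).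
  apply: cmeas_cis; apply: measurable_dot_div; first exact: measurable_snd.
  by apply: measurable_rowZ; exact: measurable_fst.
have fb y eta : normc (f (y, eta)) <= normc (U y) * normc (phih eta).
  by rewrite /f (normcM (U y)) (normcM (cis _)) normc_cis mul1r.
have FU := cfubini mf fb (fun=> normc_ge0 _) (cintegrable_norm iU)
  (fun=> cintegrable_norm iphih) (fun=> lexx _) (fun _ eta => pB eta).
have icp y : cintegrable mu (fun eta => cis (dot eta y / hbar) * phih eta).
  have md := measurable_dot_div hbar (@measurable_id _ 'rV[R]_n setT)
    (@measurable_cst _ _ _ 'rV[R]_n setT y).
  exact: (cintegrable_cisM md iphih).
have E1 : cint mu (fun y => cint mu (fun eta => f (y, eta))) = (kap ^- 2)%:C * Z xi.
  have iz : cintegrable mu (fun y => cis (- (dot xi y / hbar)) * (w y * conjc (g (y + xi)))).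
    apply: (cintegrable_cisM (measurable_dotc hbar xi)).
    have [[cg [Bg gB]] _] := ng.
    apply: (cintegrable_le _ _ (integrableZl measurableT Bg (cintegrable_norm iw))).
      apply: cmeasM; first by case: iw.
      apply: cmeas_conj; apply: (cmeas_comp (phi := fun y : 'rV[R]_n => y + xi) _ (bcont_cmeas bg)).
      by apply: measurable_rowD; [exact: measurable_id|exact: measurable_cst].
    move=> y; rewrite (normcM (w y)) normc_conjc mulrC.
    by apply: ler_wpM2r; [exact: normc_ge0|exact: gB].
  rewrite -(cintZ _ iz); apply: eq_cint => y.
  have E : cint mu (fun eta => f (y, eta)) = U y *
      cint mu (fun eta => cis (dot eta (eps *: y) / hbar) * phih eta).
    exact: (cintZ (U y) (icp (eps *: y))).
  rewrite E schwartz_inversion /U opprK /w.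
  move: (cis _) (h y) (conjc _) (phi _) (_%:C) => a b c d e; ring.
have E2 eta : cint mu (fun y => f (y, eta)) = (kap^-1)%:C * (phih eta * V (- xi) (xi - eps *: eta)).
  have ifw := cintegrable_cisM (measurable_dotc hbar (xi - eps *: eta)) iW.
  transitivity (phih eta * ft hbar (fun y => h y * conjc (g (y - - xi))) (xi - eps *: eta)).
    rewrite {2}/ft -(cintZ _ ifw); apply: eq_cint => y; rewrite /f /U; cbn [fst snd].
    have -> : - (dot (xi - eps *: eta) y / hbar) = - (dot xi y / hbar) + dot eta (eps *: y) / hbar.
      by rewrite dotDl dotNl dotZl dotZr; ring.
    rewrite cisD; move: (cis _) (cis _) (h y) (conjc _) (phih eta) => a b c d e; ring.
  have VE : V (- xi) (xi - eps *: eta) =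
      kap%:C * ft hbar (fun y => h y * conjc (g (y - - xi))) (xi - eps *: eta).
    exact: (stftE hbar (- xi) (xi - eps *: eta) bh ng).
  have kk := kapVK; rewrite VE; move: (phih eta) => b; move: (ft _ _ _) => a; move: (kap^-1)%:C (kap%:C) kk => k' k kk.
  by rewrite (mulrCA k') (mulrA k') kk mul1r.
have iPV : cintegrable mu (fun eta => phih eta * V (- xi) (xi - eps *: eta)).
  have [BV VB] := stft_bounded hbar bh ng.
  apply: (cintegrable_le _ _ (integrableZl measurableT BV (cintegrable_norm iphih))).
    apply: cmeasM; first by case: iphih.
    apply: (cmeas_stft hbar bh ng); first exact: measurable_cst.
    apply: measurable_rowB; first exact: measurable_cst.
    by apply: measurable_rowZ; exact: measurable_id.
  by move=> eta; rewrite (normcM (phih eta)) mulrC; apply: ler_wpM2r; [exact: normc_ge0|exact: VB].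
have E : (kap ^- 2)%:C * Z xi =
    (kap^-1)%:C * cint mu (fun eta => phih eta * V (- xi) (xi - eps *: eta)).
  exact: (etrans (esym E1) (etrans FU (etrans (eq_cint _ E2) (cintZ _ iPV)))).
move: (Z xi) (cint mu _) E => z I E.
by rewrite -[LHS]mul1r -kap2K -(mulrA (kap ^+ 2)%:C) E (mulrA (kap ^+ 2)%:C) kap2V.
Qed.

(** The substitution of xi + eps eta for xi removes eps from the frequency argument. The integrand
    is then dominated by [stft_sup] at xi, independently of eps and eta, and the limit in eps only
    requires continuity in the window centre. *)
Lemma cutoff_chirp_window :
  cint mu (fun y => chirp 1 y * w y) * chirp_window =
  cint mu (fun eta => kap%:C * phih eta *
    cint mu (fun xi => chirp (-1) (xi + eps *: eta) * V (- (xi + eps *: eta)) xi)).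
Proof.
have ikphi : cintegrable mu (fun eta => kap%:C * phih eta) by exact: cintegrableZ.
have [B FB] := stft_sup_bounded hbar bh ng.
have mF := measurable_stft_sup hbar bh ng.
pose f (p : 'rV[R]_n * 'rV[R]_n) :=
  kap%:C * phih p.1 * (chirp (-1) p.2 * V (- p.2) (p.2 - eps *: p.1)).
have msub : measurable_fun setT (fun p : 'rV[R]_n * 'rV[R]_n => p.2 - eps *: p.1).
  by apply: measurable_rowB; [exact: measurable_snd|apply: measurable_rowZ; exact: measurable_fst].
have mf : cmeas f.
  apply: cmeasM; first exact: (@cmeas_comp _ _ _ _ _ fst _ measurable_fst (proj1 ikphi)).
  apply: cmeasM; first exact: (cmeas_chirp (-1) measurable_snd).
  by apply: (cmeas_stft hbar bh ng) => //; apply: measurable_rowN; exact: measurable_snd.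
have fb eta xi : normc (f (eta, xi)) <= normc (kap%:C * phih eta) * F (xi - eps *: eta).
  rewrite /f (normcM (kap%:C * phih eta)) (normcM (chirp _ _)) normc_chirp mul1r.
  by apply: ler_wpM2l; [exact: normc_ge0|exact: VF].
have iFs eta := (integrable_shift (- (eps *: eta)) iF).1.
have EFs eta := (integrable_shift (- (eps *: eta)) iF).2.
have FM eta : \int[mu]_xi F (xi - eps *: eta) <= \int[mu]_xi F xi :=
  eq_ind_r (fun r => r <= \int[mu]_xi F xi) (lexx _) (EFs eta).
have FU := cfubini mf fb (fun=> normc_ge0 _) (cintegrable_norm ikphi) iFs FM (fun eta xi => FB _).
rewrite cutoff_fubini.
have iPV xi : cintegrable mu (fun eta => phih eta * V (- xi) (xi - eps *: eta)).
  apply: (cintegrable_le _ _ (integrableZl measurableT B (cintegrable_norm iphih))).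
    apply: cmeasM; first by case: iphih.
    apply: (cmeas_stft hbar bh ng); first exact: measurable_cst.
    apply: measurable_rowB; first exact: measurable_cst.
    by apply: measurable_rowZ; exact: measurable_id.
  move=> eta; rewrite (normcM (phih eta)) mulrC; apply: ler_wpM2r; first exact: normc_ge0.
  exact: le_trans (VF _ _) (FB _).
have E1 xi : chirp (-1) xi * Z xi = cint mu (fun eta => f (eta, xi)).
  rewrite cutoff_stft mulrA -(cintZ _ (iPV xi)); apply: eq_cint => eta; rewrite /f; cbn [fst snd].
  move: (chirp _ _) (V _ _) (_%:C) (phih eta) => a b c d; ring.
have E2 eta : cint mu (fun xi => f (eta, xi)) = kap%:C * phih eta *
    cint mu (fun xi => chirp (-1) (xi + eps *: eta) * V (- (xi + eps *: eta)) xi).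
  pose H zeta := chirp (-1) (zeta + eps *: eta) * V (- (zeta + eps *: eta)) zeta.
  have madd : measurable_fun setT (fun z : 'rV[R]_n => z + eps *: eta).
    by apply: measurable_rowD; [exact: measurable_id|exact: measurable_cst].
  have iH : cintegrable mu H.
    apply: (cintegrable_le _ _ iF).
      apply: cmeasM; first exact: cmeas_chirp.
      by apply: (cmeas_stft hbar bh ng); [exact: measurable_rowN|exact: measurable_id].
    by move=> z; rewrite /H (normcM (chirp _ _)) normc_chirp mul1r; exact: VF.
  have [iHs EH] := cint_shift (- (eps *: eta)) iH.
  rewrite -/(cint mu H) -EH -(cintZ _ iHs); apply: eq_cint => xi.
  by rewrite /f /H; cbn [fst snd]; rewrite subrK.
exact: (etrans (eq_cint _ E1) (etrans (esym FU) (eq_cint _ E2))).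
Qed.

End fixed_cutoff.

End fresnel_limit.

Lemma cvg_cis (R : realType) (u : nat -> R) (l : R) :
  u k @[k --> \oo] --> l -> (cis (u k) : R[i]) @[k --> \oo] --> cis l.
Proof.
move=> ul; apply/cvg_complexP; split => /=; apply: cvg_comp; try exact: ul.
  exact: continuous_cos.
exact: continuous_sin.
Qed.

Lemma cvg_dot (R : realType) n (u v : nat -> 'rV[R]_n) (x y : 'rV[R]_n) :
  u k @[k --> \oo] --> x -> v k @[k --> \oo] --> y -> dot (u k) (v k) @[k --> \oo] --> dot x y.
Proof.
move=> ux vy; rewrite /dot; elim: (index_enum _) => [|i s IHs].
  by under eq_fun do rewrite big_nil; rewrite big_nil; exact: cvg_cst.
under eq_fun do rewrite big_cons; rewrite big_cons; apply: cvgD => //.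
by apply: cvgM; exact: cvg_coord_row.
Qed.

Section fresnel_formula.
Context {R : realType} {n : nat}.
Variable hbar : R.
Hypothesis h0 : 0 < hbar.
Variables (g h : 'rV[R]_n -> R[i]).
Hypotheses (bh : bcont h) (ng : nice_window g) (foo : (normMinf1 hbar g h < +oo)%E).
Hypothesis D0 : chirp_window hbar g != 0.
Local Notation mu := (leb R n).
Local Notation kap := (@stft_cst R n hbar).
Local Notation V := (stft hbar g h).
Local Notation F := (stft_sup hbar g h).
Local Notation J := (chirp_stft hbar g h).

Let iF := integrable_stft_sup bh ng foo.

Let cvg_chirp (u : nat -> 'rV[R]_n) x s : u k @[k --> \oo] --> x ->
  chirp hbar s (u k) @[k --> \oo] --> chirp hbar s x.
Proof.
move=> ux; apply: cvg_cis; apply: cvgM; first exact: cvg_cst.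
by apply: cvgM; [exact: cvg_dot|exact: cvg_cst].
Qed.

Let H (e : R) eta xi := chirp hbar (-1) (xi + e *: eta) * V (- (xi + e *: eta)) xi.

Let cmeas_H e : cmeas (fun p : 'rV[R]_n * 'rV[R]_n => H e p.1 p.2).
Proof.
have madd : measurable_fun setT (fun p : 'rV[R]_n * 'rV[R]_n => p.2 + e *: p.1).
  by apply: measurable_rowD; [exact: measurable_snd|apply: measurable_rowZ; exact: measurable_fst].
apply: cmeasM; first exact: cmeas_chirp.
by apply: (cmeas_stft hbar bh ng); [exact: measurable_rowN|exact: measurable_snd].
Qed.

Let cmeas_H1 e eta : cmeas (H e eta).
Proof. exact: (cmeas_comp (pair1_measurable eta) (cmeas_H e)). Qed.

Let normH e eta xi : normc (H e eta xi) <= F xi.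
Proof. by rewrite /H (normcM (chirp _ _ _)) normc_chirp mul1r; exact: (stft_le_sup hbar bh ng). Qed.

Let H0 eta : cint mu (H 0 eta) = J.
Proof. by apply: eq_cint => xi; rewrite /H scale0r addr0. Qed.

Let cvg_H (u : nat -> R) eta : u k @[k --> \oo] --> 0 ->
  cint mu (H (u k) eta) @[k --> \oo] --> J.
Proof.
move=> u0; rewrite -(H0 eta).
apply: (@cint_dominated _ _ R mu (fun k => H (u k) eta) (H 0 eta) F
  (fun k => cmeas_H1 (u k) eta) (cmeas_H1 0 eta) _ (fun k xi => normH (u k) eta xi) iF).
move=> xi; have c : xi + u k *: eta @[k --> \oo] --> xi + 0 *: eta.
  by apply: cvgD; [exact: cvg_cst|exact: cvg_scale_row].
apply: cvg_complexM; first exact: cvg_chirp.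
exact: (@stft_cvg R n hbar g h (fun k => - (xi + u k *: eta)) (- (xi + 0 *: eta)) xi bh ng (cvgN c)).
Qed.

Lemma cvg_fresnel_seq (phi : 'rV[R]_n -> R[i]) (u : nat -> R) : schwartz phi -> phi 0 = 1 ->
  (forall k, 0 < u k) -> u k @[k --> \oo] --> 0 ->
  fresnel_approx hbar h phi (u k) @[k --> \oo] -->
    cis (- (pi * n%:R / 4)) * (J / chirp_window hbar g).
Proof.
move=> sp p1 u0 uc; have k0 : 0 < kap by exact: stft_cst_gt0.
have iphi : cintegrable mu (ft hbar phi) by exact: ft_schwartz_integrable.
have ikphi : cintegrable mu (fun eta => kap%:C * ft hbar phi eta) by exact: cintegrableZ.
(* Inversion at 0 makes the integral of the transform of the cutoff a multiple of phi(0) = 1, so the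
   limit no longer depends on [phi]. *)
have I : cint mu (fun eta => kap%:C * ft hbar phi eta * J) = (kap^-1)%:C * J.
  have := schwartz_inversion h0 sp 0; rewrite p1 mulr1 => E.
  transitivity (cint mu (fun eta => (kap%:C * J) * ft hbar phi eta)).
    by apply: eq_cint => eta; rewrite mulrAC.
  rewrite (cintZ _ iphi).
  have -> : cint mu (ft hbar phi) = (kap ^- 2)%:C.
    by rewrite -E; apply: eq_cint => eta; rewrite dot0r mul0r cis0 mul1r.
  rewrite mulrAC -rmorphM /=; congr (_%:C * _).
  by rewrite expr2 invfM mulrA divff ?mul1r// gt_eqF.
have lim : cint mu (fun eta => kap%:C * ft hbar phi eta * cint mu (H (u k) eta)) @[k --> \oo] -->
    (kap^-1)%:C * J.
  rewrite -I; apply: (@cint_dominated _ _ R mu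
    (fun k eta => kap%:C * ft hbar phi eta * cint mu (H (u k) eta))
    (fun eta => kap%:C * ft hbar phi eta * J)
    (fun eta => (\int[mu]_xi F xi) * normc (kap%:C * ft hbar phi eta))).
  - move=> k; apply: cmeasM; first by case: ikphi.
    exact: (cmeas_cint_param mu (cmeas_H (u k))).
  - by apply: cmeasM; [case: ikphi|exact: cmeas_cst].
  - by move=> eta; apply: cvg_complexM; [exact: cvg_cst|exact: cvg_H].
  - move=> k eta; rewrite (normcM (kap%:C * _)) mulrC; apply: ler_wpM2r; first exact: normc_ge0.
    by apply: normc_cint_le iF; [exact: cmeas_H1|exact: normH].
  - exact: (integrableZl measurableT _ (cintegrable_norm ikphi)).
have AE k : fresnel_approx hbar h phi (u k) = kap%:C * cis (- (pi * n%:R / 4)) *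
    (cint mu (fun eta => kap%:C * ft hbar phi eta * cint mu (H (u k) eta)) / chirp_window hbar g).
  rewrite -(cutoff_chirp_window h0 bh ng foo sp (u0 k)) mulfK//.
  rewrite /fresnel_approx -/kap; congr (_ * _).
  have E x : cis (dot x x / (2 * hbar)) * h x * phi (u k *: x) =
      chirp hbar 1 x * (h x * phi (u k *: x)) by rewrite /chirp mul1r mulrA.
  rewrite (funext E) cintegralE//.
  have [bp _] := schwartz_nice_window sp.
  apply: cmeasM; first exact: (cmeas_chirp hbar 1 (@measurable_id _ 'rV[R]_n setT)).
  apply: cmeasM; first exact: bcont_cmeas.
  apply: (cmeas_comp _ (bcont_cmeas bp)).
  by apply: measurable_rowZ; exact: measurable_id.
have -> : cis (- (pi * n%:R / 4)) * (J / chirp_window hbar g) =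
    kap%:C * cis (- (pi * n%:R / 4)) * ((kap^-1)%:C * J / chirp_window hbar g).
  have kk : kap%:C * (kap^-1)%:C = 1 by rewrite -rmorphM /= divff// gt_eqF.
  rewrite -!mulrA (mulrCA _ (cis _)) (mulrA _ _ (_ / _)) kk mul1r //.
under eq_fun do rewrite AE.
apply: cvg_complexM; first exact: cvg_cst.
by apply: cvg_complexM; [exact: lim|exact: cvg_cst].
Qed.

(** Dominated convergence works along sequences, and a right limit of a real function is determined
    by sequences; hence the passage through real and imaginary parts. *)
Lemma cvg_fresnel (phi : 'rV[R]_n -> R[i]) : schwartz phi -> phi 0 = 1 ->
  fresnel_approx hbar h phi eps @[eps --> 0^'+] -->
    cis (- (pi * n%:R / 4)) * (J / chirp_window hbar g).
Proof.
move=> sp p1.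
apply: (proj2 (@cvg_complexP R R (0 : R)^'+ _ (fresnel_approx hbar h phi)
  (cis (- (pi * n%:R / 4)) * (J / chirp_window hbar g)))).
split; apply/cvg_at_rightP => u [u0 uc].
  by have /cvg_complexP[] := cvg_fresnel_seq sp p1 u0 uc.
by have /cvg_complexP[] := cvg_fresnel_seq sp p1 u0 uc.
Qed.

Lemma fresnelE : fresnel hbar h = cis (- (pi * n%:R / 4)) * (J / chirp_window hbar g).
Proof.
apply: xget_unique; first exact: cvg_fresnel.
move=> z Hz.
(* The defining condition of [fresnel] quantifies over cutoffs, so uniqueness of the value needs at
   least one of them: a Gaussian equal to 1 at 0. *)
have sg : schwartz (fun x : 'rV[R]_n => (1 * gauss (fun=> 1) x)%:C).
  by apply: schwartz_gauss => _; exact: ltr01.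
have g1 : (1 * gauss (fun=> 1) (0 : 'rV[R]_n))%:C = 1 :> R[i] by rewrite gauss0 mulr1.
exact: (cvg_unique (@norm_hausdorff _ _) (Hz _ sg g1) (cvg_fresnel sg g1)).
Qed.

End fresnel_formula.

Lemma atanV (R : realType) (x : R) : 0 < x -> atan x^-1 = pi / 2 - atan x.
Proof.
move=> x0; set a := atan x.
have a1 : - (pi / 2) < a := atan_gtNpi2 x; have a2 : a < pi / 2 := atan_ltpi2 x.
have ca : 0 < cos a by apply: cos_gt0_pihalf; rewrite a1 a2.
have ta : sin a = x * cos a.
  by rewrite -[X in X * _](atanK x) /tan -/a divfK// gt_eqF.
have sa : 0 < sin a by rewrite ta mulr_gt0.
have a0 : 0 < a.
  rewrite ltNge; apply/negP => a_le0; have : 0 <= sin (- a).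
    by apply: sin_ge0_pi; rewrite oppr_ge0 a_le0 /=; have := pi_gt0 R; lra.
  by rewrite sinN oppr_ge0 leNgt sa.
have t : tan (pi / 2 - a) = x^-1.
  rewrite /tan sinB cosB sin_pihalf cos_pihalf !mul0r !mul1r subr0 add0r ta.
  by rewrite invfM mulrCA divff ?mulr1// gt_eqF.
by rewrite -t tanK// in_itv /=; apply/andP; split; have := pi_gt0 R; lra.
Qed.

(** * Chirp integrals of the Gaussian window *)

Section window_chirps.
Context {R : realType}.
Variables (hbar : R) (q : nat -> R).
Hypotheses (h0 : 0 < hbar) (q0 : forall j, 0 < q j).
Local Notation RR := (measurableTypeR R).
Local Notation mu1 := (@lebesgue_measure R).
Local Notation kap n := (@stft_cst R n hbar).
Local Notation win n := (@window R hbar q n).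
Local Notation w := (wcoef hbar q).

(** This is (1 + q_j^2)^(-1/4), in the form in which [cint_gauss_chirp1] produces moduli. *)
Definition chirp_modulus (j : nat) : R := expR (- (ln (1 + q j ^+ 2) / 4)).

Lemma stft_cst1 : kap 1 = (Num.sqrt (2 * pi * hbar))^-1.
Proof.
by rewrite /stft_cst powRN div1r powR12_sqrt// !mulr_ge0 ?pi_ge0// ltW.
Qed.

Lemma stft_cst_prod n : kap n = \prod_(i < n) kap 1.
Proof.
elim: n => [|n IHn]; first by rewrite big_ord0 /stft_cst mul0r oppr0 powRr0.
by rewrite big_ord_recr /= -IHn stft_cstS.
Qed.

(** In essence q^(-1/2) (1 + q^(-2))^(-1/4) = (1 + q^2)^(-1/4), verified on logarithms. *)
Lemma window_chirp_modulus j :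
  kap 1 * (Num.sqrt (pi / w j) * expR (- (ln (1 + (- (2 * hbar)^-1 / w j) ^+ 2) / 4))) =
  chirp_modulus j.
Proof.
have qj := q0 j; have p0 : 0 < 2 * pi * hbar by rewrite !mulr_gt0 ?pi_gt0.
have -> : pi / w j = 2 * pi * hbar / q j by rewrite /wcoef; field; rewrite !gt_eqF.
have -> : - (2 * hbar)^-1 / w j = - (q j)^-1 by rewrite /wcoef; field; rewrite !gt_eqF.
rewrite (@sqrtrM _ (2 * pi * hbar) (q j)^-1) ?ltW// stft_cst1 mulrA mulrA mulVf ?mul1r; last by rewrite gt_eqF// sqrtr_gt0.
have Eq : q j = expR (ln (q j)) by rewrite lnK ?posrE.
have -> : Num.sqrt (q j)^-1 = expR (- (ln (q j) / 2)).
  rewrite -[LHS]ger0_norm ?sqrtr_ge0//; apply/eqP; rewrite -(@eqrXn2 _ 2)// ?expR_ge0//.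
  rewrite real_normK ?num_real// sqr_sqrtr ?invr_ge0 ?ltW// -expRM_natl.
  by rewrite {1}Eq -expRN; apply/eqP; congr expR; field.
rewrite -expRD /chirp_modulus; congr expR.
have -> : 1 + q j ^+ 2 = q j ^+ 2 * (1 + (- (q j)^-1) ^+ 2) by field; rewrite gt_eqF.
rewrite lnM ?posrE ?exprn_gt0//; last by rewrite ltr_pwDl// sqr_ge0.
by rewrite lnXn// mulr2n; field.
Qed.

Lemma chirp_windowE n : chirp_window hbar (win n) =
  \prod_(i < n) ((chirp_modulus i)%:C * cis (- (atan (q i)^-1 / 2))).
Proof.
have wi i : 0 < w i by exact: wcoef_gt0.
have ig : cintegrable (leb R n) (fun x => (gauss (fun i : 'I_n => w i) x)%:C *
    cis (- (2 * hbar)^-1 * dot x x)).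
  apply: (cintegrable_le _ _ (integrable_gauss (fun i : 'I_n => wi i))).
    apply: cmeasM; first exact: (cmeas_real (measurable_gauss _)).
    apply: cmeas_cis; apply: measurable_funM => //.
    by apply: measurable_dot; exact: measurable_id.
  by move=> x; rewrite (normcM _%:C) normc_cis mulr1 normc_R ger0_norm// gauss_ge0.
transitivity ((kap n)%:C * cint (leb R n) (fun x => (gauss (fun i : 'I_n => w i) x)%:C *
    cis (- (2 * hbar)^-1 * dot x x))).
  rewrite -(cintZ _ ig); apply: eq_cint => x; rewrite conjc_window windowE rmorphM /= /chirp.
  have -> : -1 * (dot x x / (2 * hbar)) = - (2 * hbar)^-1 * dot x x by ring.
  by rewrite mulrC mulrA.
rewrite (cint_gauss_chirp _ (fun i : 'I_n => wi i)) stft_cst_prod rmorph_prod -big_split /=.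
apply: eq_bigr => i _; rewrite mulrA -rmorphM /= window_chirp_modulus; congr (_ * cis _).
by rewrite -[RHS]mulNr -atanN; congr (atan _ / 2); rewrite /wcoef; field; rewrite !gt_eqF.
Qed.

Lemma normc_chirp_window n :
  normc (chirp_window hbar (win n)) = \prod_(i < n) chirp_modulus i.
Proof.
rewrite chirp_windowE; elim: n => [|n IHn].
  by rewrite !big_ord0 (normc_R 1) normr1.
rewrite !big_ord_recr /= (normcM (\prod_(i < n) _)) IHn (normcM _%:C) normc_cis mulr1 normc_R.
by rewrite ger0_norm// expR_ge0.
Qed.

Lemma chirp_window_neq0 n : chirp_window hbar (win n) != 0.
Proof.
apply/eqP => E; have : 0 < normc (chirp_window hbar (win n)).
  by rewrite normc_chirp_window; apply: prodr_gt0 => i _; exact: expR_gt0.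
by rewrite E (normc_R 0) normr0 ltxx.
Qed.

(** ln(1 + t) <= t in each factor replaces the product by a sum of q_j^2, bounded in n for a
    summable sequence. *)
Lemma normc_chirp_window_ge n :
  expR (- ((\sum_(j < n) q j ^+ 2) / 4)) <= normc (chirp_window hbar (win n)).
Proof.
rewrite normc_chirp_window mulr_suml -sumrN expR_sum.
apply: ler_prod => i _; rewrite expR_ge0 ler_expR lerN2 ler_pM2r//.
by apply: le_ln1Dx; rewrite (lt_le_trans _ (sqr_ge0 _))// ltrN10.
Qed.

(** The modulus equals that of the factor of [chirp_window] for the variable [j]. In the quotient of
    the two only phases survive when a dummy variable is added. *)
Lemma cint_omega_chirp j :
  cintegrable mu1 (fun eta : RR => cis ((2 * hbar)^-1 * eta ^+ 2) * (omega hbar q j eta)%:C) /\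
  cint mu1 (fun eta : RR => cis ((2 * hbar)^-1 * eta ^+ 2) * (omega hbar q j eta)%:C) =
    (chirp_modulus j)%:C * cis (atan (q j) / 2).
Proof.
pose a := (2 * hbar ^+ 2 * (q j / hbar))^-1.
have a0 : 0 < a by rewrite invr_gt0 !mulr_gt0// ?exprn_gt0 ?invr_gt0.
pose K := kap 1 * (kap 1 * Num.sqrt (pi / w j)).
have oE eta : omega hbar q j eta = K * expR (- (a * eta ^+ 2)) by exact: omegaE.
have mchirp : measurable_fun setT (fun x : R => (2 * hbar)^-1 * x ^+ 2).
  by apply: measurable_funM => //; exact: exprn_measurable.
have ic := cintegrable_gauss_cis a0 mchirp.
have E : (fun eta : RR => cis ((2 * hbar)^-1 * eta ^+ 2) * (omega hbar q j eta)%:C) =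
    (fun eta : RR => K%:C * ((expR (- (a * eta ^+ 2)))%:C * cis ((2 * hbar)^-1 * eta ^+ 2))).
  by apply/funext => eta; rewrite oE rmorphM /= mulrC mulrA.
rewrite E; split; first exact: cintegrableZ.
rewrite (cintZ _ ic) (cint_gauss_chirp1 _ a0) mulrA -rmorphM /=.
have ba : (2 * hbar)^-1 / a = q j by rewrite /a; field; rewrite !gt_eqF.
(* This product is the mass of [omega], already known to be 1. *)
suff S : K * Num.sqrt (pi / a) = 1 by rewrite ba (mulrA K) S mul1r.
have [ig Ig] := integral_gauss a0.
have [io _] := integral_omega h0 q0 j.
suff : (K * Num.sqrt (pi / a))%:E = 1%E :> \bar R by move=> [].
rewrite -io -Ig -(RintegralZl _ measurableT ig) EFin_Rintegral; last exact: (integrableZl measurableT _ ig).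
by apply: eq_integral => eta _; rewrite oE.
Qed.

End window_chirps.

Section window_fresnel.
Context {R : realType}.
Variables (hbar : R) (q : nat -> R).
Hypotheses (h0 : 0 < hbar) (q0 : forall j, 0 < q j).
Local Notation RR := (measurableTypeR R).
Local Notation mu1 := (@lebesgue_measure R).
Local Notation kap n := (@stft_cst R n hbar).
Local Notation win n := (@window R hbar q n).

(** The only use of the change of window: it leads from an arbitrary Schwartz window to the Gaussian
    one, through which membership is handled from here on. *)
Lemma Minf1P n (h : 'rV[R]_n -> R[i]) :
  Minf1 hbar h <-> bcont h /\ (normMinf1 hbar (win n) h < +oo)%E.
Proof.
split=> [[ch bh [g [sg [x0 gx0] foo]]]|[[ch bh] foo]].
  split; first by split.
  have nw := nice_window_window h0 q0 n; rewrite windowE in nw *.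
  exact: (window_change h0 (conj ch bh) (schwartz_nice_window sg) (stft_cst_ge0 hbar)
    (fun i : 'I_n => wcoef_gt0 h0 q0 i) gx0 nw foo).
split=> //; exists (win n); split => //; first exact: schwartz_window.
exists 0; rewrite window0; apply/eqP => /(congr1 (@complex.Re R)) /= E.
by have := stft_cst_gt0 h0 n; rewrite E ltxx.
Qed.

Lemma Minf1_bcont n (h : 'rV[R]_n -> R[i]) : Minf1 hbar h -> bcont h.
Proof. by move/Minf1P => []. Qed.

Lemma Minf1_init n (h : 'rV[R]_n -> R[i]) : Minf1 hbar h ->
  Minf1 hbar (fun y : 'rV[R]_n.+1 => h (row_init y)).
Proof.
move=> /Minf1P[bh foo]; apply/Minf1P; split; first exact: bcont_init.
by rewrite normMinf1_init.
Qed.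

Lemma Minf1_section n (h : 'rV[R]_n.+1 -> R[i]) : Minf1 hbar h ->
  Minf1 hbar (fun t => h (row_rcons t 0)).
Proof.
move=> /Minf1P[bh foo]; apply/Minf1P; split; first exact: bcont_section.
by apply: le_lt_trans foo; exact: normMinf1_section.
Qed.

Lemma Minf1B n (h1 h2 : 'rV[R]_n -> R[i]) : Minf1 hbar h1 -> Minf1 hbar h2 ->
  Minf1 hbar (fun y => h1 y - h2 y).
Proof.
move=> /Minf1P[b1 f1] /Minf1P[b2 f2]; apply/Minf1P; split; first exact: bcontB.
apply: le_lt_trans (normMinf1B hbar b1 b2 (nice_window_window h0 q0 n)) _.
exact: (lte_add_pinfty f1 f2).
Qed.

Lemma Minf1_fresnelE n (h : 'rV[R]_n -> R[i]) : Minf1 hbar h ->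
  fresnel hbar h = cis (- (pi * n%:R / 4)) *
    (chirp_stft hbar (win n) h / chirp_window hbar (win n)).
Proof.
move=> /Minf1P[bh foo].
exact: (fresnelE h0 bh (nice_window_window h0 q0 n) foo (chirp_window_neq0 h0 q0 n)).
Qed.

Let cintegrable_chirp_stft n (h : 'rV[R]_n -> R[i]) : Minf1 hbar h ->
  cintegrable (leb R n) (fun xi => chirp hbar (-1) xi * stft hbar (win n) h (- xi) xi).
Proof.
move=> /Minf1P[bh foo]; have nw := nice_window_window h0 q0 n.
have mid := @measurable_id _ 'rV[R]_n setT.
apply: (cintegrable_le _ _ (integrable_stft_sup bh nw foo)).
  apply: cmeasM; first exact: (cmeas_chirp hbar (-1) mid).
  exact: (cmeas_stft hbar bh nw (measurable_rowN mid) mid).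
by move=> xi; rewrite (normcM (chirp _ _ _)) normc_chirp mul1r; exact: (stft_le_sup hbar bh nw).
Qed.

Lemma fresnelB n (h1 h2 : 'rV[R]_n -> R[i]) : Minf1 hbar h1 -> Minf1 hbar h2 ->
  fresnel hbar (fun y => h1 y - h2 y) = fresnel hbar h1 - fresnel hbar h2.
Proof.
move=> m1 m2; have nw := nice_window_window h0 q0 n.
rewrite (Minf1_fresnelE m1) (Minf1_fresnelE m2) (Minf1_fresnelE (Minf1B m1 m2)).
rewrite -mulrBr -mulrBl; congr (_ * (_ / _)).
rewrite /chirp_stft -(cintB (cintegrable_chirp_stft m1) (cintegrable_chirp_stft m2)).
apply: eq_cint => xi; rewrite stftB ?mulrBr//; exact: Minf1_bcont.
Qed.

Lemma fresnel_le n (h : 'rV[R]_n -> R[i]) : Minf1 hbar h ->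
  ((normc (fresnel hbar h))%:E <=
    (expR ((\sum_(j < n) q j ^+ 2) / 4))%:E * normMinf1 hbar (win n) h)%E.
Proof.
move=> mh; have [bh foo] := proj1 (Minf1P h) mh; have nw := nice_window_window h0 q0 n.
have iF := integrable_stft_sup bh nw foo.
rewrite (normMinf1E hbar bh nw) -(EFin_Rintegral iF) -EFinM lee_fin.
rewrite (Minf1_fresnelE mh) (normcM (cis _)) normc_cis mul1r (normcM (chirp_stft _ _ _)) mulrC.
have [m _] := cintegrable_chirp_stft mh.
apply: ler_pM; [exact: normc_ge0|exact: normc_ge0| |].
  have Dge := normc_chirp_window_ge h0 q0 n.
  have D0 := lt_le_trans (expR_gt0 _) Dge.
  rewrite normcV -[leRHS]invrK -expRN; move: (normc _) D0 Dge => D D0 Dge.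
  by rewrite lef_pV2 ?posrE ?expR_gt0.
apply: normc_cint_le => //.
by move=> xi; rewrite (normcM (chirp _ _ _)) normc_chirp mul1r; exact: (stft_le_sup hbar bh nw).
Qed.

Lemma chirp_stft_init n (h : 'rV[R]_n -> R[i]) : Minf1 hbar h ->
  chirp_stft hbar (win n.+1) (fun y => h (row_init y)) =
  chirp_stft hbar (win n) h * ((chirp_modulus q n)%:C * cis (atan (q n) / 2)).
Proof.
move=> mh; have [bh _] := proj1 (Minf1P h) mh.
have [iu Iu] := cint_omega_chirp h0 q0 n.
have [mf _] := cintegrable_chirp_stft (Minf1_init mh).
rewrite -Iu; apply: (proj2 (cint_row_rconsM mf _ iu (cintegrable_chirp_stft mh))) => t x.
have -> : - row_rcons t x = row_rcons (- t) (- x).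
  have r00 : row_rcons (0 : 'rV[R]_n) 0 = 0.
    by apply: row_rconsP => [|j]; rewrite !mxE.
  by rewrite -[LHS]sub0r -r00 row_rconsB !sub0r.
rewrite (stft_init h0 q0 _ _ _ _ bh) /chirp dot_rcons.
(* The window centre being [- x], the phase in [stft_init] is x^2/hbar; it turns the chirp exponent
   -x^2/(2 hbar) into x^2/(2 hbar), the one in [cint_omega_chirp]. *)
have -> : -1 * ((dot t t + x * x) / (2 * hbar)) =
    -1 * (dot t t / (2 * hbar)) + (2 * hbar)^-1 * x ^+ 2 + (x * - x / hbar).
  by field; rewrite gt_eqF.
have cc : cis (x * - x / hbar) * cis (- (x * - x / hbar)) = 1 :> R[i] by rewrite -cisD subrr cis0.
rewrite !cisD; move: (cis _) (cis _) (cis (x * _ / _)) (cis (- _)) cc (stft _ _ _ _ _) (_%:C).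
by move=> a b c d cc V o; rewrite -[RHS]mul1r -cc; ring.
Qed.

Lemma fresnel_init n (h : 'rV[R]_n -> R[i]) : Minf1 hbar h ->
  fresnel hbar (fun y : 'rV[R]_n.+1 => h (row_init y)) = fresnel hbar h.
Proof.
move=> mh; rewrite (Minf1_fresnelE mh) (Minf1_fresnelE (Minf1_init mh)) (chirp_stft_init mh).
rewrite !chirp_windowE// big_ord_recr /= atanV//.
set P := \prod_(i < n) _.
have P0 : P != 0 by rewrite /P -(chirp_windowE h0 q0 n); exact: chirp_window_neq0.
have C0 : (chirp_modulus q n)%:C != 0.
  by apply/eqP => /(congr1 (@complex.Re R)) /= E; have := expR_gt0 (- (ln (1 + q n ^+ 2) / 4)); rewrite -/(chirp_modulus q n) E ltxx.
(* The extra prefactor exp(-i pi/4) is split into the two half arguments, of total pi/4, contributed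
   by [chirp_window] and by [chirp_stft]; everything cancels. *)
have -> : - (pi * n.+1%:R / 4) = - (pi * n%:R / 4) + - ((pi / 2 - atan (q n)) / 2) - atan (q n) / 2 :> R.
  by rewrite -natr1; field.
have cc : cis (- (atan (q n) / 2)) * cis (atan (q n) / 2) = 1 :> R[i] by rewrite -cisD addNr cis0.
have c0 := cis_neq0 (- ((pi / 2 - atan (q n)) / 2)).
rewrite !cisD; move: (cis (- _)) (cis (- _)) c0 (cis (- (atan (q n) / 2))) (cis (atan _ / 2)) cc (chirp_stft _ _ _).
move=> a b b0 c d cd J; rewrite -[RHS]mulr1 -cd; field.
by rewrite P0 C0 b0.
Qed.

End window_fresnel.

(** * Cylindrical functions and their completion *)

Lemma normc_dist (R : realType) (a b : R[i]) : `|normc a - normc b| <= normc (a - b).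
Proof.
have := le_normcD (a - b) b; have := le_normcD (b - a) a; rewrite !subrK (normcB_sym b a).
by rewrite ler_norml => H1 H2; apply/andP; split; lra.
Qed.

Section cylindrical.
Context {R : realType}.
Implicit Types f : (nat -> R) -> R[i].

(** A name for the sequence at which [cutoff] evaluates its function. *)
Definition pad n (x : 'rV[R]_n) (k : nat) : R := if insub k is Some i then x 0 i else 0.

Lemma pad_ord n (x : 'rV[R]_n) (i : 'I_n) : pad x i = x 0 i.
Proof. by rewrite /pad valK. Qed.

Lemma pad_ge n (x : 'rV[R]_n) k : (n <= k)%N -> pad x k = 0.
Proof. by move=> nk; rewrite /pad insubN// -leqNgt. Qed.

Lemma pad_rcons n (t : 'rV[R]_n) : pad (row_rcons t 0) = pad t.
Proof.
apply/funext => k; have [kn|nk] := ltnP k n.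
  rewrite (pad_ord t (Ordinal kn)) -(row_rcons_widen t 0 (Ordinal kn)) -pad_ord.
  by rewrite -widen_ord_max.
rewrite (pad_ge _ nk); move: nk; rewrite leq_eqVlt => /orP[/eqP <-|nk]; last exact: pad_ge.
have := pad_ord (row_rcons t 0) ord_max; rewrite row_rcons_max; exact.
Qed.

Lemma projn_pad n (x : 'rV[R]_n) : projn n (pad x) = x.
Proof. by apply/rowP => i; rewrite mxE pad_ord. Qed.

Lemma cutoff_cyl n (h : 'rV[R]_n -> R[i]) : @cutoff R n (cyl h) = h.
Proof. by apply/funext => x; congr h; exact: projn_pad. Qed.

Lemma cutoff_section n f : @cutoff R n f = fun t => @cutoff R n.+1 f (row_rcons t 0).
Proof. by apply/funext => t; rewrite /cutoff; congr f; exact: esym (pad_rcons t). Qed.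

Lemma cyl_init n (h : 'rV[R]_n -> R[i]) : cyl (fun y : 'rV[R]_n.+1 => h (row_init y)) = cyl h.
Proof.
apply/funext => x; congr h; apply/rowP => j.
by rewrite !mxE -widen_ord_max.
Qed.

End cylindrical.

Section C0_theory.
Context {R : realType}.
Variables (hbar : R) (q : nat -> R).
Hypotheses (h0 : 0 < hbar) (q0 : forall j, 0 < q j).
Local Notation win n := (@window R hbar q n).
Implicit Types f g : (nat -> R) -> R[i].
Local Notation cnorm := (C0norm hbar q).

(** The cutoff serves as a canonical representative in every large dimension: two representations
    with different numbers of variables are compared through it, adding one dummy variable at a
    time. *)
Lemma represents_cutoff f n (h : 'rV[R]_n -> R[i]) m : represents hbar f h -> (n <= m)%N ->
  [/\ represents hbar f (@cutoff R m f), normMinf1 hbar (win m) (@cutoff R m f) = normMinf1 hbar (win n) h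
    & fresnel hbar (@cutoff R m f) = fresnel hbar h].
Proof.
move=> [n0 mh fE]; elim: m => [|m IHm]; first by rewrite leqNgt n0.
rewrite leq_eqVlt => /orP[/eqP <-|].
  by rewrite fE cutoff_cyl; split.
rewrite ltnS => /IHm[[m0 mm fEm] <- <-].
have -> : @cutoff R m.+1 f = fun y => @cutoff R m f (row_init y).
  by rewrite {1}fEm -cyl_init cutoff_cyl.
split; first by split => //; [exact: (Minf1_init h0 q0)|rewrite cyl_init].
  exact: (normMinf1_init h0 q0 (Minf1_bcont h0 q0 mm)).
exact: (fresnel_init h0 q0 mm).
Qed.

Lemma represents_inj f n (h : 'rV[R]_n -> R[i]) n' (h' : 'rV[R]_n' -> R[i]) :
  represents hbar f h -> represents hbar f h' ->
  normMinf1 hbar (win n) h = normMinf1 hbar (win n') h' /\ fresnel hbar h = fresnel hbar h'.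
Proof.
move=> r r'; have [_ <- <-] := represents_cutoff r (leq_maxl n n').
by have [_ <- <-] := represents_cutoff r' (leq_maxr n n').
Qed.

Lemma C0normE f n (h : 'rV[R]_n -> R[i]) : represents hbar f h -> cnorm f = normMinf1 hbar (win n) h.
Proof.
move=> r; apply: xget_unique => [n' h' r'|y]; first by have [] := represents_inj r r'.
by move=> /(_ n h r).
Qed.

Lemma LminE f n (h : 'rV[R]_n -> R[i]) : represents hbar f h -> Lmin hbar f = fresnel hbar h.
Proof.
move=> r; apply: xget_unique => [n' h' r'|y]; first by have [] := represents_inj r r'.
by move=> /(_ n h r).
Qed.

Lemma C0_cutoff f : C0 hbar f -> exists N, forall m, (N <= m)%N ->
  [/\ represents hbar f (@cutoff R m f), cnorm f = normMinf1 hbar (win m) (@cutoff R m f)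
    & Lmin hbar f = fresnel hbar (@cutoff R m f)].
Proof.
move=> [n [h r]]; exists n => m nm; have [rm nE fE] := represents_cutoff r nm.
by split=> //; [rewrite (C0normE r)|rewrite (LminE r)].
Qed.

Lemma C0B f g : C0 hbar f -> C0 hbar g ->
  C0 hbar (f \- g) /\ Lmin hbar (f \- g) = Lmin hbar f - Lmin hbar g.
Proof.
move=> /C0_cutoff[n nf] /C0_cutoff[m mg].
have [[n0 mf fE] _ Lf] := nf _ (leq_maxl n m); have [[_ mg' gE] _ Lg] := mg _ (leq_maxr n m).
set k := maxn n m in n0 mf fE Lf mg' gE Lg.
have r : represents hbar (f \- g) (fun x => @cutoff R k f x - @cutoff R k g x).
  split; [exact: n0|exact: (Minf1B h0 q0 mf mg')|].
  by apply/funext => x; rewrite {1}fE {1}gE.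
split; first by exists k; eexists; exact: r.
by rewrite (LminE r) (fresnelB h0 q0 mf mg') Lf Lg.
Qed.

(** From a dimension [n + d] in which the cutoff represents [f], and so carries its norm, one
    descends to [n] by setting the last variable to 0, d times. *)
Lemma Minf1_cutoff f n : C0 hbar f ->
  Minf1 hbar (@cutoff R n f) /\ (normMinf1 hbar (win n) (@cutoff R n f) <= cnorm f)%E.
Proof.
move=> /C0_cutoff[N HN].
have [d dE] : exists d, (N <= n + d)%N by exists N; exact: leq_addl.
elim: d n dE => [|d IHd] n.
  by rewrite addn0 => /HN[[_ mf _] -> _].
rewrite addnS -addSn => /IHd[mf nf]; rewrite cutoff_section; split.
  exact: (Minf1_section h0 q0).
by apply: le_trans nf; exact: (normMinf1_section h0 q0 (Minf1_bcont h0 q0 mf)).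
Qed.

(** The window at 0 equals the constant in [normc_mul_window_le], so the embedding into bounded
    functions has norm at most 1 whatever the number of variables. *)
Lemma normc_le_C0norm f x : C0 hbar f -> ((normc (f x))%:E <= cnorm f)%E.
Proof.
move=> /C0_cutoff[N /(_ _ (leqnn N))[[_ mf fE] -> _]]; rewrite {1}fE /cyl.
have bf := Minf1_bcont h0 q0 mf; have k0 := stft_cst_gt0 h0 N.
have := normc_mul_window_le h0 bf (nice_window_window h0 q0 N) (projn N x) (projn N x).
rewrite subrr window0 normc_R (gtr0_norm k0) mulrC EFinM.
by rewrite lee_pmul2l// lte_fin.
Qed.

Lemma normc_Lmin_le (S : R) f : (forall n, \sum_(j < n) q j ^+ 2 <= S) -> C0 hbar f ->
  ((normc (Lmin hbar f))%:E <= (expR (S / 4))%:E * cnorm f)%E.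
Proof.
move=> qS /C0_cutoff[N /(_ _ (leqnn N))[[_ mf _] -> ->]].
apply: le_trans (fresnel_le h0 q0 mf) _.
have nw := nice_window_window h0 q0 N; have bf := Minf1_bcont h0 q0 mf.
apply: lee_wpmul2r.
  by rewrite (normMinf1E hbar bf nw); apply: integral_ge0 => xi _; rewrite lee_fin stft_sup_ge0.
by rewrite lee_fin ler_expR ler_pM2r.
Qed.

Lemma C0norm_subrr f : C0 hbar f -> cnorm (f \- f) = 0%E.
Proof.
move=> cf; have [[n [h r]] _] := C0B cf cf; rewrite (C0normE r).
have [_ mh E] := r; have bh := Minf1_bcont h0 q0 mh; have nw := nice_window_window h0 q0 n.
have hz x : normc (h x) <= 0.
  have -> : h x = 0 by rewrite -(cutoff_cyl h) -E /cutoff /= subrr.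
  by rewrite (normc_R 0) normr0.
rewrite (normMinf1E hbar bh nw); apply: integral0_eq => xi _; congr (_%:E).
apply/eqP; rewrite eq_le (stft_sup_ge0 hbar bh nw) andbT; apply: stft_sup_le => x.
by apply: le_trans (stft_le hbar x xi bh nw hz) _; rewrite mul0r mulr0.
Qed.

(** Lower semicontinuity of the norm. For fixed centre and frequency the transforms converge, so the
    supremum for the limit is at most the lower limit of the suprema, which Fatou integrates over
    the frequencies. *)
Lemma C0norm_fatou n (h_ : nat -> 'rV[R]_n -> R[i]) h (C e : R) :
  (forall k, bcont (h_ k)) -> bcont h -> (forall k y, normc (h_ k y) <= C) ->
  (forall y, h_ k y @[k --> \oo] --> h y) ->
  (forall k, normMinf1 hbar (win n) (h_ k) <= e%:E)%E ->
  (normMinf1 hbar (win n) h <= e%:E)%E.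
Proof.
move=> bh_ bh hC h_h ne; have nw := nice_window_window h0 q0 n.
pose F k xi := (stft_sup hbar (win n) (h_ k) xi)%:E.
have F0 k xi : (0 <= F k xi)%E by rewrite lee_fin (stft_sup_ge0 hbar (bh_ k) nw).
have mF k : measurable_fun setT (F k).
  by apply/measurable_EFinP; exact: (measurable_stft_sup hbar (bh_ k) nw).
have le_inf xi : ((stft_sup hbar (win n) h xi)%:E <= limn_einf (F^~ xi))%E.
  rewrite -(stft_sup_ereal hbar bh nw); apply: ge_ereal_sup => _ [x _ <-].
  have cV := @stft_cvg_fun R n hbar (win n) h_ h C x xi bh_ bh nw hC h_h.
  pose v k := (normc (stft hbar (win n) (h_ k) x xi))%:E.
  have cv : v k @[k --> \oo] --> (normc (stft hbar (win n) h x xi))%:E.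
    apply: cvg_EFin; first exact: nearW.
    apply: (cvg_dist_le (g := fun k => normc (stft hbar (win n) (h_ k) x xi - stft hbar (win n) h x xi))).
      by move=> k; exact: normc_dist.
    exact/cvg_normcP.
  have [<- _] := cvg_limn_einf_sup cv.
  rewrite !limn_einf_lim; apply: lee_lim; try exact: is_cvg_einfs.
  apply: nearW => k; apply: le_ereal_inf_tmp => _ [j /= kj <-].
  apply: (@le_trans _ _ (v j)); last by rewrite lee_fin (stft_le_sup hbar (bh_ j) nw).
  by apply: ereal_inf_lbound; exists j.
rewrite (normMinf1E hbar bh nw).
apply: (@le_trans _ _ (\int[leb R n]_xi limn_einf (F^~ xi))%E).
  apply: ge0_le_integral => //.
  - by move=> xi _; rewrite lee_fin (stft_sup_ge0 hbar bh nw).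
  - by apply/measurable_EFinP; exact: (measurable_stft_sup hbar bh nw).
  - apply: (measurableT_comp (@oppe_measurable R setT)).
    by apply: measurable_fun_limn_esup => k; exact: (measurableT_comp (@oppe_measurable R setT) (mF k)).
apply: le_trans (fatou _ _ mF _) _ => //.
rewrite limn_einf_lim; apply: lime_le; first exact: is_cvg_einfs.
apply: nearW => k; apply: le_trans (ne k); rewrite (normMinf1E hbar (bh_ k) nw).
by apply: ereal_inf_lbound; exists k => //=.
Qed.

End C0_theory.

Section complex_sequences.
Context {R : realType}.
Implicit Types (u : nat -> R[i]) (z : R[i]).

Lemma normc_triangle (a b c : R[i]) : normc (a - c) <= normc (a - b) + normc (b - c).
Proof. by have := le_normcD (a - b) (b - c); rewrite addrA subrK. Qed.

Lemma cvg_normc_le u z :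
  (forall e : R, 0 < e -> exists N, forall k, (N <= k)%N -> normc (u k - z) <= e) ->
  u k @[k --> \oo] --> z.
Proof.
move=> H; apply/cvg_normcP/cvgrPdist_le => e e0; have [N HN] := H e e0.
by exists N => // k /= Nk; rewrite sub0r normrN ger0_norm ?normc_ge0// HN.
Qed.

Lemma normc_lt_cvg u z (e : R) : u k @[k --> \oo] --> z -> 0 < e ->
  exists N, forall k, (N <= k)%N -> normc (u k - z) < e.
Proof.
move=> /cvg_normcP/cvgrPdist_lt H e0; have [N _ HN] := H e e0; exists N => k Nk.
by have := HN k Nk; rewrite /= sub0r normrN ger0_norm ?normc_ge0.
Qed.

Lemma complex_cauchy u :
  (forall e : R, 0 < e -> exists N, forall k l, (N <= k)%N -> (N <= l)%N -> normc (u k - u l) < e) ->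
  exists z, u k @[k --> \oo] --> z.
Proof.
move=> H.
have real_case (p : R[i] -> R) : (forall z w, `|p z - p w| <= normc (z - w)) ->
    exists l : R, p (u k) @[k --> \oo] --> l.
  move=> p_le.
  have c : cvg ((fun k => p (u k)) @ \oo).
    apply: R_complete; apply: cauchy_exP => e e0; have [N HN] := H e e0.
    exists (p (u N)); exists N => // k /= Nk; rewrite -ball_normE /=.
    by apply: le_lt_trans (p_le _ _) _; exact: HN.
  by exists (lim ((fun k => p (u k)) @ \oo)).
have [a ua] : exists l : R, Re (u k) @[k --> \oo] --> l.
  by apply: real_case => z w; rewrite -ReB; exact: Re_le_normc.
have [b ub] : exists l : R, Im (u k) @[k --> \oo] --> l.
  by apply: real_case => z w; rewrite -ImB; exact: Im_le_normc.
by exists (a +i* b); apply/cvg_complexP.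
Qed.

End complex_sequences.

(** * The completion of the cylindrical functions *)

Section completion.
Context {R : realType}.
Variables (hbar : R) (q : nat -> R).
Hypotheses (h0 : 0 < hbar) (q0 : forall j, 0 < q j).
Hypothesis q_summable : cvg (series (fun j => q j ^+ 2) @ \oo).
Local Notation win n := (@window R hbar q n).
Local Notation cnorm := (C0norm hbar q).

Let K : R := expR (limn (series (fun j => q j ^+ 2)) / 4).

Let K0 : 0 < K := expR_gt0 _.

Let sum_le n : \sum_(j < n) q j ^+ 2 <= limn (series (fun j => q j ^+ 2)).
Proof.
rewrite -(big_mkord xpredT (fun j => q j ^+ 2)).
apply: (nondecreasing_cvgn_le (u_ := series (fun j => q j ^+ 2))) => //.
by apply: nondecreasing_series => j _ _; exact: sqr_ge0.
Qed.

Let normc_Lmin f : C0 hbar f -> ((normc (Lmin hbar f))%:E <= K%:E * cnorm f)%E.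
Proof.
exact: normc_Lmin_le. Qed.

Lemma normc_C0_lt (f g : (nat -> R) -> R[i]) (e : R) x : C0 hbar f -> C0 hbar g ->
  (cnorm (f \- g)%R < e%:E)%E -> normc (f x - g x) < e.
Proof.
move=> cf cg fe; rewrite -lte_fin; apply: le_lt_trans fe.
exact: (normc_le_C0norm h0 q0 x (proj1 (C0B h0 q0 cf cg))).
Qed.

Lemma normc_Lmin_lt (f g : (nat -> R) -> R[i]) (e : R) : C0 hbar f -> C0 hbar g ->
  (cnorm (f \- g)%R < e%:E)%E -> normc (Lmin hbar f - Lmin hbar g) < K * e.
Proof.
move=> cf cg fe; have [cfg <-] := C0B h0 q0 cf cg.
rewrite -lte_fin EFinM; apply: le_lt_trans (normc_Lmin cfg) _.
by rewrite lte_pmul2l// lte_fin.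
Qed.

Variable u : nat -> (nat -> R) -> R[i].
Hypothesis cu : C0cauchy hbar q u.
Local Notation F := [set v | C0cauchy hbar q v /\ C0equiv hbar q u v].

Let C0u k : C0 hbar (u k). Proof. by have [] := cu. Qed.

Let class_refl : F u.
Proof.
split=> //; rewrite /C0equiv.
by under eq_fun do rewrite (C0norm_subrr h0 q0 (C0u _)); exact: cvg_cst.
Qed.

Let class_lt v (e : R) : F v -> 0 < e ->
  (forall k, C0 hbar (v k)) /\ exists N, forall k, (N <= k)%N -> (cnorm (u k \- v k)%R < e%:E)%E.
Proof.
move=> [[cv _] uv] e0; split=> //.
have nb : nbhs (0%E : \bar R) [set y | (y < e%:E)%E].
  by apply: open_nbhs_nbhs; split; [exact: open_ereal_lt_ereal|rewrite /= lte_fin].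
by have [N _ HN] := uv _ nb; exists N.
Qed.

Lemma DLfun_cvg x : u k x @[k --> \oo] --> DLfun F x.
Proof.
have [z uz] : exists z : R[i], u k x @[k --> \oo] --> z.
  apply: complex_cauchy => e e0; have [_ /(_ e e0)[N HN]] := cu; exists N => k l Nk Nl.
  by apply: normc_C0_lt => //; exact: HN.
(* The value selected by [xget] has to be the limit along every member of the class; another member
   is compared with [u] through the uniform bound. *)
suff -> : DLfun F x = z by [].
apply: xget_unique => [v Fv|y]; last first.
  by move=> /(_ u class_refl) uy; exact: (cvg_unique (@norm_hausdorff _ _) uy uz).
apply: cvg_normc_le => e e0; have e2 : 0 < e / 2 by rewrite divr_gt0.
have [cv [N HN]] := class_lt Fv e2; have [M HM] := normc_lt_cvg uz e2.
exists (maxn N M) => k; rewrite geq_max => /andP[Nk Mk].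
have := normc_C0_lt x (C0u k) (cv k) (HN k Nk); have := HM k Mk.
have := normc_triangle (v k x) (u k x) z; rewrite (normcB_sym (v k x) (u k x)).
by move=> *; lra.
Qed.

Lemma L_cvg : Lmin hbar (u k) @[k --> \oo] --> L hbar F.
Proof.
have Ke (e : R) : 0 < e -> 0 < e / 2 / K by move=> e0; rewrite !divr_gt0.
have KK (e : R) : K * (e / 2 / K) = e / 2 by rewrite mulrC divfK// gt_eqF.
have [z uz] : exists z : R[i], Lmin hbar (u k) @[k --> \oo] --> z.
  apply: complex_cauchy => e e0; have [_ /(_ _ (Ke e e0))[N HN]] := cu; exists N => k l Nk Nl.
  have := normc_Lmin_lt (C0u k) (C0u l) (HN k l Nk Nl).
  by rewrite KK => /lt_trans; apply; lra.
(* As for [DLfun], with boundedness of [Lmin] in place of the uniform bound; the tolerance e/2/K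
   absorbs its constant. *)
suff -> : L hbar F = z by [].
apply: xget_unique => [v Fv|y]; last first.
  by move=> /(_ u class_refl) uy; exact: (cvg_unique (@norm_hausdorff _ _) uy uz).
apply: cvg_normc_le => e e0; have e2 : 0 < e / 2 by rewrite divr_gt0.
have [cv [N HN]] := class_lt Fv (Ke e e0); have [M HM] := normc_lt_cvg uz e2.
exists (maxn N M) => k; rewrite geq_max => /andP[Nk Mk].
have := normc_Lmin_lt (C0u k) (cv k) (HN k Nk); rewrite KK; have := HM k Mk.
have := normc_triangle (Lmin hbar (v k)) (Lmin hbar (u k)) z.
rewrite (normcB_sym (Lmin hbar (v k)) (Lmin hbar (u k))).
by move=> *; lra.
Qed.

Local Notation f := (DLfun F).

Lemma DLfun_dist (e : R) N l x : (forall k l, (N <= k)%N -> (N <= l)%N -> (cnorm (u k \- u l)%R < e%:E)%E) ->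
  (N <= l)%N -> normc (u l x - f x) <= e.
Proof.
move=> HN Nl; apply/ler_addgt0Pr => d d0; have [M HM] := normc_lt_cvg (@DLfun_cvg x) d0.
have := HM _ (leq_maxr N M); have := normc_C0_lt x (C0u l) (C0u _) (HN _ _ Nl (leq_maxl N M)).
have := normc_triangle (u l x) (u (maxn N M) x) (f x).
by move=> *; lra.
Qed.

(** The cutoffs of the [u k] converge uniformly, so boundedness and continuity pass to the limit. *)
Lemma bcont_cutoff_DLfun n : bcont (@cutoff R n f).
Proof.
have bu k : bcont (@cutoff R n (u k)) := Minf1_bcont h0 q0 (proj1 (Minf1_cutoff h0 q0 n (C0u k))).
have [_ Hu] := cu; split; last first.
  have [N HN] := Hu 1 ltr01; have [_ [C HC]] := bu N; exists (C + 1) => x.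
  have := HC x; have := DLfun_dist (pad x) HN (leqnn N).
  have := le_normcD (f (pad x) - u N (pad x)) (u N (pad x)); rewrite subrK normcB_sym /cutoff.
  by rewrite -/(pad x) => *; lra.
apply: continuous_seq => v x vx; apply: cvg_normc_le => e e0.
have e3 : 0 < e / 3 by rewrite divr_gt0.
have [N HN] := Hu _ e3; have [cN _] := bu N.
have [M HM] := normc_lt_cvg (cvg_continuous_complex cN vx) e3.
exists M => k Mk.
have := HM k Mk; rewrite /cutoff -!/(pad _).
have := DLfun_dist (pad x) HN (leqnn N); have := DLfun_dist (pad (v k)) HN (leqnn N).
have := normc_triangle (f (pad (v k))) (u N (pad (v k))) (f (pad x)).
have := normc_triangle (u N (pad (v k))) (u N (pad x)) (f (pad x)).
rewrite (normcB_sym (f (pad (v k))) (u N _)).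
by move=> *; lra.
Qed.

Lemma cutoff_DLfun_dist (e : R) N l n :
  (forall k l, (N <= k)%N -> (N <= l)%N -> (cnorm (u k \- u l)%R < e%:E)%E) -> (N <= l)%N ->
  Minf1 hbar (fun x => @cutoff R n (u l) x - @cutoff R n f x) /\
  (normMinf1 hbar (win n) (fun x => @cutoff R n (u l) x - @cutoff R n f x)%R <= e%:E)%E.
Proof.
move=> HN Nl.
have bu k : bcont (@cutoff R n (u k)) := Minf1_bcont h0 q0 (proj1 (Minf1_cutoff h0 q0 n (C0u k))).
have bd := bcontB (bu l) (bcont_cutoff_DLfun n).
have Nk k : (N <= N + k)%N by exact: leq_addr.
have cd k : C0 hbar (u l \- u (N + k)%N) := proj1 (C0B h0 q0 (C0u l) (C0u _)).
suff ne : (normMinf1 hbar (win n) (fun x => @cutoff R n (u l) x - @cutoff R n f x)%R <= e%:E)%E.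
  split=> //; apply/(Minf1P h0 q0); split => //.
  by apply: le_lt_trans ne _; rewrite ltry.
(* Starting the sequence at [N] makes every term satisfy the Cauchy bound. The same [e] then bounds
   the norms and, through the embedding, the functions themselves. *)
apply: (C0norm_fatou h0 q0 (h_ := fun k => @cutoff R n (u l \- u (N + k)%N)) (C := e)).
- by move=> k; exact: (bcontB (bu l) (bu _)).
- exact: bd.
- by move=> k y; apply/ltW; apply: (normc_C0_lt _ (C0u l) (C0u _)); exact: HN.
- move=> y; rewrite /cutoff -/(pad y).
  have lim : u (N + k)%N (pad y) @[k --> \oo] --> f (pad y).
    by have := @DLfun_cvg (pad y); rewrite -(cvg_shiftn N); under eq_fun do rewrite addnC.
  apply: cvg_normc_le => d d0; have [M HM] := normc_lt_cvg lim d0; exists M => k Mk.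
  have E : f (pad y) - u (N + k)%N (pad y) =
      (u l (pad y) - u (N + k)%N (pad y)) - (u l (pad y) - f (pad y)) by ring.
  by have := HM k Mk; rewrite normcB_sym E => /ltW.
- move=> k; have [_ le_n] := Minf1_cutoff h0 q0 n (cd k).
  by apply: le_trans le_n _; exact: ltW (HN _ _ Nl (Nk k)).
Qed.

Lemma Minf1_cutoff_DLfun n : Minf1 hbar (@cutoff R n f).
Proof.
have [_ /(_ 1 ltr01)[N HN]] := cu.
have [md _] := cutoff_DLfun_dist n HN (leqnn N).
have [mu _] := Minf1_cutoff h0 q0 n (C0u N).
(* f^(n) is recovered as u_N^(n) - (u_N^(n) - f^(n)), a difference of two members. *)
have := Minf1B h0 q0 mu md; congr (Minf1 _ _); apply/funext => x.
by rewrite opprB addrC subrK.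
Qed.

Lemma fresnel_cutoff_cvg : fresnel hbar (@cutoff R n f) @[n --> \oo] --> L hbar F.
Proof.
apply: cvg_normc_le => e e0.
have e2 : 0 < e / 2 by rewrite divr_gt0.
have Ke : 0 < e / 2 / K by rewrite divr_gt0.
have [_ /(_ _ Ke)[N HN]] := cu; have [M HM] := normc_lt_cvg L_cvg e2.
have Nl := leq_maxl N M; have := HM _ (leq_maxr N M).
(* The index [l] is fixed before [P]: the number of variables of [u l] may be unbounded in l, so n
   can be chosen large only afterwards. *)
set l := maxn N M in Nl * => Ll; have [P HP] := C0_cutoff h0 q0 (C0u l).
exists P => n /HP[_ _ LE]; have [md nd] := cutoff_DLfun_dist n HN Nl.
have [mu _] := Minf1_cutoff h0 q0 n (C0u l).
have : normc (Lmin hbar (u l) - fresnel hbar (@cutoff R n f)) <= e / 2.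
  rewrite LE -(fresnelB h0 q0 mu (Minf1_cutoff_DLfun n)) -lee_fin.
  apply: le_trans (fresnel_le h0 q0 md) _.
  have -> : e / 2 = K * (e / 2 / K) by rewrite [RHS]mulrC divfK// gt_eqF.
  apply: le_trans (lee_wpmul2l (ltW K0 : (0 <= K%:E)%E) nd).
  have bd := Minf1_bcont h0 q0 md; have nw := nice_window_window h0 q0 n.
  apply: lee_wpmul2r.
    rewrite (normMinf1E hbar bd nw); apply: integral_ge0 => xi _.
    by rewrite lee_fin (stft_sup_ge0 hbar bd nw).
  by rewrite lee_fin ler_expR ler_pM2r.
have := normc_triangle (fresnel hbar (@cutoff R n f)) (Lmin hbar (u l)) (L hbar F).
rewrite (normcB_sym (fresnel hbar (@cutoff R n f)) (Lmin hbar (u l))).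
by move=> *; lra.
Qed.

End completion.

Theorem theorem6p4 (R : realType) (hbar : R) (hbar_gt0 : 0 < hbar)
    (hbar_le1 : hbar <= 1) (q : nat -> R) (q_gt0 : forall j, 0 < q j)
    (q_sqr_summable : cvg (series (fun j => q j ^+ 2) @ \oo))
    (f : set (nat -> (nat -> R) -> R[i])) (f_DL : DL hbar q f) :
  DL' hbar (DLfun f) /\ L' hbar (DLfun f) = L hbar f.
Proof.
case: f_DL => u cu ->.
have lim := fresnel_cutoff_cvg hbar_gt0 q_gt0 q_sqr_summable cu.
split; last exact: (cvg_lim (@norm_hausdorff _ _) lim).
split; last by apply/cvg_ex; eexists; exact: lim.
by move=> n _; exact: (Minf1_cutoff_DLfun hbar_gt0 q_gt0 cu n).
Qed.
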